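(* Let $(\Omega,\mathcal A,\mu)$ be a $\sigma$-finite measure space with $\mu(\Omega)=\infty$, and let $X=(X(\Omega),\|\cdot\|_X)$ be a fully symmetric space on $(\Omega,\mathcal A,\mu)$. (a) If the norm $\|\cdot\|_X$ is order continuous and $X\nsubseteq L^1(\Omega)$, then the averages $M_n(T)$ converge strongly in $X$ for each $T\in DS$. (b) If $(\Omega,\mathcal A,\mu)$ is quasi-non-atomic and the averages $M_n(T)$ converge strongly in $X$ for every $T\in DS$, then the norm $\|\cdot\|_X$ is order continuous and $X\nsubseteq L^1(\Omega)$.
   Context: All measure spaces are complete. $(\Omega,\mathcal A,\mu)$ is quasi-non-atomic if it has finitely many (possibly no) atoms or all its atoms have the same measure. $L^0=L^0(\Omega)$ is the algebra of (classes of) a.e. finite real-valued measurable functions on $\Omega$; $L^p=L^p(\Omega)$, $1\le p\le\infty$, are the real $L^p$-spaces. $L^0_\mu$ is the set of $f\in L^0$ with $\mu\{|f|>\lambda\}<\infty$ for some $\lambda>0$. For $f\in L^0_\mu$, $f^*(t)=\inf\{\lambda>0:\mu\{|f|>\lambda\}\le t\}$, $t>0$. Let $\nu$ be Lebesgue measure on $(0,\infty)$. A nonzero linear subspace $X\subset L^0_\nu$ with a Banach norm $\|\cdot\|_X$ is fully symmetric on $((0,\infty),\nu)$ if $f\in X$, $g\in L^0_\nu$ and $\int_0^s g^*(t)\,dt\le\int_0^s f^*(t)\,dt$ for all $s>0$ imply $g\in X$ and $\|g\|_X\le\|f\|_X$. A fully symmetric space on $(\Omega,\mathcal A,\mu)$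 is a space $X(\Omega)=\{f\in L^0_\mu: f^*\in X\}$ with norm $\|f\|_{X(\Omega)}=\|f^*\|_X$, where $X$ is a fully symmetric space on $((0,\infty),\nu)$. The norm of $X(\Omega)$ is order continuous if $\|f_\alpha\|_{X(\Omega)}\downarrow0$ for every net $f_\alpha\in X(\Omega)$ with $f_\alpha\downarrow0$. $T\in DS$ means $T:L^1+L^\infty\to L^1+L^\infty$ is linear with $\|T(f)\|_1\le\|f\|_1$ for all $f\in L^1$ and $\|T(f)\|_\infty\le\|f\|_\infty$ for all $f\in L^\infty$; such $T$ maps $X(\Omega)$ into itself contractively. $M_n(T)=\frac1n\sum_{k=0}^{n-1}T^k$. The averages $M_n(T)$ converge strongly in $X$ if for each $f\in X$ there is $\widehat f\in X$ with $\|M_n(T)(f)-\widehat f\|_X\to0$. *)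

(* Defs.v *)
From HB Require Import structures.
From mathcomp Require Import all_boot all_order all_algebra.
From mathcomp Require Import all_classical all_reals all_analysis.

Set Implicit Arguments.
Unset Strict Implicit.
Unset Printing Implicit Defensive.
Import Order.TTheory GRing.Theory Num.Theory.
Import numFieldNormedType.Exports.
Local Open Scope classical_set_scope.
Local Open Scope ring_scope.

(* Classes of measurable functions are handled through their representatives:
   a space of classes is a set of everywhere defined real functions closed
   under a.e. equality, and all identities and inequalities between classes are
   required almost everywhere only.  Every class of a.e. finite functions has an
   everywhere finite representative. *)

Section rearrangement.
Context {R : realType} {d : measure_display} {T : measurableType d}.
Variables (mu : {measure set T -> \bar R}) (D : set T).

Definition dist_fun (f : T -> R) (l : R) : \bar R :=
  mu (D `&` [set x | l < `|f x|]).

Definition L0mu : set (T -> R) :=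
  [set f | measurable_fun D f /\
    exists2 l : R, 0 < l & (dist_fun f l < +oo)%E].

(* For f in L0mu and t > 0 the set below is nonempty and bounded below, so that
   the real-valued inf is the true infimum; other t are irrelevant. *)
Definition rearr (f : T -> R) (t : R) : R :=
  inf [set l : R | 0 < l /\ (dist_fun f l <= t%:E)%E].

End rearrangement.

Section half_line.
Variable R : realType.

(* The real line with the complete sigma-algebra of Lebesgue measurable sets.
   Functions on (0, +oo) are functions on the line, considered on halfline. *)
Definition lebesgueType : measurableType _ :=
  caratheodory_type ((@wlength R idfun)^*)%mu.

Definition nu : {measure set lebesgueType -> \bar R} :=
  @completed_lebesgue_measure R.

Definition halfline : set lebesgueType := [set t : R | 0 < t].

Definition submajorized (g f : lebesgueType -> R) : Prop :=
  forall s : R, 0 < s ->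
   (\int[nu]_(t in [set t : R | (0 < t < s)%R]) (rearr nu halfline g t)%:E <=
    \int[nu]_(t in [set t : R | (0 < t < s)%R]) (rearr nu halfline f t)%:E)%E.

Record fully_symmetric (X : set (lebesgueType -> R))
    (normX : (lebesgueType -> R) -> R) : Prop := FullySymmetric {
  fs_sub : X `<=` L0mu nu halfline ;
  fs_ae : forall f g, X f -> measurable_fun halfline g ->
    ae_eq nu halfline f g -> X g /\ normX g = normX f ;
  fs_0 : X (cst 0) ;
  fs_D : forall f g, X f -> X g -> X (f \+ g) ;
  fs_Z : forall (a : R) f, X f -> X (fun t => a * f t) ;
  fs_nonzero : exists2 f, X f & ~ ae_eq nu halfline f (cst 0) ;
  fs_norm_ge0 : forall f, X f -> 0 <= normX f ;
  fs_norm_eq0 : forall f, X f -> normX f = 0 -> ae_eq nu halfline f (cst 0) ;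
  fs_normD : forall f g, X f -> X g -> normX (f \+ g) <= normX f + normX g ;
  fs_normZ : forall (a : R) f, X f ->
    normX (fun t => a * f t) = `|a| * normX f ;
  fs_complete : forall u : nat -> lebesgueType -> R,
    (forall n, X (u n)) ->
    (forall e : R, 0 < e -> exists N : nat, forall m n : nat,
       (N <= m)%N -> (N <= n)%N -> normX (u m \- u n) < e) ->
    exists2 f, X f & normX (u n \- f) @[n --> \oo] --> (0 : R) ;
  fs_symmetric : forall f g, X f -> L0mu nu halfline g -> submajorized g f ->
    X g /\ normX g <= normX f
}.

End half_line.

Section spaces_on_Omega.
Context {R : realType} {d : measure_display} {T : measurableType d}.
Variable mu : {measure set T -> \bar R}.

Definition space_on (X : set (lebesgueType R -> R)) : set (T -> R) :=
  [set f | L0mu mu setT f /\ X (rearr mu setT f)].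

Definition norm_on (normX : (lebesgueType R -> R) -> R) (f : T -> R) : R :=
  normX (rearr mu setT f).

Definition L1 : set (T -> R) := [set f | f \in Lfun mu 1%E].

Definition L1Linf : set (T -> R) :=
  [set f | exists g h : T -> R,
    [/\ g \in Lfun mu 1%E, h \in Lfun mu +oo%E & f = g \+ h]].

Record DS (U : (T -> R) -> (T -> R)) : Prop := DunfordSchwartz {
  DS_stable : forall f, L1Linf f -> L1Linf (U f) ;
  DS_ae : forall f g, L1Linf f -> L1Linf g ->
    ae_eq mu setT f g -> ae_eq mu setT (U f) (U g) ;
  DS_linear : forall (a : R) f g, L1Linf f -> L1Linf g ->
    ae_eq mu setT (U (fun x => a * f x + g x)) (fun x => a * U f x + U g x) ;
  DS_L1 : forall f, f \in Lfun mu 1%E ->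
    ('N[mu]_1[EFin \o U f] <= 'N[mu]_1[EFin \o f])%E ;
  DS_Linf : forall f, f \in Lfun mu +oo%E ->
    ('N[mu]_+oo[EFin \o U f] <= 'N[mu]_+oo[EFin \o f])%E
}.

Definition average (U : (T -> R) -> (T -> R)) (n : nat) (f : T -> R) : T -> R :=
  fun x => n%:R^-1 * \sum_(k < n) iter k U f x.

Definition averages_converge_strongly (Y : set (T -> R)) (N : (T -> R) -> R)
    (U : (T -> R) -> (T -> R)) : Prop :=
  forall f, Y f -> exists2 fhat, Y fhat &
    N (average U n f \- fhat) @[n --> \oo] --> (0 : R).

Record directed (I : Type) (le : I -> I -> Prop) : Prop := Directed {
  directed_inh : inhabited I ;
  directed_refl : forall i, le i i ;
  directed_trans : forall i j k, le i j -> le j k -> le i k ;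
  directed_ub : forall i j, exists k, le i k /\ le j k
}.

(* The infimum of an uncountable net is that of the lattice Y of classes; it
   need not be the pointwise one. *)
Definition decreases_to_0 (Y : set (T -> R)) (I : Type) (le : I -> I -> Prop)
    (f : I -> T -> R) : Prop :=
  [/\ forall i j, le i j -> {ae mu, forall x, f j x <= f i x},
      forall i, {ae mu, forall x, 0 <= f i x} &
      forall g, Y g -> (forall i, {ae mu, forall x, g x <= f i x}) ->
        {ae mu, forall x, g x <= 0}].

Definition order_continuous (Y : set (T -> R)) (N : (T -> R) -> R) : Prop :=
  forall (I : Type) (le : I -> I -> Prop) (f : I -> T -> R),
    directed le -> (forall i, Y (f i)) -> decreases_to_0 Y le f ->
    (forall i j, le i j -> N (f j) <= N (f i)) /\
    inf [set N (f i) | i in [set: I]] = 0.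

Definition atom (A : set T) : Prop :=
  [/\ measurable A, (0 < mu A)%E &
      forall B, measurable B -> B `<=` A -> mu B = 0%E \/ mu (A `\` B) = 0%E].

(* Atoms are counted up to null sets. *)
Definition finitely_many_atoms : Prop :=
  exists S : set (set T), [/\ finite_set S, S `<=` atom &
    forall A, atom A -> exists2 B, S B & mu (A `+` B) = 0%E].

Definition quasi_non_atomic : Prop :=
  finitely_many_atoms \/ (forall A B, atom A -> atom B -> mu A = mu B).

End spaces_on_Omega.

(* Main.v *)
Require Import Defs.
From HB Require Import structures.
From mathcomp Require Import all_boot all_order all_algebra.
From mathcomp Require Import all_classical all_reals all_analysis.
From mathcomp Require Import measurable_realfun ess_sup_inf ring lra.
Import Order.TTheory GRing.Theory Num.Theory.
Import numFieldNormedType.Exports.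
Local Open Scope classical_set_scope.
Local Open Scope ring_scope.
Set Implicit Arguments.
Unset Strict Implicit.
Unset Printing Implicit Defensive.

(** A function [f] enters only through its excess integrals
    [Phi f l], the integral of [max (|f| - l) 0], because the integral [Kf f s]
    of the rearrangement of [f] over [(0, s)] is the minimum over [l] of
    [s l + Phi f l], attained at [l = f^* s].  Splitting [f] at height [l] shows
    that an operator in DS decreases every [Phi f l], hence contracts the space.

    (a) Order continuity makes the bounded functions with support of finite
    measure dense.  For such [f] the averages are Cauchy in L2: the norms of the
    averages, and of the midpoints of two averages, have the same infimum, and
    the parallelogram law applies.  The difference [g] of two averages is
    therefore large only on a set of small measure, where order continuity
    controls it; where [g] is small it is controlled by a function of the space
    outside of L1, whose [Kf] is unbounded.  The space is complete.

    (b) If [f_k] decreases to [0] but its norm does not tend to [0], let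
    [E_k = {f_k > del f_0}] and multiply by a function [m] with
    [1 - 1 / k.+1 <= m < 1] on [E_k]: the averages of [f_0] can only tend to
    [0], but the [n]-th one is at least [f_0 / 2] on [E_(2n)].  Nets are reduced
    to sequences by sigma-finiteness.  If the space lies in L1, the inclusion is
    bounded; an operator transporting [1_(A_0)] along disjoint sets [A_k] of
    increasing finite measure keeps its integral, whereas the averages are at
    most [1/n], so they can only tend to [0], and this fails in L1. *)

(** * Distribution functions and rearrangements *)

(** [X] lives on the half line, whereas Omega may have atoms, so functions on the half line cannot
    in general be carried over to Omega. The vector space operations and the completeness of
    [X(Omega)] have to be recovered from those of [X] by submajorization. Rearrangements alone are
    awkward for this, because [(f + g)^*] is not bounded by [f^* + g^*]. The excess is an ordinary
    integral over Omega: it is monotone, it satisfies a triangle inequality in which the heights add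
    up, and Fatou's lemma applies to it.

    An operator in DS is controlled only in L1 and L-infinity. The contraction in L2 behind the
    parallelogram argument again comes from excesses, since a square is a superposition of them. As
    such an operator is linear only up to null sets, the Hilbert space argument is run on
    polynomials carrying a quadratic functional, and then read on the orbit of a single function. *)

Section half_line_measure.
Variable R : realType.
Local Notation nu := (@nu R).
Local Notation halfline := (@halfline R).

Lemma lebesgueType_measurable (A : set R) :
  @measurable _ (measurableTypeR R) A -> @measurable _ (lebesgueType R) A.
Proof. exact: sub_caratheodory. Qed.

Lemma nuE (A : set R) :
  nu A = lebesgue_measure A.
Proof. by []. Qed.

Lemma halflineE : halfline = `]0%R, +oo[%classic.
Proof. by apply/seteqP; split => x /=; rewrite in_itv/= andbT. Qed.

Lemma measurable_halfline : measurable halfline.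
Proof. by rewrite halflineE; apply: lebesgueType_measurable; exact: measurable_itv. Qed.

Lemma set_0ltE (s : R) :
  [set t : R | (0 < t < s)%R] = `]0%R, s[%classic.
Proof. by apply/seteqP; split => x /=; rewrite in_itv. Qed.

Lemma measurable_0lt (s : R) :
  @measurable _ (lebesgueType R) [set t : R | (0 < t < s)%R].
Proof. by rewrite set_0ltE; apply: lebesgueType_measurable; exact: measurable_itv. Qed.

Lemma nu_0lt (s : R) : (0 <= s)%R -> nu [set t : R | (0 < t < s)%R] = s%:E.
Proof.
move=> s0; rewrite set_0ltE nuE lebesgue_measure_itv/= lte_fin.
have [_|] := ltrP 0 s; first by rewrite sube0.
by move=> s0'; apply/eqP; rewrite eqe eq_le s0 s0'.
Qed.

Lemma nu_halfline : nu halfline = +oo%E.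
Proof. by rewrite halflineE nuE lebesgue_measure_itv/= ltry. Qed.

(** Stated for an extended real because [a] will be a value of a distribution function, which may be
    infinite at low heights. *)
Lemma halfline_ltE (a : \bar R) : (0 <= a)%E ->
  measurable (halfline `&` [set t : R | (t%:E < a)%E]) /\
  nu (halfline `&` [set t : R | (t%:E < a)%E]) = a.
Proof.
case: a => [s s0| |]; last by rewrite leeNy_eq.
- have -> : halfline `&` [set t : R | (t%:E < s%:E)%E] =
      [set t : R | (0 < t < s)%R].
    apply/seteqP; split => t /=; rewrite lte_fin; first by case=> t0 ts; rewrite t0.
    by move=> /andP[].
  split; [exact: measurable_0lt|exact: nu_0lt].
- move=> _.
  have -> : halfline `&` [set t : R | (t%:E < +oo)%E] = halfline.
    by apply/setIidl => t _ /=; rewrite ltry.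
  split; [exact: measurable_halfline|exact: nu_halfline].
Qed.

End half_line_measure.

Lemma measurable_fun_gt {R : realType} {d : measure_display} {T : measurableType d}
    (D : set T) (f : T -> R) :
  (forall l, measurable (D `&` [set x | l < f x])) -> measurable_fun D f.
Proof.
move=> mf mD; apply: (measurability _ (RGenOInfty.measurableE R)) => //.
move=> /= _ [_ [l ->] <-]; rewrite preimage_itvoy; exact: mf.
Qed.

Section distribution.
Context {R : realType} {d : measure_display} {T : measurableType d}.
Variables (mu : {measure set T -> \bar R}) (D : set T).
Hypothesis mD : measurable D.
Implicit Types f g : T -> R.
Local Open Scope ereal_scope.

Lemma measurable_levelset f (l : R) : measurable_fun D f ->
  measurable (D `&` [set x | (l < `|f x|)%R]).
Proof.
move=> mf; have /(_ mD _ (measurable_itv `]l, +oo[)) := measurableT_comp (@normr_measurable R setT) mf.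
congr measurable; apply/seteqP; split => x [Dx] /=; rewrite in_itv/= ?andbT//.
Qed.

Lemma dist_fun_nincr f : measurable_fun D f ->
  {homo dist_fun mu D f : l l' / (l <= l')%R >-> l' <= l}.
Proof.
move=> mf l l' ll'; apply: le_measure; rewrite ?inE; try exact: measurable_levelset.
by move=> x [Dx] /= h; split => //; exact: le_lt_trans h.
Qed.

(** Right-continuity of the distribution function: the strict superlevel set at [l] is the
    increasing union of those at [l + 1 / n.+1], and continuity from below holds even for infinite
    measure. *)
Lemma dist_fun_right f (l : R) (t : \bar R) : measurable_fun D f ->
  t < dist_fun mu D f l -> exists2 l', (l < l')%R & t < dist_fun mu D f l'.
Proof.
move=> mf tl; apply: contrapT => H.
have H' n : dist_fun mu D f (l + n.+1%:R^-1)%R <= t.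
  rewrite leNgt; apply/negP => h; apply: H; exists (l + n.+1%:R^-1)%R => //.
  by rewrite ltrDl invr_gt0.
pose F n := D `&` [set x | (l + n.+1%:R^-1 < `|f x|)%R].
have mF n : measurable (F n) by exact: measurable_levelset.
have ndF : nondecreasing_seq F.
  move=> n m nm; apply/subsetPset => x [Dx] /= h; split => //=.
  by apply: le_lt_trans h; rewrite lerD2l lef_pV2 ?posrE// ler_nat ltnS.
have FE : \bigcup_n F n = D `&` [set x | (l < `|f x|)%R].
  apply/seteqP; split => x /=.
    by move=> [n _ [Dx /= h]]; split => //=; apply: lt_trans h; rewrite ltrDl invr_gt0.
  move=> [Dx /= h]; have := h; rewrite -subr_gt0 => h'.
  have [n _] := near_infty_natSinv_lt (PosNum h').
  by move=> /(_ n (leqnn n)) /= hn; exists n => //; split => //=; rewrite addrC -ltrBrDr.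
have := @nondecreasing_cvg_mu _ _ _ mu F mF (bigcupT_measurable _ mF) ndF.
rewrite FE => /cvg_lim => /(_ (@ereal_hausdorff _)) HH.
move: tl; rewrite /dist_fun -HH ltNge => /negP; apply.
apply: lime_le; last by apply: nearW => n; exact: H'.
by apply: ereal_nondecreasing_is_cvgn => n m nm; apply: le_measure; rewrite ?inE//; exact/subsetPset/ndF.
Qed.

(** Continuity from above along the heights [l0 + n]: the first superlevel set has finite measure,
    and the intersection is empty because [f] takes real values. *)
Lemma dist_fun_small f (e : R) : L0mu mu D f -> (0 < e)%R ->
  exists2 l, (0 < l)%R & dist_fun mu D f l <= e%:E.
Proof.
move=> [mf [l0 l00 fin]] e0.
pose F (n : nat) := D `&` [set x | (l0 + n%:R < `|f x|)%R].
have mF n : measurable (F n) by exact: measurable_levelset.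
have niF : nonincreasing_seq F.
  move=> n m nm; apply/subsetPset => x [Dx] /= h; split => //=.
  by apply: le_lt_trans h; rewrite lerD2l ler_nat.
have FE : \bigcap_n F n = set0.
  apply/seteqP; split => x //= h.
  have [_ /=] := h (Num.bound `|f x|) I.
  apply/negP; rewrite -leNgt (le_trans (ltW (archi_boundP (normr_ge0 (f x)))))//.
  by rewrite lerDr ltW.
have F0 : mu (F 0%N) < +oo by rewrite /F addr0.
have := @nonincreasing_cvg_mu _ _ _ mu F F0 mF (bigcapT_measurable mF) niF.
rewrite FE measure0 => /fine_cvgP[_] /cvgrPdist_lt /(_ _ e0) [n _ /(_ n)].
rewrite /= leqnn sub0r normrN => /(_ isT) h.
exists (l0 + n%:R)%R; first by rewrite (lt_le_trans l00)// lerDl.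
have fn : mu (F n) \is a fin_num.
  rewrite ge0_fin_numE// (le_lt_trans _ F0)// le_measure ?inE//.
  by apply/subsetPset/niF.
rewrite /dist_fun -/(F n) -(fineK fn) lee_fin ltW// (le_lt_trans _ h)//.
exact: ler_norm.
Qed.

Lemma rearr_ge0 f (t : R) : (0 <= rearr mu D f t)%R.
Proof.
rewrite /rearr; set S := (X in inf X).
(* The infimum of the empty set is [0] by convention, so the bound holds for every [f] and [t]. *)
have [->|/set0P S0] := eqVneq S set0; first by rewrite inf0.
by apply: lb_le_inf => // y [/ltW].
Qed.

(** The rearrangement and the distribution function are generalized inverses of each other.
    Right-continuity gives the direction from the distribution function, where the infimum must be
    strictly above [l]. *)
Lemma rearr_ltP f (l t : R) : L0mu mu D f -> (0 < t)%R -> (0 <= l)%R ->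
  (l < rearr mu D f t)%R <-> t%:E < dist_fun mu D f l.
Proof.
move=> Lf t0 l0; have mf := Lf.1; rewrite /rearr; set S := (X in inf X).
have lbS : lbound S 0%R by move=> y [/ltW].
have hlS : has_lbound S by exists 0%R.
split => [h|h].
  rewrite ltNge; apply/negP => hl; move: h; apply/negP; rewrite -leNgt.
  (* [l] may be [0], which the set excludes, but [l + e] is admissible. *)
  apply/ler_addgt0Pr => e e0; apply: ge_inf => //; split.
    by rewrite (lt_le_trans e0)// lerDr.
  by apply: le_trans hl; apply: dist_fun_nincr => //; rewrite lerDl ltW.
have [l' ll' tl'] := dist_fun_right mf h.
apply: lt_le_trans ll' _; apply: lb_le_inf.
  by have [y y0 yt] := dist_fun_small Lf t0; exists y.
move=> y [y0 yt]; rewrite leNgt; apply/negP => yl'.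
have := dist_fun_nincr mf (ltW yl').
by rewrite leNgt => /negP; apply; exact: le_lt_trans tl'.
Qed.

Lemma dist_rearr_fin f (t : R) : L0mu mu D f -> (0 < t)%R ->
  dist_fun mu D f (rearr mu D f t) <= t%:E.
Proof.
move=> Lf t0; rewrite leNgt; apply/negP => h.
by have := (rearr_ltP Lf t0 (rearr_ge0 f t)).2 h; rewrite ltxx.
Qed.

Lemma rearr_nincr f (s t : R) : L0mu mu D f -> (0 < s)%R -> (s <= t)%R ->
  (rearr mu D f t <= rearr mu D f s)%R.
Proof.
move=> Lf s0 st; rewrite leNgt; apply/negP.
move=> /(rearr_ltP Lf (lt_le_trans s0 st) (rearr_ge0 f s)) h.
have := dist_rearr_fin Lf s0; rewrite leNgt => /negP; apply.
by apply: le_lt_trans h; rewrite lee_fin.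
Qed.

End distribution.

Section rearr_half_line.
Context {R : realType} {d : measure_display} {T : measurableType d}.
Variables (mu : {measure set T -> \bar R}) (D : set T).
Hypothesis mD : measurable D.
Implicit Types f g : T -> R.
Local Notation nu := (@nu R).
Local Notation halfline := (@halfline R).
Local Open Scope ereal_scope.

Lemma rearr_levelset f (l : R) : L0mu mu D f -> (0 <= l)%R ->
  halfline `&` [set t | (l < rearr mu D f t)%R] =
  halfline `&` [set t : R | t%:E < dist_fun mu D f l].
Proof.
move=> Lf l0; apply/seteqP; split => t /= [t0 h]; split => //.
  exact/rearr_ltP.
exact/(rearr_ltP mD Lf t0 l0).
Qed.

Lemma measurable_rearr f : L0mu mu D f ->
  measurable_fun halfline (rearr mu D f : lebesgueType R -> R).
Proof.
move=> Lf; apply: measurable_fun_gt => l; have [l0|l0] := leP 0%R l.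
  rewrite [X in measurable X](rearr_levelset Lf l0).
  by have [] := halfline_ltE (measure_ge0 mu (D `&` [set x | (l < `|f x|)%R])).
rewrite [X in measurable X](_ : _ = halfline); first exact: measurable_halfline.
by apply/setIidl => t _ /=; rewrite (lt_le_trans l0)// rearr_ge0.
Qed.

(** Equimeasurability: a superlevel set of the rearrangement is an initial interval of the matching
    length. *)
Lemma dist_rearr f (l : R) : L0mu mu D f -> (0 <= l)%R ->
  dist_fun nu halfline (rearr mu D f) l = dist_fun mu D f l.
Proof.
move=> Lf l0; rewrite {1}/dist_fun.
under eq_set => t do rewrite ger0_norm ?rearr_ge0//.
rewrite (rearr_levelset Lf l0).
by have [] := halfline_ltE (measure_ge0 mu (D `&` [set x | (l < `|f x|)%R])).
Qed.

Lemma L0mu_rearr f : L0mu mu D f -> L0mu nu halfline (rearr mu D f).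
Proof.
move=> Lf; split; first exact: measurable_rearr.
by have [_ [l l0 h]] := Lf; exists l => //; rewrite dist_rearr// ltW.
Qed.

Lemma rearr_rearr f : L0mu mu D f ->
  rearr nu halfline (rearr mu D f) = rearr mu D f.
Proof.
move=> Lf; apply/funext => t; congr inf; apply/seteqP.
split => l /= [l0] h; split => //; apply: le_trans h.
  by have E := dist_rearr Lf (ltW l0); exact: (eq_ind_r (fun z => _ <= z) (lexx _) E).
by have E := dist_rearr Lf (ltW l0); exact: (eq_ind_r (fun z => z <= _) (lexx _) E).
Qed.

End rearr_half_line.

(** * Excess integrals *)

Section staircase.
Context {R : realFieldType}.
Implicit Types (h y : R) (N : nat).

(** A Riemann sum of mesh [h] for the layer-cake formula of the positive part of [y], bounding it
    from below. Its terms are indicators of strict inequalities, so it integrates to values of the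
    distribution function. *)
Definition stair h N y : R := \sum_(i < N) (h * (h * i.+1%:R < y)%R%:R).

Lemma stairS h N y : stair h N.+1 y = stair h N y + h * (h * N.+1%:R < y)%R%:R.
Proof. by rewrite /stair big_ord_recr. Qed.

Lemma stair_ge0 h N y : 0 <= h -> 0 <= stair h N y.
Proof. by move=> h0; apply: sumr_ge0 => i _; rewrite mulr_ge0. Qed.

Lemma stair_le_cst h N y : 0 <= h -> stair h N y <= h * N%:R.
Proof.
move=> h0; elim: N => [|N IH]; first by rewrite /stair big_ord0 mulr0.
rewrite stairS -natr1 mulrDr mulr1 lerD// ler_piMr//.
by case: (_ < _); rewrite ?ler01.
Qed.

Lemma stair_le_max h N y : 0 <= h -> stair h N y <= Num.max y 0.
Proof.
move=> h0; elim: N => [|N IH]; first by rewrite /stair big_ord0 le_max lexx orbT.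
have [hy|yh] := ltP (h * N.+1%:R) y.
  by rewrite le_max (le_trans (stair_le_cst N.+1 y h0) (ltW hy)).
by rewrite stairS ltNge yh mulr0 addr0.
Qed.

Lemma stair_full h N y : 0 <= h -> h * N%:R < y -> stair h N y = h * N%:R.
Proof.
move=> h0; elim: N => [|N IH] hy; first by rewrite /stair big_ord0 mulr0.
rewrite stairS hy mulr1 IH; first by rewrite -natr1 mulrDr mulr1.
by apply: le_lt_trans hy; rewrite ler_wpM2l// ler_nat.
Qed.

Lemma stair_ge h N y : 0 <= h -> y <= h * N%:R -> Num.max y 0 - h <= stair h N y.
Proof.
move=> h0; elim: N => [|N IH] hy.
  by rewrite /stair big_ord0 mulr0 in hy *; rewrite max_r// sub0r oppr_le0.
have [yN|Ny] := leP y (h * N%:R).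
  by apply: le_trans (IH yN) _; rewrite stairS lerDl mulr_ge0.
rewrite stairS stair_full// ltNge hy mulr0 addr0.
rewrite max_l ?lerBlDr; last by rewrite (le_trans _ (ltW Ny))// mulr_ge0.
by move: hy; rewrite -natr1 mulrDr mulr1.
Qed.

End staircase.

Section excess.
Context {R : realType} {d : measure_display} {T : measurableType d}.
Variables (mu : {measure set T -> \bar R}) (D : set T).
Implicit Types f g : T -> R.
Local Open Scope ereal_scope.

Definition Phi f (l : R) : \bar R :=
  \int[mu]_(x in D) (Num.max (`|f x| - l) 0)%:E.

Lemma Phi_ge0 f l : 0 <= Phi f l.
Proof. by apply: integral_ge0 => x _; rewrite lee_fin le_max lexx orbT. Qed.

Hypothesis mD : measurable D.

Lemma measurable_excess f (l : R) : measurable_fun D f ->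
  measurable_fun D (fun x => (Num.max (`|f x| - l) 0)%:E).
Proof.
move=> mf; apply/measurable_EFinP; apply: measurable_maxr => //.
by apply: measurable_funB => //; exact: measurableT_comp.
Qed.

Lemma le_Phi f (l l' : R) : measurable_fun D f -> (l <= l')%R ->
  Phi f l' <= Phi f l.
Proof.
move=> mf ll'; apply: ge0_le_integral => //; try exact: measurable_excess.
  by move=> x _; rewrite lee_fin le_max lexx orbT.
move=> x _; rewrite lee_fin ge_max !le_max lexx orbT andbT.
by rewrite lerB.
Qed.

(** Markov's inequality for the excess; it turns a finite excess integral into membership in
    [L0mu]. *)
Lemma Phi_dist f (l e : R) : measurable_fun D f -> (0 < e)%R ->
  e%:E * dist_fun mu D f (l + e) <= Phi f l.
Proof.
move=> mf e0; set A := D `&` [set x | (l + e < `|f x|)%R].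
have mA : measurable A by exact: measurable_levelset.
rewrite /dist_fun -/A -integral_cst//.
apply: (@le_trans _ _ (\int[mu]_(x in A) (Num.max (`|f x| - l) 0)%:E)).
  apply: ge0_le_integral => //.
  - by move=> x _; rewrite lee_fin ltW.
  - by apply: (measurable_funS mD) => [x []//|]; exact: measurable_excess.
  - move=> x [Dx /= h]; rewrite lee_fin le_max lerBrDl.
    by rewrite (ltW h).
apply: ge0_subset_integral => //; first exact: measurable_excess.
  by move=> x _; rewrite lee_fin le_max lexx orbT.
by move=> x [].
Qed.

Lemma L0mu_Phi f (l : R) : measurable_fun D f -> (0 <= l)%R -> Phi f l < +oo ->
  L0mu mu D f.
Proof.
move=> mf l0 fin; split => //; exists (l + 1)%R; first by rewrite (lt_le_trans ltr01)// lerDr.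
by apply: le_lt_trans fin; rewrite -[leLHS]mul1e; apply: Phi_dist.
Qed.

(** With mesh [1 / n.+1], it takes [n.+1 ^ 2] steps to reach the height [n.+1]: the mesh tends to 0
    while the height tends to infinity. *)
Definition stair_fun f (l : R) (n : nat) (x : T) : \bar R :=
  (stair n.+1%:R^-1 (n.+1 * n.+1) (`|f x| - l))%:E.

Lemma stair_fun_cvg f l x :
  stair_fun f l n x @[n --> \oo] --> (Num.max (`|f x| - l) 0)%:E.
Proof.
apply: cvg_EFin; first by apply: nearW => n.
apply/cvgrPdist_le => e e0; set y := (`|f x| - l)%R.
have [N1 _ HN1] := near_infty_natSinv_lt (PosNum e0).
exists (maxn N1 (Num.bound `|y|)) => // n /=; rewrite geq_max => /andP[n1 n2].
have h0 : (0 <= n.+1%:R^-1 :> R)%R by rewrite invr_ge0.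
have yn : (y <= n.+1%:R^-1 * (n.+1 * n.+1)%:R)%R.
  rewrite natrM mulKf ?pnatr_eq0//.
  rewrite (le_trans (ler_norm y))// (le_trans (ltW (archi_boundP (normr_ge0 y))))//.
  by rewrite ler_nat ltnW.
rewrite ger0_norm ?subr_ge0 ?stair_le_max//.
rewrite lerBlDr -lerBlDl.
apply: le_trans _ (stair_ge h0 yn); rewrite lerD2l lerN2.
by apply: ltW; exact: (HN1 n n1).
Qed.

Lemma integral_stair_fun f l n : measurable_fun D f ->
  measurable_fun D (stair_fun f l n) /\
  \int[mu]_(x in D) stair_fun f l n x =
  \sum_(i < n.+1 * n.+1)
     n.+1%:R^-1%:E * dist_fun mu D f (l + n.+1%:R^-1 * i.+1%:R)%R.
Proof.
move=> mf; set h : R := n.+1%:R^-1%R; set N := (n.+1 * n.+1)%N.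
pose A i := D `&` [set x | (l + h * i.+1%:R < `|f x|)%R].
have mA i : measurable (A i) by exact: measurable_levelset.
have mg i : measurable_fun D (fun x => h%:E * (\1_(A i) x)%:E).
  apply: emeasurable_funM => //; apply/measurable_EFinP.
  exact: measurable_indic.
have E x : D x -> stair_fun f l n x = \sum_(i < N) h%:E * (\1_(A i) x)%:E.
  move=> Dx; rewrite /stair_fun /stair -sumEFin; apply: eq_bigr => i _.
  rewrite -EFinM; congr (_ * _)%:E; rewrite indicE; congr (nat_of_bool _)%:R.
  rewrite ltrBrDl; apply/idP/idP => [?|]; first by rewrite inE.
  by rewrite inE => -[].
split.
  apply: (eq_measurable_fun (fun x => \sum_(i < N) h%:E * (\1_(A i) x)%:E)).
    by move=> x; rewrite inE => Dx; rewrite E.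
  exact: emeasurable_sum.
rewrite (eq_integral (fun x => \sum_(i < N) h%:E * (\1_(A i) x)%:E)); last first.
  by move=> x; rewrite inE => Dx; rewrite E.
rewrite ge0_integral_sum//; last first.
  by move=> i x _; rewrite -EFinM lee_fin mulr_ge0// ?invr_ge0.
apply: eq_bigr => i _; rewrite ge0_integralZl//.
- by rewrite integral_indic// /dist_fun; congr (_ * mu _); apply/setIidl => x [].
- by apply/measurable_EFinP; exact: measurable_indic.
- by rewrite lee_fin invr_ge0.
Qed.

Lemma integral_stair_fun_le f l n : measurable_fun D f ->
  \int[mu]_(x in D) stair_fun f l n x <= Phi f l.
Proof.
move=> mf; apply: ge0_le_integral => //.
- by move=> x _; rewrite lee_fin stair_ge0// invr_ge0.
- by have [] := integral_stair_fun l n mf.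
- exact: measurable_excess.
- by move=> x _; rewrite lee_fin stair_le_max// invr_ge0.
Qed.

End excess.

(** Layer-cake comparison between two measure spaces. The staircases integrate to sums of
    distribution functions; as they are not monotone in [n], the limit is taken with Fatou's
    lemma. *)
Lemma Phi_le_dist {R : realType} {d d' : measure_display}
    {T : measurableType d} {T' : measurableType d'}
    (mu : {measure set T -> \bar R}) (mu' : {measure set T' -> \bar R})
    (D : set T) (D' : set T') (f : T -> R) (g : T' -> R) (l : R) :
  measurable D -> measurable D' -> measurable_fun D f -> measurable_fun D' g ->
  (forall l', l <= l' -> (dist_fun mu D f l' <= dist_fun mu' D' g l')%E) ->
  (Phi mu D f l <= Phi mu' D' g l)%E.
Proof.
move=> mD mD' mf mg H.
rewrite /Phi (eq_integral (fun x => limn_einf (stair_fun f l ^~ x))); last first.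
  by move=> x _; rewrite (cvg_limn_einf_sup (@stair_fun_cvg _ _ _ f l x)).1.
have Hn n : (\int[mu]_(x in D) stair_fun f l n x <= Phi mu' D' g l)%E.
  apply: le_trans (integral_stair_fun_le mu' mD' l n mg).
  rewrite (integral_stair_fun mu mD l n mf).2 (integral_stair_fun mu' mD' l n mg).2.
  apply: lee_sum => i _; apply: lee_wpmul2l; first by rewrite lee_fin invr_ge0.
  by apply: H; rewrite lerDl mulr_ge0// invr_ge0.
apply: le_trans (fatou _ mD _ _) _.
- by move=> n; exact: (integral_stair_fun mu mD l n mf).1.
- by move=> n x _; rewrite lee_fin stair_ge0// invr_ge0.
rewrite limn_einf_lim; apply: lime_le; first exact: is_cvg_einfs.
apply: nearW => n; apply: le_trans (Hn n).
by apply: ereal_inf_lbound; exists n => //=.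
Qed.

(** * The K-functional *)

Section excess_integral.
Context {R : realType} {d : measure_display} {T : measurableType d}.
Variables (mu : {measure set T -> \bar R}) (A : set T).
Hypothesis mA : measurable A.
Implicit Types f : T -> R.
Local Open Scope ereal_scope.

Let excess_ge0 f (l : R) x : 0 <= (Num.max (`|f x| - l) 0)%:E.
Proof. by rewrite lee_fin le_max lexx orbT. Qed.

Lemma integral_le_Phi f (l : R) : measurable_fun A f -> (0 <= l)%R ->
  \int[mu]_(x in A) (`|f x|)%:E <= l%:E * mu A + Phi mu A f l.
Proof.
move=> mf l0; have mex := measurable_excess l mf.
rewrite /Phi -integral_cst// -ge0_integralD//.
apply: ge0_le_integral => //.
- by apply/measurable_EFinP; exact: measurableT_comp.
- exact: emeasurable_funD.
- by move=> t _; rewrite -EFinD lee_fin -lerBlDl le_max lexx.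
Qed.

Lemma integral_eq_Phi f (l : R) : measurable_fun A f -> (0 <= l)%R ->
  (forall x, A x -> (l <= f x)%R) ->
  \int[mu]_(x in A) (f x)%:E = l%:E * mu A + Phi mu A f l.
Proof.
move=> mf l0 lf; have mex := measurable_excess l mf.
rewrite /Phi -integral_cst// -ge0_integralD//.
apply: eq_integral => x; rewrite inE => /lf lfx.
have f0 := le_trans l0 lfx.
by rewrite -EFinD ger0_norm// max_l ?subr_ge0// subrKC.
Qed.

Lemma Phi_subset f (B : set T) (l : R) : measurable B -> measurable_fun B f ->
  A `<=` B -> Phi mu A f l <= Phi mu B f l.
Proof.
by move=> mB mf AB; apply: ge0_subset_integral => //; exact: measurable_excess.
Qed.

Lemma Phi_truncate f (B : set T) (l : R) : A `<=` B ->
  (forall x, B x -> ~ A x -> (`|f x| <= l)%R) -> Phi mu B f l = Phi mu A f l.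
Proof.
move=> AB H; rewrite /Phi integral_mkcond [RHS]integral_mkcond.
apply: eq_integral => t _; rewrite !patchE.
case: ifPn => tB; case: ifPn => tA //; last first.
  by move: tA tB; rewrite inE notin_setE => /AB.
rewrite inE in tB; rewrite notin_setE in tA.
by rewrite max_r// subr_le0; exact: H.
Qed.

End excess_integral.

Section K_functional.
Context {R : realType} {d : measure_display} {T : measurableType d}.
Variables (mu : {measure set T -> \bar R}) (D : set T).
Hypothesis mD : measurable D.
Implicit Types f g : T -> R.
Local Notation nu := (@nu R).
Local Notation halfline := (@halfline R).
Local Open Scope ereal_scope.

(** Peetre's K-functional for the couple of L1 and L-infinity, given by its formula in terms of the
    rearrangement. Submajorization compares two of these. *)
Definition Kf f (s : R) : \bar R :=
  \int[nu]_(t in [set t : R | (0 < t < s)%R]) (rearr mu D f t)%:E.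

Lemma sub_0lt_halfline (s : R) : [set t : R | (0 < t < s)%R] `<=` halfline.
Proof. by move=> t /= /andP[]. Qed.

Lemma measurable_rearr_0lt f (s : R) : L0mu mu D f ->
  @measurable_fun _ _ (lebesgueType R) _ [set t : R | (0 < t < s)%R]
    (fun t => (rearr mu D f t)%:E).
Proof.
move=> Lf; apply/measurable_EFinP.
exact: (measurable_funS (@measurable_halfline R) (@sub_0lt_halfline s)
  (measurable_rearr mD Lf)).
Qed.

Lemma Kf_ge0 f s : 0 <= Kf f s.
Proof. by apply: integral_ge0 => x _; rewrite lee_fin rearr_ge0. Qed.

Lemma Phi_rearr f (l : R) : L0mu mu D f -> (0 <= l)%R ->
  Phi nu halfline (rearr mu D f) l = Phi mu D f l.
Proof.
move=> Lf l0; apply/eqP; rewrite eq_le; apply/andP; split.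
  apply: Phi_le_dist => //; first exact: measurable_halfline.
  - exact: measurable_rearr.
  - exact: Lf.1.
  - by move=> l' ll'; rewrite (dist_rearr mD Lf (le_trans l0 ll')).
apply: Phi_le_dist => //; first exact: measurable_halfline.
- exact: Lf.1.
- exact: measurable_rearr.
- by move=> l' ll'; rewrite (dist_rearr mD Lf (le_trans l0 ll')).
Qed.

Lemma Kf_le f (s l : R) : L0mu mu D f -> (0 < s)%R -> (0 <= l)%R ->
  Kf f s <= (s * l)%:E + Phi mu D f l.
Proof.
move=> Lf s0 l0; rewrite -(Phi_rearr Lf l0).
have mr := measurable_rearr mD Lf.
have mr' := measurable_funS (@measurable_halfline R) (@sub_0lt_halfline s) mr.
have H := integral_le_Phi nu (@measurable_0lt R s) mr' l0.
have HP := Phi_subset nu (@measurable_0lt R s) l (@measurable_halfline R) mr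
  (@sub_0lt_halfline s).
rewrite mulrC EFinM -(nu_0lt (ltW s0)); apply: le_trans (leeD (lexx _) HP).
apply: le_trans H.
rewrite le_eqVlt; apply/orP; left; apply/eqP; apply: eq_integral => t _.
by rewrite ger0_norm// rearr_ge0.
Qed.

(** With [l] equal to [f^* s] nothing is lost in [Kf_le]: the rearrangement is at least [l] on
    [(0, s)], and at most [l] beyond, where it has no excess. *)
Lemma KfE f (s : R) : L0mu mu D f -> (0 < s)%R ->
  Kf f s = (s * rearr mu D f s)%:E + Phi mu D f (rearr mu D f s).
Proof.
move=> Lf s0; set l := rearr mu D f s; have l0 : (0 <= l)%R by exact: rearr_ge0.
rewrite -(Phi_rearr Lf l0).
have mr := measurable_rearr mD Lf.
have mr' := measurable_funS (@measurable_halfline R) (@sub_0lt_halfline s) mr.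
have lr x : (0 < x < s)%R -> (l <= rearr mu D f x)%R.
  by move=> /andP[x0 xs]; apply: rearr_nincr => //; exact: ltW.
rewrite (@Phi_truncate _ _ _ nu _ _ _ l (@sub_0lt_halfline s)); last first.
  move=> t t0 /= /negP; rewrite t0/= -leNgt => st; rewrite ger0_norm ?rearr_ge0//.
  exact: rearr_nincr.
rewrite mulrC EFinM -(nu_0lt (ltW s0)).
exact: (integral_eq_Phi nu (@measurable_0lt R s) mr' l0 lr).
Qed.

(** The Hardy-Littlewood inequality for an indicator: [|f|] is cut at the height [f^* s], and the
    lower part contributes at most [s * f^* s] on [A]. *)
Lemma integral_le_Kf f (A : set T) (s : R) : L0mu mu D f ->
  measurable A -> A `<=` D -> (0 < s)%R -> mu A <= s%:E ->
  \int[mu]_(x in A) (`|f x|)%:E <= Kf f s.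
Proof.
move=> Lf mA AD s0 As; rewrite KfE//; set l := rearr mu D f s.
have l0 : (0 <= l)%R by exact: rearr_ge0.
apply: le_trans (integral_le_Phi mu mA (measurable_funS mD AD Lf.1) l0) _.
apply: leeD; last exact: (Phi_subset mu mA l mD Lf.1 AD).
by rewrite mulrC EFinM; apply: lee_wpmul2l; rewrite ?lee_fin.
Qed.

End K_functional.

Section Kf_comparison.
Context {R : realType} {d d' : measure_display}
  {T : measurableType d} {T' : measurableType d'}.
Variables (mu : {measure set T -> \bar R}) (D : set T).
Variables (mu' : {measure set T' -> \bar R}) (D' : set T').
Hypothesis (mD : measurable D) (mD' : measurable D').
Local Open Scope ereal_scope.

Lemma Kf_le_Phi (f : T -> R) (g : T' -> R) (s : R) :
  L0mu mu D f -> L0mu mu' D' g ->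
  (forall l, (0 <= l)%R -> Phi mu' D' g l <= Phi mu D f l) -> (0 < s)%R ->
  Kf mu' D' g s <= Kf mu D f s.
Proof.
move=> Lf Lg H s0; rewrite (KfE mD Lf s0).
apply: le_trans (Kf_le mD' Lg s0 (rearr_ge0 mu D f s)) _.
by apply: leeD => //; apply: H; exact: rearr_ge0.
Qed.

End Kf_comparison.

(** * The space on a measure space *)

Section excess_properties.
Context {R : realType} {d : measure_display} {T : measurableType d}.
Variables (mu : {measure set T -> \bar R}) (D : set T).
Hypothesis mD : measurable D.
Implicit Types f g : T -> R.
Local Open Scope ereal_scope.

Lemma Phi_le_ae f g (l l' : R) : measurable_fun D f -> measurable_fun D g ->
  {ae mu, forall x, D x -> (`|g x| - l' <= `|f x| - l)%R} ->
  Phi mu D g l' <= Phi mu D f l.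
Proof.
move=> mf mg H; apply: ae_ge0_le_integral => //.
- by move=> x _; rewrite lee_fin le_max lexx orbT.
- exact: measurable_excess.
- by move=> x _; rewrite lee_fin le_max lexx orbT.
- exact: measurable_excess.
apply: filterS H => x H Dx; rewrite lee_fin ge_max !le_max lexx orbT andbT.
by rewrite H.
Qed.

Lemma Phi_le_norm f g (l : R) : measurable_fun D f -> measurable_fun D g ->
  {ae mu, forall x, D x -> (`|g x| <= `|f x|)%R} ->
  Phi mu D g l <= Phi mu D f l.
Proof.
move=> mf mg H; apply: Phi_le_ae => //.
by apply: filterS H => x H Dx; rewrite lerD2r; exact: H.
Qed.

Lemma Phi_cst0 (l : R) : (0 <= l)%R -> Phi mu D (cst 0%R) l = 0.
Proof.
move=> l0; rewrite /Phi; apply: integral0_eq => x _ /=.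
by rewrite normr0 sub0r max_r// oppr_le0.
Qed.

Lemma Phi_ae0 f : measurable_fun D f ->
  Phi mu D f 0 = 0 <-> ae_eq mu D f (cst 0%R).
Proof.
move=> mf; have E : Phi mu D f 0 = \int[mu]_(x in D) `|(EFin \o f) x|.
  by apply: eq_integral => x _ /=; rewrite subr0 max_l.
have mf' : measurable_fun D (EFin \o f) by exact/measurable_EFinP.
rewrite E; split => [|H].
  by move=> /(ae_eq_integral_abs mu mD mf'); apply: filterS => x h /h [].
by apply/(ae_eq_integral_abs mu mD mf'); apply: filterS H => x h /h /= ->.
Qed.

Lemma PhiD f g (l l' : R) : measurable_fun D f -> measurable_fun D g ->
  Phi mu D (f \+ g)%R (l + l') <= Phi mu D f l + Phi mu D g l'.
Proof.
move=> mf mg; rewrite /Phi -ge0_integralD//; last first.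
- exact: measurable_excess.
- by move=> x _; rewrite lee_fin le_max lexx orbT.
- exact: measurable_excess.
- by move=> x _; rewrite lee_fin le_max lexx orbT.
apply: ge0_le_integral => //.
- by move=> x _; rewrite lee_fin le_max lexx orbT.
- by apply: measurable_excess; exact: measurable_funD.
- by apply: emeasurable_funD; exact: measurable_excess.
move=> x _; rewrite -EFinD lee_fin ge_max; apply/andP; split; last first.
  by rewrite addr_ge0// le_max lexx orbT.
have h1 : (`|f x| - l <= Num.max (`|f x| - l) 0)%R by rewrite le_max lexx.
have h2 : (`|g x| - l' <= Num.max (`|g x| - l') 0)%R by rewrite le_max lexx.
have := ler_normD (f x) (g x); rewrite /=; lra.
Qed.

Lemma PhiZ f (a l : R) : measurable_fun D f ->
  Phi mu D (fun x => (a * f x)%R) (`|a| * l) = `|a|%:E * Phi mu D f l.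
Proof.
move=> mf; rewrite /Phi -ge0_integralZl//; last 2 first.
- exact: measurable_excess.
- by move=> x _; rewrite lee_fin le_max lexx orbT.
apply: eq_integral => x _; rewrite -EFinM normrM -mulrBr; congr EFin.
by rewrite maxr_pMr// mulr0.
Qed.

Lemma Phi_fin f (s : R) : L0mu mu D f -> (0 < s)%R -> Kf mu D f s < +oo ->
  Phi mu D f (rearr mu D f s) < +oo.
Proof.
move=> Lf s0; rewrite KfE//; apply: le_lt_trans.
by rewrite leeDr// lee_fin mulr_ge0// ?rearr_ge0// ltW.
Qed.

(** A rough form of concavity: the optimal height [l] for [s] is tested at [t], and [t * l] is at
    most [t / s] times [Kf] at [s]. Hence finiteness at one argument gives finiteness at all. *)
Lemma Kf_scale f (s t : R) : L0mu mu D f -> (0 < s)%R -> (0 < t)%R ->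
  Kf mu D f t <= (1 + t / s)%:E * Kf mu D f s.
Proof.
move=> Lf s0 t0; rewrite (KfE mD Lf s0); set l := rearr _ _ _ _.
have l0 : (0 <= l)%R by exact: rearr_ge0.
apply: le_trans (Kf_le mD Lf t0 l0) _.
have ts0 : (0 <= t / s)%R by rewrite divr_ge0// ltW.
rewrite ge0_muleDr ?Phi_ge0 ?lee_fin ?mulr_ge0 ?(ltW s0)//.
apply: leeD; last first.
  by rewrite -[leLHS]mul1e; apply: lee_wpmul2r; rewrite ?Phi_ge0// lee_fin lerDl.
rewrite -EFinM lee_fin mulrDl mul1r mulrA mulfVK ?gt_eqF//.
by rewrite lerDr mulr_ge0// ltW.
Qed.

Lemma KfD_le f g (s : R) : L0mu mu D f -> L0mu mu D g -> L0mu mu D (f \+ g)%R ->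
  (0 < s)%R -> Kf mu D (f \+ g)%R s <= Kf mu D f s + Kf mu D g s.
Proof.
move=> Lf Lg Lfg s0; rewrite (KfE mD Lf s0) (KfE mD Lg s0).
apply: le_trans (Kf_le mD Lfg s0 (addr_ge0 (rearr_ge0 mu D f s) (rearr_ge0 mu D g s))) _.
rewrite addeACA mulrDr EFinD; apply: leeD => //.
by apply: PhiD; [exact: Lf.1|exact: Lg.1].
Qed.

Lemma KfZ_le f (a s : R) : L0mu mu D f -> L0mu mu D (fun x => a * f x)%R ->
  (0 < s)%R -> Kf mu D (fun x => a * f x)%R s <= `|a|%:E * Kf mu D f s.
Proof.
move=> Lf Laf s0; rewrite (KfE mD Lf s0).
have l0 := rearr_ge0 mu D f s.
apply: le_trans (Kf_le mD Laf s0 (mulr_ge0 (normr_ge0 a) l0)) _.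
rewrite (PhiZ _ _ Lf.1) [leRHS]ge0_muleDr ?Phi_ge0 ?lee_fin ?mulr_ge0 ?(ltW s0)//.
by rewrite -EFinM mulrCA.
Qed.

End excess_properties.

Section fully_symmetric_space.
Context {R : realType} {d : measure_display} {T : measurableType d}.
Variables (mu : {measure set T -> \bar R}).
Variables (X : set (lebesgueType R -> R)) (normX : (lebesgueType R -> R) -> R).
Hypothesis XS : fully_symmetric X normX.
Implicit Types f g : T -> R.
Local Notation nu := (@nu R).
Local Notation halfline := (@halfline R).
Local Notation Y := (space_on mu X).
Local Notation N := (norm_on mu normX).
Local Notation K := (Kf mu setT).
Local Notation Ph := (Phi mu setT).

Let mh : measurable halfline := @measurable_halfline R.

(** Local integrability is forced by the norm. If [Kf F] were infinite somewhere, it would be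
    infinite everywhere and [2 * F] would be submajorized by [F]. Then [2 * normX F <= normX F], so
    [F] is zero a.e. and [Kf F] vanishes. *)
Lemma X_Kf_fin F (s : R) : X F -> 0 < s -> (Kf nu halfline F s < +oo)%E.
Proof.
move=> XF s0; have LF := fs_sub XS XF.
rewrite ltNge; apply/negP; rewrite leye_eq => /eqP Koo.
have Koo' t : 0 < t -> Kf nu halfline F t = +oo%E.
  move=> t0; have := Kf_scale mh LF t0 s0; rewrite Koo leye_eq.
  by have := Kf_ge0 nu halfline F t; case: (Kf nu halfline F t).
have X2 := fs_Z XS 2 XF.
have sub2 : submajorized (fun t => 2 * F t) F.
  by move=> t t0; rewrite [leRHS](Koo' _ t0) leey.
have [_] := fs_symmetric XS XF (fs_sub XS X2) sub2.
rewrite (fs_normZ XS)// ger0_norm// => n2.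
have n0 : normX F = 0.
  by apply/eqP; rewrite eq_le (fs_norm_ge0 XS XF) andbT; move: n2; lra.
have F0 := fs_norm_eq0 XS XF n0.
have Ph0 := (Phi_ae0 nu mh LF.1).2 F0.
have := Kf_le mh LF s0 (lexx 0); rewrite Koo leye_eq mulr0 add0e.
by rewrite [X in X == _]Ph0.
Qed.

(** The passage from the half line to Omega. The bound involves the integral of [|F|] rather than
    [Kf F], so that it can be checked for a sum of rearrangements; Hardy-Littlewood then supplies
    [Kf F]. *)
Lemma Y_of_X F f : X F -> L0mu mu setT f ->
  (forall s : R, 0 < s ->
     (K f s <= \int[nu]_(t in [set t : R | (0 < t < s)%R]) (`|F t|%R)%:E)%E) ->
  Y f /\ N f <= normX F.
Proof.
move=> XF Lf H; have LF := fs_sub XS XF.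
have LR := L0mu_rearr (@measurableT _ T) Lf.
have sub : submajorized (rearr mu setT f) F.
  move=> s s0; rewrite (rearr_rearr (@measurableT _ T) Lf).
  apply: le_trans (H _ s0) _.
  apply: (integral_le_Kf mh LF (@measurable_0lt R s) (@sub_0lt_halfline R s) s0).
  by rewrite nu_0lt// ltW.
have [X1 X2] := fs_symmetric XS XF LR sub.
by split => //; split.
Qed.

Lemma Y_L0mu f : Y f -> L0mu mu setT f. Proof. by case. Qed.
Lemma Y_meas f : Y f -> measurable_fun setT f. Proof. by move=> /Y_L0mu[]. Qed.

Lemma Kf_rearrE f s : L0mu mu setT f ->
  K f s = Kf nu halfline (rearr mu setT f) s.
Proof. by move=> Lf; rewrite [RHS]/Kf (rearr_rearr (@measurableT _ T) Lf). Qed.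

Lemma Y_Kf_fin f s : Y f -> 0 < s -> (K f s < +oo)%E.
Proof. by move=> [Lf Xf] s0; rewrite Kf_rearrE//; exact: X_Kf_fin. Qed.

Lemma Y_Phi_fin f : Y f -> (Ph f (rearr mu setT f 1) < +oo)%E.
Proof.
move=> Yf; apply: (Phi_fin (@measurableT _ T) (Y_L0mu Yf) ltr01).
exact: Y_Kf_fin.
Qed.

Lemma Y_Kf_le f g : Y f -> L0mu mu setT g ->
  (forall s : R, 0 < s -> (K g s <= K f s)%E) -> Y g /\ N g <= N f.
Proof.
move=> [Lf Xf] Lg H; apply: Y_of_X => // s s0; apply: le_trans (H _ s0) _.
rewrite le_eqVlt; apply/orP; left; apply/eqP; apply: eq_integral => t _.
by rewrite ger0_norm// rearr_ge0.
Qed.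

Lemma Y_Phi_le f g : Y f -> measurable_fun setT g ->
  (forall l : R, 0 <= l -> (Ph g l <= Ph f l)%E) -> Y g /\ N g <= N f.
Proof.
move=> Yf mg H; have Lf := Y_L0mu Yf.
have Lg : L0mu mu setT g.
  apply: (L0mu_Phi measurableT mg (rearr_ge0 mu setT f 1)).
  by apply: le_lt_trans (Y_Phi_fin Yf); apply: H; exact: rearr_ge0.
apply: (Y_Kf_le Yf Lg) => s s0.
exact: (Kf_le_Phi measurableT measurableT Lf Lg H s0).
Qed.

Lemma Y_le f g : Y f -> measurable_fun setT g ->
  {ae mu, forall x, `|g x| <= `|f x|} -> Y g /\ N g <= N f.
Proof.
move=> Yf mg H; apply: (Y_Phi_le Yf mg) => l l0.
by apply: (Phi_le_norm measurableT _ (Y_meas Yf) mg); apply: filterS H.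
Qed.

Lemma N_ge0 f : Y f -> 0 <= N f.
Proof. by move=> [_ Xf]; exact: (fs_norm_ge0 XS). Qed.

(** [(f + g)^*] need not lie below [f^* + g^*] pointwise, but it is submajorized by this sum, which
    belongs to [X]. *)
Lemma Y_D f g : Y f -> Y g -> Y (f \+ g) /\ N (f \+ g) <= N f + N g.
Proof.
move=> Yf Yg; have [[Lf Xf] [Lg Xg]] := (Yf, Yg).
have mfg : measurable_fun setT (f \+ g) by apply: measurable_funD; [exact: Lf.1|exact: Lg.1].
have Lfg : L0mu mu setT (f \+ g).
  apply: (L0mu_Phi measurableT mfg
    (addr_ge0 (rearr_ge0 mu setT f 1) (rearr_ge0 mu setT g 1))).
  apply: le_lt_trans (PhiD mu measurableT _ _ Lf.1 Lg.1) _.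
  by apply: lte_add_pinfty; exact: Y_Phi_fin.
have [] := @Y_of_X _ (f \+ g) (fs_D XS Xf Xg) Lfg _.
  move=> s s0; apply: le_trans (KfD_le measurableT Lf Lg Lfg s0) _.
  have E := ge0_integralD nu (@measurable_0lt R s) _
    (@measurable_rearr_0lt _ _ _ mu setT measurableT _ s Lf) _
    (@measurable_rearr_0lt _ _ _ mu setT measurableT _ s Lg).
  rewrite le_eqVlt; apply/orP; left; apply/eqP.
  rewrite /Kf -E; last 2 first.
  - by move=> t _; rewrite lee_fin rearr_ge0.
  - by move=> t _; rewrite lee_fin rearr_ge0.
  apply: eq_integral => t _.
  by rewrite -EFinD ger0_norm// addr_ge0// rearr_ge0.
by move=> YD ND; split => //; apply: le_trans ND (fs_normD XS Xf Xg).
Qed.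

Lemma Y_Z f a : Y f -> Y (fun x => a * f x) /\ N (fun x => a * f x) <= `|a| * N f.
Proof.
move=> Yf; have [Lf Xf] := Yf.
have maf : measurable_fun setT (fun x => a * f x) by apply: measurable_funM => //; exact: Lf.1.
have Laf : L0mu mu setT (fun x => a * f x).
  apply: (L0mu_Phi measurableT maf (mulr_ge0 (normr_ge0 a) (rearr_ge0 mu setT f 1))).
  rewrite (PhiZ mu measurableT _ _ Lf.1).
  have : Ph f (rearr mu setT f 1) \is a fin_num.
    by rewrite ge0_fin_numE ?Phi_ge0// Y_Phi_fin.
  by move=> /fineK <-; rewrite -EFinM ltry.
have [] := @Y_of_X _ (fun x => a * f x) (fs_Z XS a Xf) Laf _.
  move=> s s0; apply: le_trans (KfZ_le measurableT Lf Laf s0) _.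
  have E := ge0_integralZl nu (@measurable_0lt R s)
    (@measurable_rearr_0lt _ _ _ mu setT measurableT _ s Lf).
  rewrite le_eqVlt; apply/orP; left; apply/eqP.
  rewrite /Kf -E ?lee_fin//; last by move=> t _; rewrite lee_fin rearr_ge0.
  apply: eq_integral => t _.
  by rewrite -EFinM normrM (ger0_norm (rearr_ge0 mu setT f t)).
by move=> YD ND; split => //; rewrite -(fs_normZ XS).
Qed.

Lemma Y_B f g : Y f -> Y g -> Y (f \- g) /\ N (f \- g) <= N f + N g.
Proof.
move=> Yf Yg; have [Yg1 Ng1] := Y_Z (-1) Yg.
have [] := Y_D Yf Yg1.
rewrite (_ : f \+ _ = f \- g); last by apply/funext => x /=; rewrite mulN1r.
move=> YD ND; split => //; apply: le_trans ND _; rewrite lerD2l.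
by rewrite normrN1 mul1r in Ng1.
Qed.

Lemma N_eq0 f : Y f -> N f = 0 -> ae_eq mu setT f (cst 0).
Proof.
move=> [Lf Xf] /(fs_norm_eq0 XS Xf) f0.
apply/(Phi_ae0 mu (@measurableT _ T) Lf.1); rewrite -(Phi_rearr measurableT Lf (lexx 0)).
by apply/(Phi_ae0 nu mh (measurable_rearr measurableT Lf)).
Qed.

End fully_symmetric_space.

(** * Series of functions and completeness *)

Section pointwise_series.
Context {R : realType} {d : measure_display} {T : measurableType d}.
Variable (mu : {measure set T -> \bar R}).
Implicit Types (u : nat -> T -> R) (l : nat -> R).
Local Open Scope ereal_scope.

Definition sumf u n : T -> R := fun x => (\sum_(k < n) u k x)%R.

(* The upper limit makes the sum of the series measurable everywhere, also
   where the series diverges. *)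
Definition limf u : T -> R := fun x => fine (limn_esup (fun n => (sumf u n x)%:E)).

Lemma limfE u x (r : R) : sumf u n x @[n --> \oo] --> r -> limf u x = r.
Proof.
move=> h; rewrite /limf.
have h' : (sumf u n x)%:E @[n --> \oo] --> r%:E by apply: cvg_EFin => //; apply: nearW.
by rewrite (cvg_limn_einf_sup h').2.
Qed.

Lemma measurable_sumf u n : (forall k, measurable_fun setT (u k)) ->
  measurable_fun setT (sumf u n).
Proof. by move=> mu_; apply: measurable_sum. Qed.

Lemma measurable_limf u : (forall k, measurable_fun setT (u k)) ->
  measurable_fun setT (limf u).
Proof.
move=> mu_; apply: (measurableT_comp (fine_measurable measurableT)).
apply: measurable_fun_limn_esup => n; apply/measurable_EFinP.
exact: measurable_sumf.
Qed.

Lemma cvg_sum_abs (a b : nat -> R) : (forall k, (`|a k| <= b k)%R) ->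
  \sum_(0 <= k <oo) (b k)%:E < +oo ->
  exists r, (\sum_(k < n) a k)%R @[n --> \oo] --> r /\
     (`|r|%:E <= \sum_(0 <= k <oo) (b k)%:E).
Proof.
move=> ab boo; set B := \sum_(0 <= k <oo) _ in boo *.
have b0 k : (0 <= b k)%R by apply: le_trans (ab k).
have B0 : 0 <= B by apply: nneseries_ge0 => k _ _; rewrite lee_fin.
have Bf : B \is a fin_num by rewrite ge0_fin_numE.
have Hn n : (\sum_(0 <= k < n) `|a k| <= fine B)%R.
  rewrite -lee_fin fineK// -sumEFin.
  apply: le_trans (@nneseries_lim_ge _ (fun k => (b k)%:E) xpredT 0 n _); last first.
    by move=> k _ _; rewrite lee_fin.
  by apply: lee_sum => k _; rewrite lee_fin.
have C : cvgn (series a).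
  apply: normed_cvg; apply: nondecreasing_is_cvgn.
    by apply/nondecreasing_seqP => n; rewrite [leRHS]big_nat_recr//= lerDl.
  by exists (fine B) => _ [n _ <-]; exact: Hn.
exists (limn (series a)); split.
  by rewrite (_ : (fun n => _) = series a)//; apply/funext => n; rewrite /series/= big_mkord.
rewrite -(fineK Bf) lee_fin.
have C' : (fun n => `|series a n|%R) @ \oo --> (`|limn (series a)|)%R by exact: cvg_norm.
rewrite -(cvg_lim _ C')//; apply: limr_le; first by apply/cvg_ex; eexists; exact: C'.
apply: nearW => n; apply: le_trans (Hn n); rewrite /series/=.
exact: ler_norm_sum.
Qed.

(** Each [|u k|] is at most [l k] plus its excess over [l k]. The heights sum to a constant [L] and
    the excesses to an integrable [G], so the series converges absolutely where [G] is finite, and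
    its sum exceeds [L] by at most [G]. *)
Lemma series_ae u l : (forall k, measurable_fun setT (u k)) ->
  (forall k, (0 <= l k)%R) ->
  \sum_(0 <= k <oo) (l k)%:E < +oo ->
  \sum_(0 <= k <oo) Phi mu setT (u k) (l k) < +oo ->
  {ae mu, forall x, sumf u n x @[n --> \oo] --> limf u x} /\
  Phi mu setT (limf u) (fine (\sum_(0 <= k <oo) (l k)%:E)) <=
    \sum_(0 <= k <oo) Phi mu setT (u k) (l k).
Proof.
move=> mu_ l0 loo Poo; set L := \sum_(0 <= k <oo) (l k)%:E in loo *.
pose G x := \sum_(0 <= k <oo) (Num.max (`|u k x| - l k) 0)%:E.
have e0 k x : 0 <= (Num.max (`|u k x| - l k) 0)%:E.
  by rewrite lee_fin le_max lexx orbT.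
have me k : measurable_fun setT (fun x => (Num.max (`|u k x| - l k) 0)%:E).
  exact: measurable_excess.
have mG : measurable_fun setT G.
  by apply: (@ge0_emeasurable_sum _ _ _ _ _ xpredT) => [k x _ _|k _]; [exact: e0|exact: me].
have G0 x : 0 <= G x by apply: nneseries_ge0 => k _ _; exact: e0.
have IG : \int[mu]_x G x = \sum_(0 <= k <oo) Phi mu setT (u k) (l k).
  by rewrite integral_nneseries.
have iG : mu.-integrable setT G.
  apply/integrableP; split => //.
  by under eq_integral => x _ do rewrite gee0_abs//; rewrite IG.
have Gfin : {ae mu, forall x, G x \is a fin_num}.
  have := integrable_ae measurableT iG.
  by apply: filterS => x; exact.
have L0 : 0 <= L by apply: nneseries_ge0 => k _ _; rewrite lee_fin.
have H : {ae mu, forall x, sumf u n x @[n --> \oo] --> limf u x /\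
                           `|limf u x|%:E <= L + G x}.
  apply: filterS Gfin => x Gx.
  pose b k := (l k + Num.max (`|u k x| - l k) 0)%R.
  have Eb : \sum_(0 <= k <oo) (b k)%:E = L + G x.
    rewrite -nneseriesD// => k _ _; by rewrite lee_fin.
  have ub k : (`|u k x| <= b k)%R by rewrite -lerBlDl le_max lexx.
  have [|r [cr lr]] := cvg_sum_abs ub.
    by rewrite Eb lte_add_pinfty// ltey_eq Gx.
  by have E := limfE cr; rewrite E; split => //; rewrite -Eb.
split; first by apply: filterS H => x [].
rewrite -IG; apply: ae_ge0_le_integral => //.
- by move=> x _; rewrite lee_fin le_max lexx orbT.
- by apply: measurable_excess; exact: measurable_limf.
apply: filterS H => x [_ H] _.
have Lf : L \is a fin_num by rewrite ge0_fin_numE.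
move: H; rewrite -{1}(fineK Lf) => H.
rewrite EFin_max ge_max G0 andbT.
by rewrite EFinB leeBlDl.
Qed.

End pointwise_series.

(** * Domination, monotone limits and series on the half line *)

Section half_line_space.
Context {R : realType}.
Variables (X : set (lebesgueType R -> R)) (normX : (lebesgueType R -> R) -> R).
Hypothesis XS : fully_symmetric X normX.
Implicit Types F G : lebesgueType R -> R.
Local Notation nu := (@nu R).
Local Notation halfline := (@halfline R).

Let mh : measurable halfline := @measurable_halfline R.

Lemma X_le F G : X F -> measurable_fun halfline G ->
  {ae nu, forall t, halfline t -> `|G t| <= `|F t|} ->
  X G /\ normX G <= normX F.
Proof.
move=> XF mG H; have LF := fs_sub XS XF.
have HP l : 0 <= l -> (Phi nu halfline G l <= Phi nu halfline F l)%E.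
  by move=> l0; exact: (Phi_le_norm mh _ LF.1 mG H).
have LG : L0mu nu halfline G.
  apply: (L0mu_Phi mh mG (rearr_ge0 nu halfline F 1)).
  apply: le_lt_trans (HP _ (rearr_ge0 nu halfline F 1)) _.
  by apply: (Phi_fin mh LF ltr01); exact: (X_Kf_fin XS).
apply: (fs_symmetric XS XF LG) => s s0.
exact: (Kf_le_Phi mh mh LF LG HP s0).
Qed.

Lemma X_B F G : X F -> X G -> X (F \- G) /\ normX (F \- G) <= normX F + normX G.
Proof.
move=> XF XG; have XG' := fs_Z XS (-1) XG.
have -> : F \- G = F \+ (fun t => -1 * G t).
  by apply/funext => t /=; rewrite mulN1r.
split; first exact: (fs_D XS).
by apply: le_trans (fs_normD XS XF XG') _; rewrite (fs_normZ XS)// normrN1 mul1r.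
Qed.

Lemma normX_sym F G : X F -> X G -> normX (F \- G) = normX (G \- F).
Proof.
move=> XF XG; have [XB _] := X_B XG XF.
have -> : F \- G = (fun t => -1 * (G \- F) t).
  by apply/funext => t /=; rewrite mulN1r opprB.
by rewrite (fs_normZ XS)// normrN1 mul1r.
Qed.

Lemma normX_tri F G H : X F -> X G -> X H ->
  normX (F \- H) <= normX (F \- G) + normX (G \- H).
Proof.
move=> XF XG XH; have [XB _] := X_B XF XG; have [XB' _] := X_B XG XH.
have -> : F \- H = (F \- G) \+ (G \- H).
  by apply/funext => t /=; rewrite addrA subrK.
exact: (fs_normD XS).
Qed.

Lemma normX0 : normX (cst 0) = 0.
Proof.
have := fs_normZ XS 0 (fs_0 XS); rewrite normr0 mul0r => H; rewrite -[RHS]H.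
by congr normX; apply/funext => t /=; rewrite mul0r.
Qed.

(** Norm convergence gives no pointwise information directly. But the positive part of [S n - F] is
    dominated by [|S m - F|] for all [m >= n], so its norm is zero. *)
Lemma X_monotone_limit (S : nat -> lebesgueType R -> R) F n :
  (forall n, X (S n)) -> X F -> (forall n t, S n t <= S n.+1 t) ->
  normX (S m \- F) @[m --> \oo] --> (0 : R) ->
  {ae nu, forall t, halfline t -> S n t <= F t}.
Proof.
move=> XSn XF ndS SF.
have ndS' m : (n <= m)%N -> forall t, S n t <= S m t.
  move=> /subnK <-; elim: (m - n)%N => [//|k IH] t.
  by apply: le_trans (IH t) _; rewrite addSn.
pose H t := Num.max (S n t - F t) 0.
have LF := fs_sub XS XF; have LS := fs_sub XS (XSn n).
have mH : measurable_fun halfline H.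
  apply: (@measurable_maxr _ (lebesgueType R) R _ (S n \- F) (cst 0)).
    by apply: measurable_funB; [exact: LS.1|exact: LF.1].
  exact: measurable_cst.
have XH m : (n <= m)%N -> X H /\ normX H <= normX (S m \- F).
  move=> nm; have [XB _] := X_B (XSn m) XF.
  apply: X_le => //; apply: nearW => t _ /=.
  rewrite ger0_norm ?le_max ?lexx ?orbT// ge_max normr_ge0 andbT.
  by apply: le_trans (ler_norm _); rewrite lerD2r; exact: ndS'.
have [XH' _] := XH n (leqnn n).
have H0 : normX H = 0.
  apply/eqP; rewrite eq_le (fs_norm_ge0 XS XH') andbT.
  rewrite -(cvg_lim _ SF)//; apply: limr_ge; first by apply/cvg_ex; exists 0.
  by exists n => // m /= nm; have [] := XH m nm.
apply: filterS (fs_norm_eq0 XS XH' H0) => t h th.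
move: (h th); rewrite /H/= => h'; rewrite -subr_le0 -h'.
by rewrite le_max lexx.
Qed.

End half_line_space.

Lemma half_pow_le {R : realType} n : (2^-1 : R) ^+ n <= n.+1%:R^-1.
Proof.
by rewrite exprVn lef_pV2 ?posrE ?exprn_gt0// -natrX ler_nat ltn_expl.
Qed.

Lemma half_pow_small {R : realType} (c e : R) : 0 < e ->
  exists N, forall n, (N <= n)%N -> c * 2^-1 ^+ n < e.
Proof.
move=> e0; pose e' := PosNum (divr_gt0 e0 (ltr_pwDl ltr01 (normr_ge0 c))).
have [N _ HN] := near_infty_natSinv_lt e'.
exists N => n Nn; have := HN n Nn; rewrite /= => h.
have c0 : 0 < 1 + `|c| by rewrite ltr_pwDl.
apply: le_lt_trans (_ : (1 + `|c|) * n.+1%:R^-1 < _); last first.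
  by rewrite mulrC -ltr_pdivlMr.
apply: (@le_trans _ _ ((1 + `|c|) * 2^-1 ^+ n)).
  apply: ler_wpM2r; first by rewrite exprn_ge0// invr_ge0.
  by apply: le_trans (ler_norm c) _; rewrite lerDr.
by apply: ler_wpM2l; [exact: ltW|exact: half_pow_le].
Qed.

Section half_line_series.
Context {R : realType}.
Variables (X : set (lebesgueType R -> R)) (normX : (lebesgueType R -> R) -> R).
Hypothesis XS : fully_symmetric X normX.
Variables (v : nat -> lebesgueType R -> R) (c : R).
Hypothesis Xv : forall k, X (v k).
Hypothesis v0 : forall k t, 0 <= v k t.
Hypothesis vc : forall k, normX (v k) <= c * 2^-1 ^+ k.
Local Notation nu := (@nu R).
Local Notation halfline := (@halfline R).

Let S n : lebesgueType R -> R := fun t => \sum_(k < n) v k t.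

Let SS n : S n.+1 = S n \+ v n.
Proof. by apply/funext => t; rewrite /S big_ord_recr. Qed.

Let S0 : S 0 = cst 0.
Proof. by apply/funext => t; rewrite /S big_ord0. Qed.

Let XSn n : X (S n).
Proof.
by elim: n => [|n IH]; rewrite ?S0 ?SS; [exact: (fs_0 XS)|exact: (fs_D XS)].
Qed.

(** The exact geometric tail is kept because it telescopes in the induction on [m - n]. *)
Let SB n m : (n <= m)%N ->
  normX (S m \- S n) <= c * (2 * 2^-1 ^+ n - 2 * 2^-1 ^+ m).
Proof.
move=> /subnK <-; elim: (m - n)%N => [|k IH].
  rewrite add0n subrr mulr0 (_ : _ \- _ = cst 0) ?(normX0 XS)//.
  by apply/funext => t /=; rewrite subrr.
rewrite addSn SS (_ : _ \- _ = (S (k + n) \- S n) \+ v (k + n)%N); last first.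
  by apply/funext => t /=; rewrite addrAC.
have [XB _] := X_B XS (XSn (k + n)) (XSn n).
apply: le_trans (fs_normD XS XB (Xv _)) _.
apply: le_trans (lerD IH (vc _)) _.
by rewrite le_eqVlt; apply/orP; left; apply/eqP; rewrite exprS; field.
Qed.

(** The partial sums increase and are Cauchy, so the limit given by completeness dominates them all;
    this majorant and its norm are what the series on Omega will need. *)
Lemma X_series : exists F, [/\ X F, normX F <= c * 2 &
  forall n, {ae nu, forall t, halfline t -> \sum_(k < n) v k t <= F t}].
Proof.
have c0 : 0 <= c.
  have := vc 0; rewrite expr0 mulr1; apply: le_trans.
  exact: (fs_norm_ge0 XS).
have p0 n : 0 <= (2^-1 : R) ^+ n by rewrite exprn_ge0// invr_ge0.
have SB' n m : (n <= m)%N -> normX (S m \- S n) <= c * 2 * 2^-1 ^+ n.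
  move=> nm; apply: le_trans (SB nm) _; rewrite -mulrA; apply: ler_wpM2l => //.
  by rewrite lerBlDr lerDl mulr_ge0.
have [F XF SF] : exists2 F, X F & normX (S n \- F) @[n --> \oo] --> (0 : R).
  apply: (fs_complete XS XSn) => e e0.
  have [K HK] := half_pow_small (c * 2) e0; exists K => m n Km Kn.
  have [mn|nm] := leqP m n.
    by rewrite (normX_sym XS)//; apply: le_lt_trans (SB' _ _ mn) _; exact: HK.
  by apply: le_lt_trans (SB' _ _ (ltnW nm)) _; exact: HK.
exists F; split => //.
  have FN n : normX F <= c * 2 + normX (S n \- F).
    have H := normX_tri XS XF (XSn n) (fs_0 XS).
    rewrite (_ : F \- cst 0 = F) in H; last by apply/funext => t /=; rewrite subr0.
    apply: le_trans H _; rewrite addrC (normX_sym XS XF (XSn n)) lerD2r.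
    by have := SB' 0%N n (leq0n n); rewrite expr0 mulr1 S0.
  have C : c * 2 + normX (S n \- F) @[n --> \oo] --> c * 2 + 0.
    by apply: cvgD => //; exact: cvg_cst.
  rewrite -[leRHS]addr0 -(cvg_lim _ C)//.
  apply: limr_ge; last by apply: nearW.
  by apply/cvg_ex; eexists; exact: C.
have ndS k t : S k t <= S k.+1 t by rewrite SS /= lerDl.
by move=> n; exact: (@X_monotone_limit _ _ _ XS S F n XSn XF ndS SF).
Qed.

End half_line_series.

Lemma sum_integral_le {R : realType} {d : measure_display} {T : measurableType d}
    (mu : {measure set T -> \bar R}) (A : set T) (v : nat -> T -> R) (F : T -> R) n :
  measurable A -> (forall k, measurable_fun A (v k)) ->
  (forall k x, 0 <= v k x) -> measurable_fun A F ->
  {ae mu, forall x, A x -> \sum_(k < n) v k x <= F x} ->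
  (\sum_(k < n) \int[mu]_(x in A) (v k x)%:E <= \int[mu]_(x in A) (`|F x|%R)%:E)%E.
Proof.
move=> mA mv v0 mF H; rewrite -ge0_integral_sum//; last first.
- by move=> k x _; rewrite lee_fin.
- by move=> k; exact/measurable_EFinP.
apply: ae_ge0_le_integral => //.
- by move=> x _; apply: sume_ge0 => k _; rewrite lee_fin.
- by apply: emeasurable_sum => k; exact/measurable_EFinP.
- by apply/measurable_EFinP; exact: measurableT_comp.
by apply: filterS H => x H Ax; rewrite sumEFin lee_fin (le_trans (H Ax))// ler_norm.
Qed.

Section completeness.
Context {R : realType} {d : measure_display} {T : measurableType d}.
Variables (mu : {measure set T -> \bar R}).
Variables (X : set (lebesgueType R -> R)) (normX : (lebesgueType R -> R) -> R).
Hypothesis XS : fully_symmetric X normX.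
Implicit Types f g : T -> R.
Local Notation nu := (@nu R).
Local Notation halfline := (@halfline R).
Local Notation Y := (space_on mu X).
Local Notation N := (norm_on mu normX).
Local Notation K := (Kf mu setT).
Local Notation Ph := (Phi mu setT).

(** Completeness is available on the half line only, so the rearrangements of the [u k] are summed
    there. Their majorant [F] bounds the sum of the [K (u k) s], and [KfE] splits this sum into the
    series of heights and the series of excesses required by [series_ae]. *)
Lemma Y_series (u : nat -> T -> R) (c : R) : (forall k, Y (u k)) ->
  (forall k, N (u k) <= c * 2^-1 ^+ k) ->
  [/\ Y (limf u), N (limf u) <= c * 2 &
   {ae mu, forall x, sumf u n x @[n --> \oo] --> limf u x}].
Proof.
move=> Yu Nu.
have [F [XF NF FS]] := X_series XS (fun k => (Yu k).2)
  (fun k t => rearr_ge0 mu setT (u k) t) Nu.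
have Lu k : L0mu mu setT (u k) := (Yu k).1.
have LF := fs_sub XS XF.
pose B s := (\int[nu]_(t in [set t : R | (0 < t < s)%R]) (`|F t|%R)%:E)%E.
have Bfin s : 0 < s -> (B s < +oo)%E.
  move=> s0; apply: le_lt_trans (X_Kf_fin XS XF s0).
  apply: (integral_le_Kf (@measurable_halfline R) LF (@measurable_0lt R s)
    (@sub_0lt_halfline R s) s0).
  by rewrite nu_0lt// ltW.
have KB s : 0 < s -> (\sum_(0 <= k <oo) K (u k) s <= B s)%E.
  move=> s0; apply: lime_le.
    by apply: is_cvg_nneseries => k _ _; exact: Kf_ge0.
  apply: nearW => n; rewrite big_mkord.
  apply: (@sum_integral_le R _ (lebesgueType R) nu _
    (fun k => rearr mu setT (u k)) F n (@measurable_0lt R s)).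
  - by move=> k; apply/measurable_EFinP; exact: measurable_rearr_0lt.
  - by move=> k t; exact: rearr_ge0.
  - exact: (measurable_funS (@measurable_halfline R) (@sub_0lt_halfline R s) LF.1).
  - apply: (@filterS _ _ _ _ _ _ (FS n)) => t h ts; apply: h.
    exact: (@sub_0lt_halfline R s).
(* These heights are optimal for one [s] only, so the bound on [K (limf u) s] is derived separately
   for each [s]; [limf u] itself does not depend on them. *)
pose l s k := rearr mu setT (u k) s.
have l0 s k : 0 <= l s k by exact: rearr_ge0.
have Ph0 s k : (0 <= Ph (u k) (l s k))%E by exact: Phi_ge0.
have EK s : 0 < s -> (\sum_(0 <= k <oo) K (u k) s =
    s%:E * (\sum_(0 <= k <oo) (l s k)%:E) +
    \sum_(0 <= k <oo) Ph (u k) (l s k))%E.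
  move=> s0; rewrite -nneseriesZl; last by move=> k _; rewrite lee_fin.
  rewrite -nneseriesD//; last by move=> k _ _; rewrite -EFinM lee_fin mulr_ge0// ltW.
  by apply: eq_eseriesr => k _; rewrite (KfE measurableT (Lu k) s0) EFinM.
have sl0 s : (0 <= \sum_(0 <= k <oo) (l s k)%:E)%E.
  by apply: nneseries_ge0 => k _ _; rewrite lee_fin.
have sP0 s : (0 <= \sum_(0 <= k <oo) Ph (u k) (l s k))%E.
  by apply: nneseries_ge0.
have Poo s : 0 < s -> (\sum_(0 <= k <oo) Ph (u k) (l s k) < +oo)%E.
  move=> s0; apply: le_lt_trans (Bfin s s0); apply: le_trans (KB s s0).
  by rewrite EK// leeDr// mule_ge0// lee_fin ltW.
have loo s : 0 < s -> (\sum_(0 <= k <oo) (l s k)%:E < +oo)%E.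
  move=> s0; rewrite ltNge leye_eq; apply/negP => /eqP H.
  have := le_lt_trans (KB s s0) (Bfin s s0).
  rewrite EK// H gt0_muley ?lte_fin// addye; first by rewrite ltxx.
  by rewrite gt_eqF// (lt_le_trans _ (sP0 s)).
have mu_ k : measurable_fun setT (u k) by exact: (Lu k).1.
have SA s (s0 : 0 < s) := series_ae mu_ (l0 s) (loo s s0) (Poo s s0).
have mr := measurable_limf mu_.
have Lr : L0mu mu setT (limf u).
  apply: (L0mu_Phi measurableT mr (_ : 0 <= fine (\sum_(0 <= k <oo) (l 1 k)%:E))).
    by rewrite fine_ge0.
  exact: le_lt_trans (SA 1 ltr01).2 (Poo 1 ltr01).
have [] := Y_of_X XS XF Lr.
  move=> s s0; apply: le_trans (KB s s0); rewrite EK//.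
  apply: le_trans (Kf_le measurableT Lr s0 (_ : 0 <= fine (\sum_(0 <= k <oo) (l s k)%:E))) _.
    by rewrite fine_ge0.
  rewrite EFinM fineK; last by rewrite ge0_fin_numE// loo.
  by apply: leeD => //; exact: (SA s s0).2.
move=> Yr Nr; split => //; first exact: le_trans NF.
exact: (SA 1 ltr01).1.
Qed.

Let mh : measurable halfline := @measurable_halfline R.

Lemma Y_Kf_leZ F g (c : R) : X F -> L0mu mu setT g -> 0 <= c ->
  (forall s : R, 0 < s -> (K g s <= c%:E * Kf nu halfline F s)%E) ->
  Y g /\ N g <= c * normX F.
Proof.
move=> XF Lg c0 H; have LF := fs_sub XS XF.
(* [F] is replaced by its rearrangement, because over [(0, s)] the integral of [|F|] may be smaller
   than [Kf F s]. *)
have LF' := L0mu_rearr mh LF.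
have sub : submajorized (rearr nu halfline F) F.
  by move=> s s0; rewrite (rearr_rearr mh LF).
have [XF' NF'] := fs_symmetric XS XF LF' sub.
have [] := Y_of_X XS (fs_Z XS c XF') Lg _.
  move=> s s0; apply: le_trans (H s s0) _.
  have E := ge0_integralZl nu (@measurable_0lt R s)
    (@measurable_rearr_0lt _ _ _ nu halfline mh _ s LF).
  rewrite le_eqVlt; apply/orP; left; apply/eqP.
  rewrite /Kf -E ?lee_fin//; last by move=> t _; rewrite lee_fin rearr_ge0.
  apply: eq_integral => t _.
  by rewrite -EFinM normrM !ger0_norm// rearr_ge0.
move=> YD ND; split => //; apply: le_trans ND _.
by rewrite (fs_normZ XS)// ger0_norm// ler_wpM2l.
Qed.

(* The bounds on [g] say that [K g s <= min (e s) C]. *)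
Lemma Y_small_values F g (c e C t : R) : X F -> measurable_fun setT g ->
  0 < t -> 0 <= c -> 0 <= e -> {ae mu, forall x, `|g x| <= e} ->
  (Ph g 0 <= C%:E)%E ->
  e <= c * rearr nu halfline F t -> (C%:E <= c%:E * Kf nu halfline F t)%E ->
  Y g /\ N g <= c * normX F.
Proof.
move=> XF mg t0 c0 e0 ge Pg0 ec Cc.
have LF := fs_sub XS XF.
have Lg : L0mu mu setT g.
  by apply: (L0mu_Phi measurableT mg (lexx 0)); apply: le_lt_trans Pg0 (ltry _).
(* Up to [t] the bound [e * s] suffices, since the rearrangement of [F] decreases; beyond [t] the
   bound [C] does, since [Kf F] increases. *)
apply: (Y_Kf_leZ XF Lg c0) => s s0; have [st|ts] := leP s t.
  apply: le_trans (Kf_le measurableT Lg s0 e0) _.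
  have -> : Ph g e = 0%E.
    apply/eqP; rewrite eq_le Phi_ge0 andbT -(Phi_cst0 mu setT (lexx 0)).
    apply: Phi_le_ae => //.
    by apply: filterS ge => x gx _; rewrite normr0 subr0 subr_le0.
  rewrite adde0 (KfE mh LF s0) ge0_muleDr ?Phi_ge0 ?lee_fin ?mulr_ge0 ?rearr_ge0 ?(ltW s0)//.
  apply: le_trans (leeDl _ _); last by rewrite mule_ge0 ?Phi_ge0.
  rewrite -EFinM lee_fin mulrCA; apply: ler_wpM2l; first exact: ltW.
  by apply: le_trans ec _; apply: ler_wpM2l => //; exact: rearr_nincr.
apply: le_trans (Kf_le measurableT Lg s0 (lexx 0)) _.
rewrite mulr0 add0e; apply: le_trans Pg0 _; apply: le_trans Cc _.
apply: lee_wpmul2l; rewrite ?lee_fin//.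
apply: le_trans (Kf_le mh LF t0 (rearr_ge0 nu halfline F s)) _.
rewrite (KfE mh LF s0); apply: leeD => //; rewrite lee_fin.
by apply: ler_wpM2r; [exact: rearr_ge0|exact: ltW].
Qed.

Lemma X_rearr_gt0 : exists F, exists2 t, X F & 0 < t /\ 0 < rearr nu halfline F t.
Proof.
have [F XF Fn0] := fs_nonzero XS; exists F; apply: contrapT => H; apply: Fn0.
have LF := fs_sub XS XF.
have F0 t : 0 < t -> rearr nu halfline F t = 0.
  move=> t0; apply/eqP; rewrite eq_le rearr_ge0 andbT leNgt; apply/negP => h.
  by apply: H; exists t.
apply/(Phi_ae0 nu mh LF.1).
have K1 := KfE mh LF ltr01.
have K0 : Kf nu halfline F 1 = 0%E.
  by apply: integral0_eq => t /= /andP[t0 _]; rewrite F0.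
by move: K1; rewrite K0 F0// mulr0 add0e.
Qed.

Lemma BI_Y g (e C : R) : measurable_fun setT g -> {ae mu, forall x, `|g x| <= e} ->
  0 <= e -> (Ph g 0 <= C%:E)%E -> Y g.
Proof.
move=> mg ge e0 gC; have [F [t XF [t0 Ft]]] := X_rearr_gt0.
set a := rearr nu halfline F t in Ft.
have Kt : ((t * a)%:E <= Kf nu halfline F t)%E.
  by rewrite (KfE mh (fs_sub XS XF) t0) leeDl// Phi_ge0.
have ta0 : 0 < t * a by rewrite mulr_gt0.
(* One summand for each requirement of [Y_small_values]: [e <= c * a], and [C <= c * (t * a)], where
   [t * a] is a lower bound of [Kf F t]. *)
pose c := e / a + `|C| / (t * a).
have c1 : 0 <= e / a by rewrite divr_ge0// ltW.
have c2 : 0 <= `|C| / (t * a) by rewrite divr_ge0// ltW.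
have [] := @Y_small_values F g c e C t XF mg t0 _ e0 ge gC.
- by rewrite addr_ge0.
- by rewrite -ler_pdivrMr// lerDl.
apply: (@le_trans _ _ (c%:E * (t * a)%:E)%E).
  rewrite -EFinM lee_fin -ler_pdivrMr//; apply: le_trans (_ : `|C| / (t * a) <= _).
    by rewrite ler_pM2r ?invr_gt0// ler_norm.
  by rewrite lerDr.
  by apply: lee_wpmul2l; rewrite ?lee_fin// addr_ge0.
by move=> Yg _.
Qed.

End completeness.

(** * The mean ergodic theorem in an abstract quadratic space *)

Section mean_ergodic.
Context {R : realType}.
Variable q : {poly R} -> R.
Hypothesis q_ge0 : forall p, 0 <= q p.
Hypothesis qZ : forall c p, q (c *: p) = c ^+ 2 * q p.
Hypothesis q_shift : forall p, q ('X * p) <= q p.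
Hypothesis q_parallelogram :
  forall p r, q (p + r) + q (p - r) = 2 * q p + 2 * q r.
Hypothesis q_add : forall e p r, 0 < e ->
  q (p + r) <= (1 + e) * q p + (1 + e^-1) * q r.

(** ['X] stands for the operator, and [q p] for the squared L2 norm of [p] evaluated at the operator
    and applied to a fixed function. Commutation and telescoping become polynomial identities. *)
Definition avg n : {poly R} := n%:R^-1 *: \sum_(k < n) 'X^k.

Let q0 : q 0 = 0.
Proof. by have := qZ 0 0; rewrite scaler0 expr0n mul0r. Qed.

Let q_Xn k p : q ('X^k * p) <= q p.
Proof.
elim: k => [|k IH]; first by rewrite expr0 mul1r.
by rewrite exprS -mulrA; exact: le_trans (q_shift _) IH.
Qed.

(** Cauchy-Schwarz for sums, with [q_add] in place of an inner product; the weight [1 / n.+1] makes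
    both coefficients equal to [n.+2]. *)
Let q_sum (r : nat -> {poly R}) n :
  q (\sum_(k < n) r k) <= n%:R * \sum_(k < n) q (r k).
Proof.
elim: n => [|n IH]; first by rewrite !big_ord0 q0 mul0r.
case: n IH => [_|n IH]; first by rewrite !big_ord_recr !big_ord0/= !add0r mul1r.
rewrite big_ord_recr/= [in leRHS]big_ord_recr/=.
have n0 : 0 < n.+1%:R :> R by rewrite ltr0n.
have e0 : 0 < n.+1%:R^-1 :> R by rewrite invr_gt0.
apply: le_trans (q_add _ _ e0) _; rewrite invrK.
apply: le_trans (_ : (1 + n.+1%:R^-1) * (n.+1%:R * \sum_(i < n.+1) q (r i)) +
  (1 + n.+1%:R) * q (r n.+1) <= _).
  by rewrite lerD2r; apply: ler_wpM2l => //; rewrite addr_ge0// ltW.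
rewrite mulrA mulrDl mul1r mulVf ?gt_eqF// -[n.+2%:R]natr1 mulrDr.
by rewrite [1 + n.+1%:R]addrC.
Qed.

Let q_mean (r : nat -> {poly R}) n (C : R) : (forall k, (k < n)%N -> q (r k) <= C) ->
  (0 < n)%N -> q (n%:R^-1 *: \sum_(k < n) r k) <= C.
Proof.
move=> H n0; have n0' : 0 < n%:R :> R by rewrite ltr0n.
rewrite qZ; apply: le_trans (_ : n%:R^-1 ^+ 2 * (n%:R * (n%:R * C)) <= _).
  apply: ler_wpM2l; first by rewrite exprn_ge0// invr_ge0 ltW.
  apply: le_trans (q_sum _ _) _; apply: ler_wpM2l; first exact: ltW.
  apply: le_trans (ler_sum _ (fun (i : 'I_n) _ => H i (ltn_ord i))) _.
  by rewrite sumr_const card_ord mulr_natl.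
by rewrite le_eqVlt; apply/orP; left; apply/eqP; field; rewrite gt_eqF.
Qed.

Let q_avg n p : (0 < n)%N -> q (avg n * p) <= q p.
Proof.
move=> n0; rewrite /avg -scalerAl mulr_suml.
apply: (@q_mean (fun k => 'X^k * p)) => // k _; exact: q_Xn.
Qed.

Let q_add2 p r : q (p + r) <= 2 * q p + 2 * q r.
Proof. by rewrite -q_parallelogram lerDl. Qed.

Let qN p : q (- p) = q p.
Proof. by rewrite -scaleN1r qZ sqrrN expr1n mul1r. Qed.

(* [w] is good when averaging absorbs it: this holds for averages, whose
   product with [avg N] differs from [avg N] by a telescoping sum. *)
Let good w := exists C : R, forall n, (0 < n)%N ->
  q (avg n * (w - 1)) <= C / n%:R ^+ 2.

Let good_Xn k n : (0 < n)%N ->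
  q (avg n * ('X^k - 1)) <= 4 * k%:R ^+ 2 * q 1 / n%:R ^+ 2.
Proof.
move=> n0; have n0' : 0 < n%:R :> R by rewrite ltr0n.
(* Both ['X^k - 1] and ['X^n - 1] are multiples of ['X - 1]. Exchanging the cofactors leaves a sum
   of only [k] terms, so the factor [1 / n ^ 2] survives. *)
have -> : avg n * ('X^k - 1) = n%:R^-1 *: (('X^n - 1) * \sum_(i < k) 'X^i).
  rewrite /avg -scalerAl !subrX1; congr (_ *: _).
  by rewrite mulrCA mulrA.
rewrite qZ exprVn mulrC; apply: ler_wpM2r; first by rewrite invr_ge0 exprn_ge0// ltW.
have qs : q (\sum_(i < k) 'X^i) <= k%:R ^+ 2 * q 1.
  apply: le_trans (q_sum (fun i => 'X^i) k) _.
  rewrite expr2 -mulrA; apply: ler_wpM2l => //.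
  rewrite mulr_natl -[X in _ *+ X]card_ord -sumr_const; apply: ler_sum => i _.
  by rewrite -['X^i]mulr1; exact: q_Xn.
rewrite mulrBl mul1r; apply: le_trans (q_add2 _ _) _; rewrite qN.
have := q_Xn n (\sum_(i < k) 'X^i); nra.
Qed.

Let good_avg n : (0 < n)%N -> good (avg n).
Proof.
move=> n0; exists (4 * n%:R ^+ 2 * q 1) => N N0.
have -> : avg N * (avg n - 1) = n%:R^-1 *: \sum_(k < n) (avg N * ('X^k - 1)).
  rewrite -mulr_sumr scalerAr; congr (_ * _).
  rewrite sumrB sumr_const card_ord scalerBr -/(avg n); congr (_ - _).
  by rewrite -scalerMnr scalerMnl -mulr_natr mulVf ?scale1r// pnatr_eq0 -lt0n.
apply: (@q_mean (fun k => avg N * ('X^k - 1))) => // k kn.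
apply: le_trans (good_Xn k N0) _.
apply: ler_wpM2r; first by rewrite invr_ge0 exprn_ge0.
apply: ler_wpM2r => //; apply: ler_wpM2l => //.
by rewrite lerXn2r ?nnegrE// ler_nat ltnW.
Qed.

Let good_mid w w' : good w -> good w' -> good (2^-1 *: (w + w')).
Proof.
move=> [C HC] [C' HC']; exists (2^-1 * C + 2^-1 * C') => n n0.
have -> : avg n * (2^-1 *: (w + w') - 1) =
    2^-1 *: (avg n * (w - 1)) + 2^-1 *: (avg n * (w' - 1)).
  rewrite -scalerDr -mulrDr scalerAr; congr (_ * _).
  rewrite [in RHS]addrACA [in RHS]scalerDr; congr (_ + _).
  by rewrite -opprD scalerN -mulr2n -scalerMnr scalerMnl -mulr_natr mulVf ?scale1r// pnatr_eq0.
apply: le_trans (q_add2 _ _) _; rewrite !qZ.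
rewrite [leRHS]mulrDl -!mulrA.
have := HC n n0; have := HC' n n0.
set x := C' / _; set y := C / _; set u := q _; set v := q _.
lra.
Qed.

(** [avg n] differs from [avg n * w] by a vanishing term, and [q (avg n * w) <= q w]. As [q_add]
    carries weights, [d] is chosen with [d * q w <= e / 2]. *)
Let good_le w e : good w -> 0 < e ->
  exists N, forall n, (N <= n)%N -> q (avg n) <= q w + e.
Proof.
move=> [C HC] e0.
pose d := e / 2 / (q w + 1).
have d0 : 0 < d by rewrite divr_gt0 ?divr_gt0// ltr_wpDl.
pose B := (1 + d^-1) * `|C|.
have B0 : 0 <= B by rewrite mulr_ge0// addr_ge0// invr_ge0 ltW.
pose N := (Num.bound (B / (e / 2))).+1.
exists N => n Nn; have n0 : (0 < n)%N by apply: leq_trans Nn.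
have E : avg n = avg n * w + (- (avg n * (w - 1))).
  by rewrite mulrBr mulr1 opprB addrC subrK.
rewrite {1}E; apply: le_trans (q_add _ _ d0) _; rewrite qN.
have h1 : (1 + d) * q (avg n * w) <= q w + e / 2.
  apply: le_trans (_ : (1 + d) * q w <= _).
    by apply: ler_wpM2l; [rewrite addr_ge0// ltW|exact: q_avg].
  rewrite mulrDl mul1r lerD2l /d -mulrA ler_piMr//; first by rewrite ltW// divr_gt0.
  by rewrite mulrC ler_pdivrMr ?mul1r ?lerDl// ltr_wpDl.
have h2 : (1 + d^-1) * q (avg n * (w - 1)) <= e / 2.
  apply: le_trans (_ : (1 + d^-1) * (`|C| / n%:R ^+ 2) <= _).
    apply: ler_wpM2l; first by rewrite addr_ge0// invr_ge0 ltW.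
    apply: le_trans (HC n n0) _; apply: ler_wpM2r; last exact: ler_norm.
    by rewrite invr_ge0 exprn_ge0.
  rewrite mulrA -/B ler_pdivrMr; last by rewrite exprn_gt0// ltr0n.
  rewrite mulrC -ler_pdivrMr; last by rewrite divr_gt0.
  apply: le_trans (ltW (archi_boundP _)) _.
    by rewrite divr_ge0// divr_ge0// ltW.
  apply: (@le_trans _ _ n%:R); first by rewrite ler_nat ltnW.
  by rewrite expr2 ler_peMr// ler1n.
rewrite [e in leRHS]splitr addrA; exact: lerD.
Qed.

Lemma mean_cauchy e : 0 < e -> exists N, forall m n, (N <= m)%N -> (N <= n)%N ->
  q (avg m - avg n) < e.
Proof.
move=> e0; pose S := [set q (avg n.+1) | n in [set: nat]].
have hlS : has_lbound S by exists 0 => _ [n _ <-].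
have S0 : S !=set0 by exists (q (avg 1)); exists 0%N.
have hS : has_inf S by split.
(* Far enough, each average exceeds the infimum by less than [2 * e / 16]; the parallelogram law
   then bounds the difference by [8 * e / 16]. *)
have e80 : 0 < e / 16 by rewrite divr_gt0.
have [_ [k _ <-] Hk] := inf_adherent e80 hS.
have [N HN] := good_le (good_avg (ltn0Sn k)) e80.
(* A midpoint of averages need not be an average, but later averages fall below [q w + d] for any
   good [w], so the same infimum bounds it from below. *)
have inf_good w : good w -> inf S <= q w.
  move=> gw; apply/ler_addgt0Pr => d d0; have [M HM] := good_le gw d0.
  apply: le_trans (HM M.+1 (leqnSn M)).
  by apply: ge_inf => //; exists M.
exists N.+1 => m n Nm Nn.
have m0 : (0 < m)%N by apply: leq_trans Nm.
have n0 : (0 < n)%N by apply: leq_trans Nn.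
have := inf_good _ (good_mid (good_avg m0) (good_avg n0)).
have := q_parallelogram (avg m) (avg n).
have := HN m (ltnW Nm); have := HN n (ltnW Nn).
rewrite (qZ 2^-1); lra.
Qed.

End mean_ergodic.

(** * Dunford-Schwartz operators *)

Section clip.
Context {R : realFieldType}.
Implicit Types l x : R.

Definition clip l x : R := Num.max (- l) (Num.min l x).

Lemma clip_le l x : (0 <= l) -> (`|clip l x| <= l).
Proof.
by move=> l0; rewrite ler_norml /clip le_max lexx/= ge_max ge_min lexx/= andbT ge0_cp.
Qed.

Lemma clip_excess l x : (0 <= l) -> (`|x - clip l x| = Num.max (`|x| - l) 0).
Proof.
move=> l0; rewrite /clip; have [lx|xl] := leP l x.
  rewrite max_r; last by lra.
  by rewrite !ger0_norm ?subr_ge0 ?max_l ?subr_ge0//; lra.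
have [xl'|lx'] := leP x (- l).
  rewrite opprK ler0_norm; last by lra.
  rewrite ler0_norm; last by lra.
  by rewrite max_l; lra.
rewrite subrr normr0 max_r//.
by rewrite subr_le0 ler_norml !ltW.
Qed.

End clip.

Section Lfun_characterizations.
Context {R : realType} {d : measure_display} {T : measurableType d}.
Variable (mu : {measure set T -> \bar R}).
Hypothesis mu_infinite : mu setT = +oo%E.
Implicit Types f g : T -> R.
Local Notation Ph := (Phi mu setT).
Local Open Scope ereal_scope.

Lemma Phi0E f : Ph f 0 = \int[mu]_x (`|f x|)%:E.
Proof. by apply: eq_integral => x _; rewrite subr0 max_l. Qed.

Lemma Lnorm1_Phi f : 'N[mu]_1[EFin \o f] = Ph f 0.
Proof. by rewrite Lnorm1 Phi0E. Qed.

(** The norm ['N[mu]_+oo] is the essential supremum only on a space of positive measure, which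
    [mu_infinite] provides. *)
Lemma Lnormy_leP f (M : R) : 'N[mu]_+oo[EFin \o f] <= M%:E <->
  {ae mu, forall x, (`|f x| <= M)%R}.
Proof.
rewrite unlock mu_infinite ltry; split.
  by move=> /ess_supP; apply: filterS => x /=; rewrite lee_fin.
by move=> H; apply/ess_supP; apply: filterS H => x /=; rewrite lee_fin.
Qed.

Lemma Lfun1P f : f \in Lfun mu 1 <-> measurable_fun setT f /\ Ph f 0 < +oo.
Proof.
rewrite Lfun1_integrable Phi0E; split.
  by move=> /integrableP[/measurable_EFinP mf].
by move=> [mf h]; apply/integrableP; split => //; exact/measurable_EFinP.
Qed.

Lemma LfunyP f : f \in Lfun mu +oo <->
  measurable_fun setT f /\ exists2 M : R, (0 <= M)%R & {ae mu, forall x, (`|f x| <= M)%R}.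
Proof.
rewrite inE/=; split.
  move=> /andP[]; rewrite !inE => mf; rewrite /finite_norm => h; split; first by [].
  have f0 : 'N[mu]_+oo[EFin \o f] \is a fin_num by rewrite ge0_fin_numE// Lnorm_ge0.
  exists (fine 'N[mu]_+oo[EFin \o f]); first by rewrite fine_ge0// Lnorm_ge0.
  by apply/Lnormy_leP; rewrite fineK.
move=> [mf [M M0 /Lnormy_leP h]]; apply/andP; split; rewrite inE//.
by rewrite /= /finite_norm; apply: le_lt_trans h (ltry _).
Qed.

Lemma measurable_clip f l : measurable_fun setT f ->
  measurable_fun setT (fun x => clip l (f x)).
Proof.
by move=> mf; apply: measurable_maxr => //; exact: measurable_minr.
Qed.

Lemma clip_Lfuny f l : measurable_fun setT f -> (0 <= l)%R ->
  (fun x => clip l (f x)) \in Lfun mu +oo.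
Proof.
move=> mf l0; apply/LfunyP; split; first exact: measurable_clip.
by exists l => //; apply: nearW => x; exact: clip_le.
Qed.

Lemma Phi_unclip f l : (0 <= l)%R -> Ph (fun x => f x - clip l (f x))%R 0 = Ph f l.
Proof.
by move=> l0; rewrite Phi0E; apply: eq_integral => x _; rewrite clip_excess.
Qed.

Lemma unclip_Lfun1 f l : measurable_fun setT f -> (0 <= l)%R -> Ph f l < +oo ->
  (fun x => f x - clip l (f x))%R \in Lfun mu 1.
Proof.
move=> mf l0 h; apply/Lfun1P; rewrite Phi_unclip//; split => //.
by apply: measurable_funB => //; exact: measurable_clip.
Qed.

(** For the converse, [f] is clipped at height [l]: the clip is bounded, and the L1 norm of what is
    cut off is the excess integral. *)
Lemma L1LinfP f : L1Linf mu f <->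
  measurable_fun setT f /\ exists2 l : R, (0 <= l)%R & Ph f l < +oo.
Proof.
split.
  move=> [g [h [/Lfun1P[mg g1] /LfunyP[mh [M M0 hM]] ->]]].
  split; first exact: measurable_funD.
  exists M => //; apply: le_lt_trans g1.
  apply: Phi_le_ae => //; first exact: measurable_funD.
  apply: filterS hM => x hx _; have := ler_normD (g x) (h x) => /=; lra.
move=> [mf [l l0 h]].
exists (fun x => f x - clip l (f x))%R, (fun x => clip l (f x)); split.
- exact: unclip_Lfun1.
- exact: clip_Lfuny.
- by apply/funext => x /=; rewrite subrK.
Qed.

Lemma L1Linf_Lfun1 f : f \in Lfun mu 1 -> L1Linf mu f.
Proof. by move=> /Lfun1P[mf h]; apply/L1LinfP; split => //; exists 0%R. Qed.

Lemma L1Linf_Lfuny f : f \in Lfun mu +oo -> L1Linf mu f.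
Proof.
move=> /LfunyP[mf [M M0 h]]; apply/L1LinfP; split => //; exists M => //.
apply: (@le_lt_trans _ _ (Ph (cst 0%R) 0)); last by rewrite Phi_cst0// ltry.
apply: Phi_le_ae => //.
by apply: filterS h => x hx _; rewrite normr0 subr0 subr_le0.
Qed.

Section DS_operator.
Variable U : (T -> R) -> (T -> R).
Hypothesis DU : DS mu U.

Lemma DS_meas f : L1Linf mu f -> measurable_fun setT (U f).
Proof. by move=> /(DS_stable DU) /L1LinfP[]. Qed.

Lemma DS_bound f (M : R) : measurable_fun setT f -> (0 <= M)%R ->
  {ae mu, forall x, (`|f x| <= M)%R} -> {ae mu, forall x, (`|U f x| <= M)%R}.
Proof.
move=> mf M0 h; apply/Lnormy_leP; apply: le_trans (DS_Linf DU _) _.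
  by apply/LfunyP; split => //; exists M.
exact/Lnormy_leP.
Qed.

Lemma DS_Phi f (l : R) : L1Linf mu f -> (0 <= l)%R -> Ph (U f) l <= Ph f l.
Proof.
move=> Lf l0; have /L1LinfP[mf _] := Lf.
have [->|foo] := eqVneq (Ph f l) +oo; first by rewrite leey.
have {}foo : Ph f l < +oo by rewrite ltey.
pose g x := (f x - clip l (f x))%R; pose h x := clip l (f x).
have g1 : g \in Lfun mu 1 by exact: unclip_Lfun1.
have hy : h \in Lfun mu +oo by exact: clip_Lfuny.
have Lg := L1Linf_Lfun1 g1; have Lh := L1Linf_Lfuny hy.
have lin := DS_linear DU 1 Lg Lh.
have E : (fun x => 1 * g x + h x)%R = f by apply/funext => x; rewrite mul1r subrK.
rewrite {}E in lin.
have Uh : {ae mu, forall x, (`|U h x| <= l)%R}.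
  apply: DS_bound => //; first exact: measurable_clip.
  by apply: nearW => x; exact: clip_le.
have H : Ph (U f) l <= Ph (U g) 0.
  apply: Phi_le_ae => //; [exact: DS_meas|exact: DS_meas|].
  apply: filterS2 lin Uh => x /(_ I) -> hx _; rewrite mul1r subr0.
  have := ler_normD (U g x) (U h x); lra.
apply: le_trans H _; rewrite -Lnorm1_Phi -Phi_unclip// -Lnorm1_Phi.
exact: (DS_L1 DU).
Qed.

End DS_operator.

End Lfun_characterizations.

(** * Contraction of L2 norms by means of excesses *)

Section ramps.
Context {R : realFieldType}.
Implicit Types (h x : R) (n : nat).

(** A Riemann sum, with left endpoints and mesh [h], for twice the integral over [l >= 0] of the
    positive part of [x - l], that is, for the square of a nonnegative [x]. It writes the square
    through excesses, which an operator in DS decreases. *)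
Definition ramps h n x : R := 2 * h * \sum_(i < n) Num.max (x - h * i%:R) 0.

Lemma rampsS h n x : 0 <= x -> ramps h n.+1 x = 2 * h * x + ramps h n (x - h).
Proof.
move=> x0; rewrite /ramps big_ord_recl mulr0 subr0 max_l// mulrDr; congr (_ + _ * _).
by apply: eq_bigr => i _; rewrite lift0 -natr1; congr Num.max; ring.
Qed.

Lemma ramps_neg h n x : 0 <= h -> x <= 0 -> ramps h n x = 0.
Proof.
move=> h0 x0; rewrite /ramps big1 ?mulr0// => i _; apply: max_r.
by rewrite subr_le0 (le_trans x0)// mulr_ge0.
Qed.

Lemma ramps_ge0 h n x : 0 <= h -> 0 <= ramps h n x.
Proof.
move=> h0; rewrite /ramps mulr_ge0// ?mulr_ge0//; apply: sumr_ge0 => i _.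
by rewrite le_max lexx orbT.
Qed.

Lemma ramps_le h n x : 0 <= h -> 0 <= x -> ramps h n x <= x ^+ 2 + 2 * h * x.
Proof.
move=> h0; elim: n x => [|n IH] x x0.
  by rewrite /ramps big_ord0 mulr0 addr_ge0// ?exprn_ge0// ?mulr_ge0.
rewrite rampsS//; have [hx|xh] := leP h x.
  have := IH (x - h); rewrite subr_ge0 => /(_ hx); rewrite !expr2; nra.
by rewrite (ramps_neg _ h0) ?subr_le0 ?(ltW xh)// addr0 lerDr exprn_ge0.
Qed.

Lemma ramps_ge h n x : 0 <= h -> 0 <= x -> x <= h * n%:R -> x ^+ 2 <= ramps h n x.
Proof.
move=> h0; elim: n x => [|n IH] x x0 xn.
  rewrite mulr0 in xn; have -> : x = 0 by apply/eqP; rewrite eq_le xn x0.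
  by rewrite expr0n ramps_neg.
rewrite rampsS//; have [hx|xh] := leP h x.
  have := IH (x - h); rewrite subr_ge0 => /(_ hx).
  have xn' : x - h <= h * n%:R by move: xn; rewrite -natr1; lra.
  by move=> /(_ xn'); rewrite !expr2; nra.
by rewrite (ramps_neg _ h0) ?subr_le0 ?(ltW xh)// addr0 expr2; nra.
Qed.

End ramps.

Section bounded_integrable.
Context {R : realType} {d : measure_display} {T : measurableType d}.
Variable (mu : {measure set T -> \bar R}).
Hypothesis mu_infinite : mu setT = +oo%E.
Implicit Types f g : T -> R.
Local Notation Ph := (Phi mu setT).
Local Open Scope ereal_scope.

Definition bounded_integrable f := [/\ measurable_fun setT f,
  exists2 M : R, (0 <= M)%R & {ae mu, forall x, (`|f x| <= M)%R} & Ph f 0 < +oo].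

Lemma BI_meas f : bounded_integrable f -> measurable_fun setT f.
Proof. by case. Qed.

Lemma BI_L1Linf f : bounded_integrable f -> L1Linf mu f.
Proof. by move=> [mf _ h]; apply/(L1LinfP mu_infinite); split => //; exists 0%R. Qed.

Lemma BI_lin f g a : bounded_integrable f -> bounded_integrable g ->
  bounded_integrable (fun x => a * f x + g x)%R.
Proof.
move=> [mf [M M0 fM] f1] [mg [M' M'0 gM] g1].
have maf : measurable_fun setT (fun x => a * f x)%R by exact: measurable_funM.
split; first exact: measurable_funD.
  exists (`|a| * M + M')%R; first by rewrite addr_ge0// mulr_ge0.
  apply: filterS2 fM gM => x h h'; apply: le_trans (ler_normD _ _) _.
  by rewrite normrM; apply: lerD => //; exact: ler_wpM2l.
rewrite -[0%R](addr0 0%R); apply: le_lt_trans (PhiD mu _ _ _ maf mg) _ => //.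
rewrite -(mulr0 `|a|%R) PhiZ//; apply: lte_add_pinfty; last by rewrite mulr0.
by apply: lte_mul_pinfty => //; rewrite ge0_fin_numE// ltry.
Qed.

Lemma BI0 : bounded_integrable (cst 0%R).
Proof.
split => //; first by exists 0%R => //; apply: nearW => x; rewrite normr0.
by rewrite Phi_cst0.
Qed.

Lemma BI_sqr f : bounded_integrable f -> \int[mu]_x ((f x) ^+ 2)%:E < +oo.
Proof.
move=> [mf [M M0 fM] f1].
apply: (@le_lt_trans _ _ (M%:E * Ph f 0)); last first.
  by apply: lte_mul_pinfty => //; rewrite ge0_fin_numE// ltry.
rewrite Phi0E -ge0_integralZl//; last first.
  by apply/measurable_EFinP; exact: measurableT_comp.
apply: ae_ge0_le_integral => //.
- by move=> x _; rewrite lee_fin sqr_ge0.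
- by apply/measurable_EFinP; exact: measurable_funX.
- by move=> x _; rewrite mule_ge0 ?lee_fin.
- by apply: measurable_funeM; apply/measurable_EFinP; exact: measurableT_comp.
apply: filterS fM => x h _; rewrite -EFinM lee_fin -real_normK ?num_real// expr2.
by apply: ler_wpM2r.
Qed.

Lemma integral_ramps f (h : R) n : measurable_fun setT f -> (0 <= h)%R ->
  measurable_fun setT (fun x => (ramps h n `|f x|)%:E) /\
  \int[mu]_x (ramps h n `|f x|)%:E =
  (2 * h)%:E * \sum_(i < n) Ph f (h * i%:R).
Proof.
move=> mf h0.
have E x : (ramps h n `|f x|)%:E =
    (2 * h)%:E * (\sum_(i < n) (Num.max (`|f x| - h * i%:R) 0)%:E).
  by rewrite /ramps EFinM sumEFin.
have me i : measurable_fun setT (fun x => (Num.max (`|f x| - h * i%:R) 0)%:E).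
  exact: measurable_excess.
have ms : measurable_fun setT
    (fun x => \sum_(i < n) (Num.max (`|f x| - h * i%:R) 0)%:E).
  exact: emeasurable_sum.
split; first by under eq_fun do rewrite E; exact: measurable_funeM.
under eq_integral => x _ do rewrite E.
rewrite ge0_integralZl//; last 2 first.
- by move=> x _; apply: sume_ge0 => i _; rewrite lee_fin le_max lexx orbT.
- by rewrite lee_fin mulr_ge0.
rewrite ge0_integral_sum// => i x _.
by rewrite lee_fin le_max lexx orbT.
Qed.

Section DS_on_BI.
Variable U : (T -> R) -> (T -> R).
Hypothesis DU : DS mu U.

Lemma BI_DS f : bounded_integrable f -> bounded_integrable (U f).
Proof.
move=> Bf; have [mf [M M0 fM] f1] := Bf.
split; first by apply: (DS_meas mu_infinite DU); exact: BI_L1Linf.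
  by exists M => //; exact: (DS_bound mu_infinite DU).
apply: le_lt_trans f1; apply: (DS_Phi mu_infinite DU) => //; exact: BI_L1Linf.
Qed.

(** The square of [U f] is at most its sum of ramps, [U] decreases the integral of each ramp, and
    the ramps of [f] exceed its square by at most [2 * h * |f|], which integrates to at most [e]. *)
Lemma DS_L2 f : bounded_integrable f ->
  \int[mu]_x ((U f x) ^+ 2)%:E <= \int[mu]_x ((f x) ^+ 2)%:E.
Proof.
move=> Bf; have [mf [M M0 fM] f1] := Bf.
have [mUf [M' M'0 UfM] _] := BI_DS Bf.
have P0 : Ph f 0 \is a fin_num by rewrite ge0_fin_numE// Phi_ge0.
apply/lee_addgt0Pr => e e0.
(* [h] makes [2 * h] times the L1 norm of [f] at most [e], the [+ 1] guarding against a zero norm;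
   [n] below lets the ramps reach the bound of [U f]. *)
pose h := (e / (2 * (fine (Ph f 0) + 1)))%R.
have fP0 : (0 <= fine (Ph f 0))%R by rewrite fine_ge0// Phi_ge0.
have h0 : (0 < h)%R by rewrite divr_gt0// mulr_gt0// ltr_wpDl.
pose n := Num.bound (M' / h).
have Mn : (M' <= h * n%:R)%R.
  by rewrite mulrC -ler_pdivrMr// ltW// archi_boundP// divr_ge0// ltW.
have [mr Er] := integral_ramps n mUf (ltW h0).
have [mr' Er'] := integral_ramps n mf (ltW h0).
have msq g : measurable_fun setT g -> measurable_fun setT (fun x => ((g x) ^+ 2)%:E).
  by move=> mg; apply/measurable_EFinP; exact: measurable_funX.
apply: (@le_trans _ _ (\int[mu]_x (ramps h n `|U f x|)%:E)).
  apply: ae_ge0_le_integral => //.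
  - by move=> x _; rewrite lee_fin sqr_ge0.
  - exact: msq.
  - by move=> x _; rewrite lee_fin ramps_ge0// ltW.
  apply: filterS UfM => x hx _; rewrite lee_fin -real_normK ?num_real//.
  by apply: ramps_ge; [exact: ltW| |exact: le_trans Mn].
apply: (@le_trans _ _ (\int[mu]_x (ramps h n `|f x|)%:E)).
  rewrite Er Er'; apply: lee_wpmul2l; first by rewrite lee_fin mulr_ge0// ltW.
  apply: lee_sum => i _; apply: (DS_Phi mu_infinite DU); first exact: BI_L1Linf.
  by rewrite mulr_ge0// ltW.
apply: (@le_trans _ _ (\int[mu]_x (((f x) ^+ 2)%:E + (2 * h)%:E * (`|f x|)%:E))).
  apply: ge0_le_integral => //.
  - by move=> x _; rewrite lee_fin ramps_ge0// ltW.
  - apply: emeasurable_funD; first exact: msq.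
    by apply: measurable_funeM; apply/measurable_EFinP; exact: measurableT_comp.
  - move=> x _; rewrite -EFinM -EFinD lee_fin -[(f x ^+ 2)%R]real_normK ?num_real//.
    by apply: ramps_le => //; exact: ltW.
rewrite ge0_integralD//; last 4 first.
- by move=> x _; rewrite lee_fin sqr_ge0.
- exact: msq.
- by move=> x _; rewrite -EFinM lee_fin mulr_ge0// mulr_ge0// ltW.
- by apply: measurable_funeM; apply/measurable_EFinP; exact: measurableT_comp.
apply: leeD => //; rewrite ge0_integralZl//; last 2 first.
- by apply/measurable_EFinP; exact: measurableT_comp.
- by rewrite lee_fin mulr_ge0// ltW.
rewrite -Phi0E -(fineK P0) -EFinM lee_fin /h.
rewrite -[leRHS]mulr1 -mulrA mulrCA -!mulrA; apply: ler_wpM2l; first exact: ltW.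
by rewrite mulrC ler_pdivrMr ?mul1r; lra.
Qed.

End DS_on_BI.
End bounded_integrable.

(** * Polynomials in a Dunford-Schwartz operator *)

Section DS_iterates.
Context {R : realType} {d : measure_display} {T : measurableType d}.
Variable (mu : {measure set T -> \bar R}).
Hypothesis mu_infinite : mu setT = +oo%E.
Variable U : (T -> R) -> (T -> R).
Hypothesis DU : DS mu U.
Implicit Types f g : T -> R.

Lemma L1Linf_lin a f g : L1Linf mu f -> L1Linf mu g ->
  L1Linf mu (fun x => a * f x + g x).
Proof.
move=> /(L1LinfP mu_infinite)[mf [l l0 h]] /(L1LinfP mu_infinite)[mg [l' l'0 h']].
have maf : measurable_fun setT (fun x => a * f x) by exact: measurable_funM.
apply/(L1LinfP mu_infinite); split; first exact: measurable_funD.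
exists (`|a| * l + l'); first by rewrite addr_ge0// mulr_ge0.
apply: le_lt_trans (PhiD mu measurableT _ _ maf mg) _.
rewrite PhiZ//; apply: lte_add_pinfty => //.
by apply: lte_mul_pinfty => //; rewrite lee_fin.
Qed.

Lemma L1Linf0 : L1Linf mu (cst 0).
Proof. exact: (BI_L1Linf mu_infinite (BI0 mu)). Qed.

Lemma L1Linf_iter k f : L1Linf mu f -> L1Linf mu (iter k U f).
Proof. by move=> Lf; elim: k => //= k; exact: DS_stable. Qed.

Lemma iter_lin k a f g : L1Linf mu f -> L1Linf mu g ->
  ae_eq mu setT (iter k U (fun x => a * f x + g x))
                (fun x => a * iter k U f x + iter k U g x).
Proof.
move=> Lf Lg; elim: k => [|k IH]; first exact: ae_eq_refl.
have L1 := L1Linf_iter k Lf; have L2 := L1Linf_iter k Lg.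
have H := DS_ae DU (L1Linf_iter k (L1Linf_lin a Lf Lg)) (L1Linf_lin a L1 L2) IH.
exact: ae_eq_trans H (DS_linear DU a L1 L2).
Qed.

Lemma DS0 : ae_eq mu setT (U (cst 0)) (cst 0).
Proof.
have := DS_linear DU 0 L1Linf0 L1Linf0.
have -> : (fun x => 0 * cst 0 x + cst 0 x) = (cst 0 : T -> R).
  by apply/funext => x /=; rewrite mul0r addr0.
move=> H; have [mU _] := (L1LinfP mu_infinite _).1 (DS_stable DU L1Linf0).
have B0 := BI0 mu.
have := DS_bound mu_infinite DU (BI_meas B0) (lexx 0).
have z : {ae mu, forall x : T, `|(cst 0 : T -> R) x| <= 0}.
  by apply: nearW => x; rewrite normr0.
move=> /(_ z); apply: filterS => x h _ /=.
by apply/eqP; rewrite -normr_eq0 eq_le h normr_ge0.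
Qed.

Lemma DS_sum (c : nat -> R) (h : nat -> T -> R) n : (forall k, L1Linf mu (h k)) ->
  L1Linf mu (fun x => \sum_(k < n) c k * h k x) /\
  ae_eq mu setT (U (fun x => \sum_(k < n) c k * h k x))
                (fun x => \sum_(k < n) c k * U (h k) x).
Proof.
move=> Lh; elim: n => [|n [IH1 IH2]].
  have -> : (fun x => \sum_(k < 0) c k * h k x) = cst 0.
    by apply/funext => x; rewrite big_ord0.
  split; first exact: L1Linf0.
  by apply: filterS DS0 => x h0 /h0 ->; rewrite big_ord0.
have E : (fun x => \sum_(k < n.+1) c k * h k x) =
    (fun x => c n * h n x + \sum_(k < n) c k * h k x).
  by apply/funext => x; rewrite big_ord_recr/= addrC.
rewrite E; split; first exact: L1Linf_lin.
have := DS_linear DU (c n) (Lh n) IH1.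
apply: filterS2 IH2 => x h1 h2 xT.
by rewrite h2// h1// big_ord_recr/= addrC.
Qed.

Lemma BI_iter k f : bounded_integrable mu f -> bounded_integrable mu (iter k U f).
Proof. by move=> Lf; elim: k => //= k; exact: BI_DS. Qed.

Section orbit_polynomial.
Variable f : T -> R.
Hypothesis Bf : bounded_integrable mu f.

(** Evaluation through coefficients and iterates is exactly additive in [p]; only multiplication by
    ['X] needs the linearity of [U] and holds almost everywhere. *)
Definition orbit_poly (p : {poly R}) : T -> R :=
  fun x => \sum_(i < size p) p`_i * iter i U f x.

Definition orbit_sqr (p : {poly R}) : R :=
  fine (\int[mu]_x ((orbit_poly p x) ^+ 2)%:E).

Let wide (p : {poly R}) n x : (size p <= n)%N ->
  orbit_poly p x = \sum_(i < n) p`_i * iter i U f x.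
Proof.
move=> pn; rewrite /orbit_poly (big_ord_widen _ (fun i => p`_i * iter i U f x) pn).
rewrite [RHS](bigID (fun i : 'I_n => (i < size p)%N))/=.
rewrite [X in _ + X]big1 ?addr0// => i; rewrite -leqNgt => pi.
by rewrite nth_default// mul0r.
Qed.

Lemma orbit_polyD p r x : orbit_poly (p + r) x = orbit_poly p x + orbit_poly r x.
Proof.
set n := maxn (size p) (size r).
rewrite (wide x (leq_maxl _ (size r) : size p <= n)%N).
rewrite (wide x (leq_maxr (size p) _ : size r <= n)%N).
rewrite (wide x (size_polyD _ _ : size (p + r)%R <= n)%N) -big_split/=.
by apply: eq_bigr => i _; rewrite coefD mulrDl.
Qed.

Lemma orbit_polyZ c p x : orbit_poly (c *: p) x = c * orbit_poly p x.
Proof.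
rewrite (wide x (size_scale_leq c p)) mulr_sumr.
by apply: eq_bigr => i _; rewrite coefZ mulrA.
Qed.

Lemma orbit_polyXn k x : orbit_poly 'X^k x = iter k U f x.
Proof.
rewrite /orbit_poly size_polyXn big_ord_recr/= big1 ?add0r ?coefXn ?eqxx ?mul1r//.
by move=> i _; rewrite coefXn ltn_eqF// mul0r.
Qed.

Lemma orbit_poly_avg n x : orbit_poly (avg n) x = average U n f x.
Proof.
rewrite /avg /average orbit_polyZ; congr (_ * _).
elim: n => [|n IH]; last by rewrite !big_ord_recr/= orbit_polyD IH orbit_polyXn.
by rewrite !big_ord0 /orbit_poly size_poly0 big_ord0.
Qed.

Lemma orbit_poly_shift p :
  ae_eq mu setT (orbit_poly ('X * p)) (U (orbit_poly p)).
Proof.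
have Lk k : L1Linf mu (iter k U f) by apply: L1Linf_iter; exact: BI_L1Linf.
have [_ H] := DS_sum (fun i => p`_i) (size p) Lk.
apply: filterS H => x h xT; rewrite h//.
have sX : (size ('X * p)%R <= (size p).+1)%N.
  by apply: leq_trans (size_polyMleq _ _) _; rewrite size_polyX.
rewrite (wide x sX) big_ord_recl coefXM/= mul0r add0r.
by apply: eq_bigr => i _; rewrite /bump leq0n add1n coefXM.
Qed.

Lemma BI_orbit_poly p : bounded_integrable mu (orbit_poly p).
Proof.
rewrite /orbit_poly; elim: (size p) => [|n IH].
  have -> : (fun x => \sum_(k < 0) p`_k * iter k U f x) = cst 0.
    by apply/funext => x; rewrite big_ord0.
  exact: BI0.
have -> : (fun x => \sum_(k < n.+1) p`_k * iter k U f x) =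
    (fun x => p`_n * iter n U f x + \sum_(k < n) p`_k * iter k U f x).
  by apply/funext => x; rewrite big_ord_recr/= addrC.
by apply: BI_lin => //; exact: BI_iter.
Qed.

Let msq g : measurable_fun setT g -> measurable_fun setT (fun x => ((g x) ^+ 2)%:E).
Proof. by move=> mg; apply/measurable_EFinP; exact: measurable_funX. Qed.

Let mo p : measurable_fun setT (orbit_poly p).
Proof. by have [] := BI_orbit_poly p. Qed.

Lemma orbit_sqrE p : (\int[mu]_x ((orbit_poly p x) ^+ 2)%:E = (orbit_sqr p)%:E)%E.
Proof.
rewrite fineK// ge0_fin_numE; first by apply: BI_sqr; exact: BI_orbit_poly.
by apply: integral_ge0 => x _; rewrite lee_fin sqr_ge0.
Qed.

Let lin_sqr (a b : R) p r : 0 <= a -> 0 <= b ->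
  (\int[mu]_x (a * (orbit_poly p x) ^+ 2 + b * (orbit_poly r x) ^+ 2)%:E =
   (a * orbit_sqr p + b * orbit_sqr r)%:E)%E.
Proof.
move=> a0 b0; under eq_integral => x _ do rewrite EFinD !EFinM.
rewrite ge0_integralD//; last 4 first.
- by move=> x _; rewrite -EFinM lee_fin mulr_ge0// sqr_ge0.
- by apply: measurable_funeM; exact: msq.
- by move=> x _; rewrite -EFinM lee_fin mulr_ge0// sqr_ge0.
- by apply: measurable_funeM; exact: msq.
rewrite !ge0_integralZl// ?lee_fin//; last 4 first.
- exact: msq.
- by move=> x _; rewrite lee_fin sqr_ge0.
- exact: msq.
- by move=> x _; rewrite lee_fin sqr_ge0.
by rewrite !orbit_sqrE.
Qed.

Lemma orbit_sqr_cauchy e : 0 < e -> exists N, forall m n, (N <= m)%N -> (N <= n)%N ->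
  (\int[mu]_x ((average U m f x - average U n f x) ^+ 2)%:E < e%:E)%E.
Proof.
move=> e0.
have := @mean_cauchy R orbit_sqr.
have qZ c p : orbit_sqr (c *: p) = c ^+ 2 * orbit_sqr p.
  apply: EFin_inj; rewrite EFinM -!orbit_sqrE -ge0_integralZl//; last 3 first.
  - exact: msq.
  - by move=> x _; rewrite lee_fin sqr_ge0.
  - by rewrite lee_fin sqr_ge0.
  by apply: eq_integral => x _; rewrite orbit_polyZ exprMn.
have qp p r : orbit_sqr (p + r) + orbit_sqr (p - r) = 2 * orbit_sqr p + 2 * orbit_sqr r.
  apply: EFin_inj; rewrite -lin_sqr// -[X in X + _]mul1r -[X in _ + X]mul1r -lin_sqr//.
  apply: eq_integral => x _; rewrite orbit_polyD.
  rewrite -scaleN1r orbit_polyD orbit_polyZ; congr EFin; ring.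
have q0 p : 0 <= orbit_sqr p.
  by rewrite fine_ge0//; apply: integral_ge0 => x _; rewrite lee_fin sqr_ge0.
have qs p : orbit_sqr ('X * p) <= orbit_sqr p.
  rewrite -lee_fin -!orbit_sqrE.
  apply: le_trans (DS_L2 mu_infinite DU (BI_orbit_poly p)).
  rewrite le_eqVlt; apply/orP; left; apply/eqP; apply: ge0_ae_eq_integral => //.
  - exact: msq.
  - by apply: msq; apply: BI_meas; apply: (BI_DS mu_infinite DU); exact: BI_orbit_poly.
  - by move=> x _; rewrite lee_fin sqr_ge0.
  - by move=> x _; rewrite lee_fin sqr_ge0.
  by apply: filterS (orbit_poly_shift p) => x h xT; rewrite h.
have qa c p r : 0 < c -> orbit_sqr (p + r) <= (1 + c) * orbit_sqr p + (1 + c^-1) * orbit_sqr r.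
  move=> c0; have c1 : 0 <= 1 + c by rewrite addr_ge0// ltW.
  have c2 : 0 <= 1 + c^-1 by rewrite addr_ge0// invr_ge0 ltW.
  rewrite -lee_fin -lin_sqr// -orbit_sqrE; apply: ge0_le_integral => //.
  - by move=> x _; rewrite lee_fin sqr_ge0.
  - exact: msq.
  - apply/measurable_EFinP; apply: measurable_funD; apply: measurable_funM => //;
      exact: measurable_funX.
  move=> x _; rewrite lee_fin orbit_polyD.
  set a := orbit_poly p x; set b := orbit_poly r x.
  (* Expanded, this is the weighted Young inequality that bounds the cross term [2 * a * b]. *)
  have : 0 <= c^-1 * (c * a - b) ^+ 2 by rewrite mulr_ge0 ?invr_ge0 ?sqr_ge0 ?ltW.
  have -> : c^-1 * (c * a - b) ^+ 2 = c * a ^+ 2 - 2 * a * b + c^-1 * b ^+ 2.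
    by field; rewrite gt_eqF.
  rewrite sqrrD !mulrDl !mul1r; lra.
move=> /(_ q0 qZ qs qp qa _ e0)[N HN]; exists N => m n Nm Nn.
have := HN m n Nm Nn; rewrite -lte_fin -orbit_sqrE.
congr (_ < _)%E; apply: eq_integral => x _.
by rewrite -scaleN1r orbit_polyD orbit_poly_avg (orbit_polyZ (-1)) orbit_poly_avg mulN1r.
Qed.

End orbit_polynomial.
End DS_iterates.

(** * Strong convergence of averages *)

Section operators_on_space.
Context {R : realType} {d : measure_display} {T : measurableType d}.
Variables (mu : {measure set T -> \bar R}).
Hypothesis mu_infinite : mu setT = +oo%E.
Variables (X : set (lebesgueType R -> R)) (normX : (lebesgueType R -> R) -> R).
Hypothesis XS : fully_symmetric X normX.
Implicit Types f g : T -> R.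
Local Notation Y := (space_on mu X).
Local Notation N := (norm_on mu normX).
Local Notation Ph := (Phi mu setT).

Lemma Y_L1Linf f : Y f -> L1Linf mu f.
Proof.
move=> Yf; apply/(L1LinfP mu_infinite); split; first exact: Y_meas Yf.
exists (rearr mu setT f 1); first exact: rearr_ge0.
exact: Y_Phi_fin XS _ Yf.
Qed.

Lemma Y_ae f g : Y f -> measurable_fun setT g -> ae_eq mu setT f g ->
  Y g /\ N g <= N f.
Proof.
move=> Yf mg H; apply: (Y_le XS Yf mg).
by apply: filterS H => x ->.
Qed.

Lemma Y_0 : Y (cst 0) /\ N (cst 0) = 0.
Proof.
have Y0 : Y (cst 0).
  apply: (BI_Y XS (e := 0) (C := 0)) => //; last by rewrite Phi_cst0.
  by apply: nearW => x; rewrite normr0.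
split => //; apply/eqP; rewrite eq_le (N_ge0 XS Y0) andbT.
have [_] := Y_Z XS 0 Y0; rewrite normr0 mul0r.
by rewrite (_ : (fun x : T => 0 * cst 0 x) = cst 0)//; apply/funext => x; rewrite mul0r.
Qed.

Lemma Y_sumf (u : nat -> T -> R) n : (forall k, Y (u k)) ->
  Y (sumf u n) /\ N (sumf u n) <= \sum_(k < n) N (u k).
Proof.
move=> Yu; elim: n => [|n [IH1 IH2]].
  have [Y0 N0] := Y_0.
  have -> : sumf u 0 = cst 0 by apply/funext => x; rewrite /sumf big_ord0.
  by rewrite big_ord0 N0.
have -> : sumf u n.+1 = sumf u n \+ u n.
  by apply/funext => x; rewrite /sumf big_ord_recr.
have [YD ND] := Y_D XS IH1 (Yu n); split => //; apply: le_trans ND _.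
by rewrite big_ord_recr/= lerD2r.
Qed.

Lemma N_sym f g : Y f -> Y g -> N (f \- g) <= N (g \- f).
Proof.
move=> Yf Yg; have [YB _] := Y_B XS Yg Yf; have [_] := Y_Z XS (-1) YB.
rewrite normrN1 mul1r (_ : (fun x => _) = f \- g)//.
by apply/funext => x /=; rewrite mulN1r opprB.
Qed.

Lemma N_tri f g h : Y f -> Y g -> Y h -> N (f \- h) <= N (f \- g) + N (g \- h).
Proof.
move=> Yf Yg Yh; have [YB _] := Y_B XS Yf Yg; have [YB' _] := Y_B XS Yg Yh.
have [_] := Y_D XS YB YB'.
by rewrite (_ : _ \+ _ = f \- h)//; apply/funext => x /=; rewrite addrA subrK.
Qed.

Section DS_space.
Variable U : (T -> R) -> (T -> R).
Hypothesis DU : DS mu U.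

Lemma Y_DS f : Y f -> Y (U f) /\ N (U f) <= N f.
Proof.
move=> Yf; have Lf := Y_L1Linf Yf.
apply: (Y_Phi_le XS Yf); first exact: (DS_meas mu_infinite DU).
by move=> l l0; exact: (DS_Phi mu_infinite DU).
Qed.

Lemma Y_iter k f : Y f -> Y (iter k U f) /\ N (iter k U f) <= N f.
Proof.
move=> Yf; elim: k => //= k [IH1 IH2]; have [Y1 N1] := Y_DS IH1.
by split => //; exact: le_trans N1 IH2.
Qed.

Lemma Y_average n f : Y f -> Y (average U n f) /\ N (average U n f) <= N f.
Proof.
move=> Yf; have [YS NS] := Y_sumf n (fun k => (Y_iter k Yf).1).
have [YA NA] := Y_Z XS n%:R^-1 YS; split => //; apply: le_trans NA _.
rewrite ger0_norm ?invr_ge0//.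
(* The average of index [0] is zero, because [0^-1 = 0]. *)
have [->|n0] := eqVneq n 0%N; first by rewrite invr0 mul0r (N_ge0 XS Yf).
rewrite mulrC ler_pdivrMr ?ltr0n ?lt0n//; apply: le_trans NS _.
rewrite mulr_natr -[X in _ *+ X]card_ord -sumr_const; apply: ler_sum => i _.
by have [] := Y_iter i Yf.
Qed.

Lemma average_sub n f g : Y f -> Y g ->
  N (average U n f \- average U n g) <= N (f \- g).
Proof.
move=> Yf Yg; have [YB _] := Y_B XS Yf Yg.
have [YA NA] := Y_average n YB.
have [YB' _] := Y_B XS (Y_average n Yf).1 (Y_average n Yg).1.
have [] := Y_ae YA (Y_meas YB') _; last by move=> _ h; exact: le_trans h NA.
have H k : ae_eq mu setT (iter k U (f \- g)) (iter k U f \- iter k U g).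
  have := iter_lin mu_infinite DU k (-1) (Y_L1Linf Yg) (Y_L1Linf Yf).
  have -> : (fun x => -1 * g x + f x) = f \- g.
    by apply/funext => x /=; rewrite mulN1r addrC.
  by apply: filterS => x h xT; rewrite h//= mulN1r addrC.
have {}H := ae_foralln H; apply: filterS H => x h _ /=.
rewrite /average -mulrBr -sumrB; congr (_ * _); apply: eq_bigr => i _.
by rewrite h.
Qed.

End DS_space.

Lemma Y_complete (u : nat -> T -> R) : (forall n, Y (u n)) ->
  (forall e : R, 0 < e -> exists K, forall m n, (K <= m)%N -> (K <= n)%N ->
     N (u m \- u n) < e) ->
  exists2 f, Y f & N (u n \- f) @[n --> \oo] --> (0 : R).
Proof.
move=> Yu C.
have p0 k : 0 < (2^-1 : R) ^+ k by rewrite exprn_gt0// invr_gt0.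
have [n0 Hn0] := choice (fun k => C _ (p0 k)).
(* Summing the thresholds makes the subsequence nondecreasing and keeps it beyond each [n0 k]. *)
pose n k := (\sum_(j < k.+1) n0 j)%N.
have n0n k : (n0 k <= n k)%N by rewrite /n big_ord_recr/= leq_addl.
have nS k : (n k <= n k.+1)%N by rewrite /n [leqRHS]big_ord_recr/= leq_addr.
pose v k := u (n k.+1) \- u (n k).
have Yv k : Y (v k) by have [] := Y_B XS (Yu (n k.+1)) (Yu (n k)).
have Nv k : N (v k) <= 2^-1 ^+ k.
  by apply: ltW; apply: Hn0; [exact: leq_trans (n0n k) (nS k)|exact: n0n].
have sS z k x : sumf z k.+1 x = sumf z k x + z k x.
  by rewrite /sumf big_ord_recr.
have sumv k x : sumf v k x = u (n k) x - u (n 0%N) x.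
  elim: k => [|k IH]; first by rewrite /sumf big_ord0 subrr.
  by rewrite /sumf big_ord_recr/= -/(sumf v k x) IH addrC addrA subrK.
have Nv1 k : N (v k) <= 1 * 2^-1 ^+ k by rewrite mul1r.
have [Yr _ cr] := Y_series XS Yv Nv1.
have [Yf _] := Y_D XS (Yu (n 0%N)) Yr.
set f := _ \+ _ in Yf; exists f => //.
(* The increments from [k] on form a series of their own, so [Y_series] bounds the norm of its sum,
   which is [f - u (n k)] almost everywhere. *)
have tail k : N (u (n k) \- f) <= 2^-1 ^+ k * 2.
  pose w j := v (k + j)%N.
  have Yw j : Y (w j) by exact: Yv.
  have Nw j : N (w j) <= 2^-1 ^+ k * 2^-1 ^+ j by rewrite -exprD; exact: Nv.
  have [Yl Nl cl] := Y_series XS Yw Nw.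
  have [Ym Nm] := Y_Z XS (-1) Yl.
  have [YB _] := Y_B XS (Yu (n k)) Yf.
  have [] := Y_ae Ym (Y_meas YB) _; last first.
    move=> _ h; apply: le_trans h _; apply: le_trans Nm _.
    by rewrite normrN1 mul1r.
  apply: filterS2 cr cl => x c1 c2 _ /=; rewrite mulN1r.
  have c3 : sumf v (j + k)%N x @[j --> \oo] --> limf v x.
    by rewrite (cvg_shiftn k (sumf v ^~ x)).
  have c4 : sumf v (j + k)%N x @[j --> \oo] --> sumf v k x + limf w x.
    rewrite (_ : (fun j => _) = (fun j => sumf v k x + sumf w j x)).
      by apply: cvgD => //; exact: cvg_cst.
    apply/funext => j; rewrite addnC; elim: j => [|j IH].
      by rewrite addn0 /sumf [X in _ = _ + X]big_ord0 addr0.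
    by rewrite addnS sS IH [sumf w j.+1 x]sS -addrA.
  have E := cvg_unique _ c3 c4; rewrite /f /= E// sumv; ring.
apply/cvgrPdist_lt => e e0; rewrite /=.
(* [tail] accounts for 2 of the 3, the distance from [u m] to [u (n K)] for the rest. *)
have [K HK] := half_pow_small 3 e0.
near=> m; have Km : (n K <= m)%N by near: m; exact: nbhs_infty_ge.
have [Yuf _] := Y_B XS (Yu m) Yf.
rewrite sub0r normrN ger0_norm; last exact: (N_ge0 XS).
apply: le_lt_trans (N_tri (Yu m) (Yu (n K)) Yf) _.
apply: le_lt_trans (HK K (leqnn K)).
have := tail K; have := ltW (Hn0 K m (n K) (leq_trans (n0n K) Km) (n0n K)); lra.
Unshelve. all: by end_near. Qed.

End operators_on_space.

(** Fatou's lemma as the height decreases to 0: a bound on the excesses at positive heights passes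
    to the L1 norm. *)
Lemma Phi0_le_lim {R : realType} {d : measure_display} {T : measurableType d}
    (mu : {measure set T -> \bar R}) (f : T -> R) (C : \bar R) :
  measurable_fun setT f ->
  (forall n, (Phi mu setT f n.+1%:R^-1 <= C)%E) -> (Phi mu setT f 0 <= C)%E.
Proof.
move=> mf HC; pose g n x := (Num.max (`|f x| - n.+1%:R^-1) 0)%:E.
have g0 n x : (0 <= g n x)%E by rewrite lee_fin le_max lexx orbT.
have cg x : g n x @[n --> \oo] --> (Num.max (`|f x| - 0) 0)%:E.
  apply: cvg_EFin; first by apply: nearW.
  rewrite subr0 max_l//.
  apply/cvgrPdist_le => e e0; have [K _ HK] := near_infty_natSinv_lt (PosNum e0).
  exists K => // n Kn /=; have h := HK n Kn; rewrite /= in h.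
  have i0 : 0 < n.+1%:R^-1 :> R by rewrite invr_gt0.
  have f0 := normr_ge0 (f x).
  have [m0|m0] := leP (`|f x| - n.+1%:R^-1) 0.
    by rewrite subr0 normr_id; apply: le_trans (ltW h); rewrite -subr_le0.
  by rewrite opprB addrC subrK (ger0_norm (ltW i0)); exact: ltW.
rewrite /Phi (eq_integral (fun x => limn_einf (g ^~ x))); last first.
  by move=> x _; rewrite (cvg_limn_einf_sup (cg x)).1.
apply: le_trans (fatou _ measurableT _ _) _.
- by move=> n; exact: measurable_excess.
- by move=> n x _.
rewrite limn_einf_lim; apply: lime_le; first exact: is_cvg_einfs.
apply: nearW => n; apply: le_trans (HC n).
by apply: ereal_inf_lbound; exists n => //=.
Qed.

(** * Consequences of order continuity *)

Section order_continuity_consequences.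
Context {R : realType} {d : measure_display} {T : measurableType d}.
Variables (mu : {measure set T -> \bar R}).
Hypothesis mu_infinite : mu setT = +oo%E.
Hypothesis mu_sigma_finite : sigma_finite setT mu.
Variables (X : set (lebesgueType R -> R)) (normX : (lebesgueType R -> R) -> R).
Hypothesis XS : fully_symmetric X normX.
Implicit Types f g : T -> R.
Local Notation Y := (space_on mu X).
Local Notation N := (norm_on mu normX).
Local Notation Ph := (Phi mu setT).
Local Notation K := (Kf mu setT).

(** Sign and monotonicity are required at every point and only the convergence almost everywhere;
    [seq_order_continuous_ae] relaxes this. *)
Definition seq_order_continuous := forall f : nat -> T -> R,
  (forall n, Y (f n)) -> (forall n x, 0 <= f n x) ->
  (forall n x, f n.+1 x <= f n x) ->
  {ae mu, forall x, f n x @[n --> \oo] --> (0 : R)} ->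
  forall e : R, 0 < e -> exists n, N (f n) < e.

Lemma nincr_seq (u : nat -> R) : (forall n, u n.+1 <= u n) ->
  {homo u : i j / (i <= j)%N >-> j <= i}.
Proof. by move=> H; exact/nonincreasing_seqP. Qed.

Lemma OC_seq : order_continuous mu Y N -> seq_order_continuous.
Proof.
move=> OC f Yf f0 fS fc e e0.
have fle i j : (i <= j)%N -> forall x, f j x <= f i x.
  by move=> ij x; apply: (nincr_seq (u := f ^~ x)) => // n; exact: fS.
have dir : directed (fun i j : nat => (i <= j)%N).
  split; [exact: (inhabits 0%N)|by move=> i|by move=> i j k; exact: leq_trans|].
  by move=> i j; exists (maxn i j); rewrite leq_maxl leq_maxr.
have dec : decreases_to_0 mu Y (fun i j : nat => (i <= j)%N) f.
  split; [by move=> i j ij; apply: nearW => x; exact: fle|by move=> i; apply: nearW|].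
  move=> g Yg H; have {}H := ae_foralln H.
  apply: filterS2 fc H => x c H; rewrite -(cvg_lim _ c)//.
  by apply: limr_ge; [apply/cvg_ex; exists 0|exact: nearW].
have [_ I0] := OC nat _ f dir Yf dec.
have hi : has_inf [set N (f i) | i in [set: nat]].
  split; first by exists (N (f 0%N)); exists 0%N.
  by exists 0 => _ [n _ <-]; exact: N_ge0 XS _ _.
by have [_ [n _ <-]] := inf_adherent e0 hi; rewrite I0 add0r => h; exists n.
Qed.

Lemma Y_indic (B : set T) : measurable B -> (mu B < +oo)%E ->
  Y (\1_B : T -> R).
Proof.
move=> mB Bfin; have Bf : mu B \is a fin_num by rewrite ge0_fin_numE.
have mi : measurable_fun setT (\1_B : T -> R) by exact: measurable_indic.
have ind1 x : `|\1_B x| <= 1 :> R.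
  by rewrite ger0_norm ?indicE//; case: (_ \in _).
apply: (BI_Y XS (e := 1) (C := fine (mu B)) mi) => //; first exact: nearW.
rewrite fineK// Phi0E.
under eq_integral => x _ do rewrite ger0_norm ?indicE//.
by under eq_integral => x _ do rewrite -indicE; rewrite integral_indic// setIT.
Qed.

Lemma N_indic_le (A B : set T) : measurable A -> measurable B -> A `<=` B ->
  (mu B < +oo)%E -> N (\1_A : T -> R) <= N (\1_B : T -> R).
Proof.
move=> mA mB AB Bfin.
have [] := Y_le XS (Y_indic mB Bfin) (_ : measurable_fun setT (\1_A : T -> R)) _ => //.
apply: nearW => x; rewrite !ger0_norm ?indicE//.
case: (boolP (x \in A)) => [|_]; last by case: (_ \in B).
by rewrite inE => /AB; rewrite -in_setE => ->.
Qed.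

(** If [K f] stayed below [C], then [f^* t <= C / t], so excesses at arbitrarily small heights would
    be at most [C] and [f] would be integrable. If [f^* t] were zero, [K f t] would be the infinite
    L1 norm, yet it is finite. *)
Lemma Y_not_L1 f : Y f -> ~ L1 mu f ->
  (forall C : R, exists2 t, 0 < t & (C%:E <= K f t)%E) /\
  (forall t, 0 < t -> 0 < rearr mu setT f t).
Proof.
move=> Yf f1; have Lf := Y_L0mu Yf.
have f0 : Ph f 0 = +oo%E.
  apply/eqP; rewrite -leye_eq leNgt; apply/negP => h; apply: f1.
  by apply/Lfun1P; split => //; exact: Lf.1.
split; last first.
  move=> t t0; rewrite lt_neqAle rearr_ge0 andbT eq_sym; apply/negP => /eqP z.
  have := Y_Kf_fin XS Yf t0; rewrite (KfE measurableT Lf t0) z mulr0 add0e.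
  by rewrite [X in (X < _)%E]f0 ltxx.
move=> C; apply: contrapT => H.
have {}H t : 0 < t -> (K f t <= C%:E)%E.
  move=> t0; rewrite leNgt; apply/negP => h; apply: H; exists t => //.
  exact: ltW.
suff : (Ph f 0 <= C%:E)%E by rewrite f0 leye_eq.
apply: Phi0_le_lim; first exact: Lf.1.
(* With this [t], the bound [t * f^* t <= C] forces [f^* t <= 1 / n.+1]; the [+ 1] keeps [t]
   positive. *)
move=> n; pose t : R := (`|C| + 1) * n.+1%:R.
have t0 : 0 < t by rewrite mulr_gt0// ltr_wpDl.
have l0 := rearr_ge0 mu setT f t.
have := H t t0; rewrite (KfE measurableT Lf t0) => Kt.
apply: le_trans (_ : (Ph f (rearr mu setT f t) <= C%:E)%E).
  apply: (le_Phi mu measurableT Lf.1).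
  have : ((t * rearr mu setT f t)%:E <= C%:E)%E.
    by apply: le_trans Kt; rewrite leeDl// Phi_ge0.
  rewrite lee_fin => h.
  have n0 : 0 < n.+1%:R :> R by [].
  rewrite -[leRHS]mul1r ler_pdivlMr//.
  have c0 : 0 < `|C| + 1 by rewrite ltr_wpDl.
  rewrite -(ler_pM2l c0) mulrCA mulrC -/t mulr1.
  by apply: le_trans h _; rewrite (le_trans (ler_norm C))// lerDl.
by apply: le_trans Kt; rewrite leeDr// lee_fin mulr_ge0// ltW.
Qed.

Section seq_consequences.
Hypothesis SOC : seq_order_continuous.

Lemma OC_truncation f (e : R) : Y f -> 0 < e ->
  exists2 g, bounded_integrable mu g & N (f \- g) < e.
Proof.
move=> Yf e0; have mf := Y_meas Yf.
have [F [FT ndF Ff]] := (sigma_finiteP _ _).1 mu_sigma_finite.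
pose E n := F n `&` [set x | `|f x| <= n%:R].
have mE n : measurable (E n).
  apply: measurableI; first exact: (Ff n).1.
  have -> : [set x | `|f x| <= n%:R] = ~` (setT `&` [set x | n%:R < `|f x|]).
    apply/seteqP; split => x /=; first by move=> h [_]; rewrite ltNge h.
    by move=> h; rewrite leNgt; apply/negP => h'; exact: h.
  by apply: measurableC; exact: measurable_levelset.
have EF n : (mu (E n) < +oo)%E.
  apply: le_lt_trans (Ff n).2; apply: le_measure; rewrite ?inE//.
    exact: (Ff n).1.
  by move=> x [].
have ES n : E n `<=` E n.+1.
  move=> x [Fx /= fx]; split; first by have /subsetPset := ndF _ _ (leqnSn n); exact.
  by rewrite /= (le_trans fx)// ler_nat.
(* The discarded parts decrease to 0 at every point, because each point eventually enters [E n]. *)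
pose r n x : R := `|f x| * \1_(~` E n) x.
have mr n : measurable_fun setT (r n).
  apply: measurable_funM; first exact: measurableT_comp.
  by apply: measurable_indic; exact: measurableC.
have i0 n x : 0 <= \1_(~` E n) x :> R by rewrite indicE.
have i1 n x : \1_(~` E n) x <= 1 :> R by rewrite indicE; case: (_ \in _).
have Yr n : Y (r n).
  have [] := Y_le XS Yf (mr n) _; last by [].
  apply: nearW => x; rewrite normrM normr_id ger0_norm//.
  by rewrite ler_piMr.
have rS n x : r n.+1 x <= r n x.
  apply: ler_wpM2l => //; rewrite !indicE !in_setC ler_nat.
  case: (boolP (x \in E n)) => [|_]; last by case: (_ \in _).
  by rewrite inE => /ES; rewrite -in_setE => ->.
have rc x : r n x @[n --> \oo] --> (0 : R).
  have : setT x by []. rewrite FT => -[k _ Fx].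
  pose K0 := maxn k (Num.bound `|f x|).
  apply/cvgrPdist_lt => e' e'0; exists K0 => // n /=.
  rewrite geq_max => /andP[kn bn].
  have Ex : E n x.
    split; first by have /subsetPset := ndF _ _ kn; exact.
    rewrite /= (le_trans (ltW (archi_boundP (normr_ge0 (f x)))))//.
    by rewrite ler_nat.
  rewrite /r indicE in_setC (_ : x \in E n) ?inE// mulr0 subr0 normr0//.
have [n Hn] := SOC Yr (fun n x => mulr_ge0 (normr_ge0 (f x)) (i0 n x)) rS
  (nearW _ rc) e0.
pose g x := f x * \1_(E n) x.
have mg : measurable_fun setT g.
  by apply: measurable_funM => //; exact: measurable_indic.
exists g.
  split => //.
    exists n%:R => //; apply: nearW => x; rewrite /g indicE.
    case: (boolP (x \in E n)) => [|_]; last by rewrite mulr0 normr0.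
    by rewrite inE mulr1 => -[].
  rewrite Phi0E.
  apply: (@le_lt_trans _ _ (\int[mu]_x (n%:R%:E * (\1_(E n) x)%:E))%E).
    apply: ge0_le_integral => //.
    - by apply/measurable_EFinP; exact: measurableT_comp.
    - by apply: measurable_funeM; apply/measurable_EFinP; exact: measurable_indic.
    move=> x _; rewrite -EFinM lee_fin /g normrM indicE.
    case: (boolP (x \in E n)) => [|_]; last by rewrite normr0 !mulr0.
    by rewrite inE normr1 !mulr1 => -[].
  rewrite ge0_integralZl//; last first.
    by apply/measurable_EFinP; exact: measurable_indic.
  rewrite integral_indic// setIT; apply: lte_mul_pinfty => //.
apply: le_lt_trans Hn.
have [] := Y_le XS (Yr n) (_ : measurable_fun setT (f \- g)) _ => //.
- exact: measurable_funB.
apply: nearW => x; rewrite /r /g /= normrM normr_id (ger0_norm (i0 _ _)) !indicE in_setC.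
case: (x \in E n); first by rewrite mulr1 subrr normr0 mulr0.
by rewrite mulr0 subr0 mulr1.
Qed.

(** Absolute continuity of the norm. Otherwise there are sets of measure at most [2^-n] whose
    indicators have norm at least [e]. Their tail unions decrease to a set that is null by
    Borel-Cantelli, so order continuity makes the norms of the tail indicators small. *)
Lemma OC_small_sets (e : R) : 0 < e -> exists2 del : R, 0 < del &
  forall B, measurable B -> (mu B < del%:E)%E -> N (\1_B : T -> R) < e.
Proof.
move=> e0; apply: contrapT => H.
have H' n : exists B, measurable B /\ (mu B <= ((2^-1 : R) ^+ n)%:E)%E /\
    e <= N (\1_B : T -> R).
  apply: contrapT => H'; apply: H; exists (2^-1 ^+ n); first by rewrite exprn_gt0// invr_gt0.
  move=> B mB Bn; rewrite ltNge; apply/negP => h; apply: H'; exists B.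
  by split => //; split => //; exact: ltW.
have [B HB] := choice H'.
have mB n : measurable (B n) by exact: (HB n).1.
have sB : (\sum_(0 <= n <oo) mu (B n) <= 2%:E)%E.
  apply: lime_le; first by apply: is_cvg_nneseries.
  apply: nearW => n; rewrite big_mkord.
  apply: (@le_trans _ _ (\sum_(i < n) ((2^-1 : R) ^+ i)%:E)%E).
    by apply: lee_sum => i _; exact: (HB i).2.1.
  rewrite sumEFin lee_fin; elim: n => [|n IH]; first by rewrite big_ord0.
  have : \sum_(i < n.+1) (2^-1 : R) ^+ i <= 2 - 2^-1 ^+ n.
    elim: n {IH} => [|n IH]; first by rewrite big_ord_recr big_ord0/= expr0; lra.
    by rewrite big_ord_recr/= exprS; lra.
  by have : 0 <= (2^-1 : R) ^+ n by []; lra.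
pose C n := \bigcup_(k in [set k | (n <= k)%N]) B k.
have mC n : measurable (C n) by exact: bigcup_measurable.
have C0 : (mu (C 0%N) < +oo)%E.
  apply: le_lt_trans (_ : (2%:E < +oo)%E); last exact: ltry.
  apply: le_trans sB; apply: measure_sigma_subadditive => //.
  by move=> x [k _ Bk]; exists k.
have CS n : C n.+1 `<=` C n by move=> x [k /= nk Bk]; exists k => //=; exact: ltnW.
have C0n n : C n `<=` C 0%N by move=> x [k _ Bk]; exists k.
have Cfin n : (mu (C n) < +oo)%E.
  by apply: le_lt_trans C0; apply: le_measure; rewrite ?inE.
have lim0 : mu (lim_sup_set B) = 0%E.
  by apply: lim_sup_set_cvg0 => //; apply: le_lt_trans sB (ltry _).
have cvg0 : {ae mu, forall x, (\1_(C n) x : R) @[n --> \oo] --> (0 : R)}.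
  exists (lim_sup_set B); split => //.
    by apply: bigcapT_measurable => n; exact: mC.
  move=> x /= h; apply: contrapT => nx; apply: h.
  have [n nCn] : exists n, ~ C n x.
    apply: contrapT => h; apply: nx => n _; apply: contrapT => nC.
    by apply: h; exists n.
  apply/cvgrPdist_lt => e' e'0; exists n => // m /= nm.
  rewrite indicE memNset ?subr0 ?normr0// => -[k /= mk Bk]; apply: nCn.
  by exists k => //=; exact: leq_trans mk.
have ind0 n x : 0 <= \1_(C n) x :> R by rewrite indicE.
have indS n x : \1_(C n.+1) x <= \1_(C n) x :> R.
  rewrite !indicE ler_nat; case: (boolP (x \in C n.+1)) => [|_ //].
  by rewrite inE => /CS; rewrite -in_setE => ->.
have [n Hn] := SOC (fun n => Y_indic (mC n) (Cfin n)) ind0 indS cvg0 e0.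
have := (HB n).2.2; rewrite leNgt => /negP; apply; apply: le_lt_trans Hn.
by apply: N_indic_le => // x Bx; exists n => //=.
Qed.

End seq_consequences.
End order_continuity_consequences.

Section strong_convergence.
Context {R : realType} {d : measure_display} {T : measurableType d}.
Variables (mu : {measure set T -> \bar R}).
Hypothesis mu_infinite : mu setT = +oo%E.
Hypothesis mu_sigma_finite : sigma_finite setT mu.
Variables (X : set (lebesgueType R -> R)) (normX : (lebesgueType R -> R) -> R).
Hypothesis XS : fully_symmetric X normX.
Implicit Types f g : T -> R.
Local Notation Y := (space_on mu X).
Local Notation N := (norm_on mu normX).
Local Notation Ph := (Phi mu setT).
Local Notation K := (Kf mu setT).
Hypothesis SOC : seq_order_continuous mu X normX.
Hypothesis Y_notin_L1 : ~ (Y `<=` L1 mu).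

Lemma BI_in_Y g : bounded_integrable mu g -> Y g.
Proof.
move=> [mg [M M0 gM] g1]; apply: (BI_Y XS (C := fine (Ph g 0)) mg gM M0).
by rewrite fineK// ge0_fin_numE// Phi_ge0.
Qed.

(* A function that is bounded, of bounded integral and small in L2 is small in
   [Y]: it is large only on a set of small measure, and its small values are
   controlled by a function of [Y] outside of L1. *)
Lemma N_small_of_L2 (M C e : R) : 0 <= M -> 0 < e -> exists2 del : R, 0 < del &
  forall g, measurable_fun setT g -> {ae mu, forall x, `|g x| <= M} ->
    (Ph g 0 <= C%:E)%E -> (\int[mu]_x ((g x) ^+ 2)%:E < del%:E)%E -> N g < e.
Proof.
move=> M0 e0.
have [f0 Yf0 f0L1] : exists2 f, Y f & ~ L1 mu f.
  apply: contrapT => H; apply: Y_notin_L1 => f Yf; apply: contrapT => h.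
  by apply: H; exists f.
have [Koo rpos] := Y_not_L1 XS Yf0 f0L1.
have Nf0 := N_ge0 XS Yf0.
(* The small values of [g] will contribute at most [c * N f0 <= e / 2]; [t] and [h] below are the
   data with which [Y_small_values] applies for this [c]. *)
pose c := e / 2 / (N f0 + 1).
have c0 : 0 < c by rewrite !divr_gt0// ltr_wpDl.
have [t t0 Kt] := Koo (C / c).
have a0 := rpos t t0; set a := rearr mu setT f0 t in a0.
pose h := c * a; have h0 : 0 < h by rewrite mulr_gt0.
have e1 : 0 < e / 2 / (M + 1) by rewrite !divr_gt0// ltr_wpDl.
have [dl dl0 Hdl] := OC_small_sets XS SOC e1.
(* By Chebyshev's inequality the set where [|g| > h] then has measure below [dl]. *)
exists (dl * h ^+ 2); first by rewrite mulr_gt0// exprn_gt0.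
move=> g mg gM gC g2.
pose B := [set x | h < `|g x|].
have mB : measurable B by have := measurable_levelset measurableT h mg; rewrite setTI.
have muB : (mu B < dl%:E)%E.
  have h2 : 0 < h ^+ 2 by rewrite exprn_gt0.
  have : ((h ^+ 2)%:E * mu B < (h ^+ 2)%:E * dl%:E)%E.
    rewrite -[X in (_ < X)%E]EFinM [X in (_ < X%:E)%E]mulrC.
    apply: le_lt_trans g2; have -> : mu B = (\int[mu]_x (\1_B x)%:E)%E by rewrite integral_indic// setIT.
    rewrite -ge0_integralZl//; last 2 first.
    - by apply/measurable_EFinP; exact: measurable_indic.
    - by rewrite lee_fin ltW.
    apply: ge0_le_integral => //.
    - by move=> x _; rewrite -EFinM lee_fin mulr_ge0// ltW.
    - by apply: measurable_funeM; apply/measurable_EFinP; exact: measurable_indic.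
    - by apply/measurable_EFinP; exact: measurable_funX.
    move=> x _; rewrite -EFinM lee_fin indicE.
    case: (boolP (x \in B)) => [|_]; last by rewrite mulr0 sqr_ge0.
    rewrite inE /B/= mulr1 -[X in _ <= X]real_normK ?num_real// => hx.
    by rewrite lerXn2r ?nnegrE ?(ltW h0)// ltW.
  by rewrite lte_pmul2l// lte_fin.
pose g1 x := g x * \1_B x; pose g2' x := g x * \1_(~` B) x.
have mg1 : measurable_fun setT g1.
  by apply: measurable_funM => //; exact: measurable_indic.
have mg2 : measurable_fun setT g2'.
  by apply: measurable_funM => //; apply: measurable_indic; exact: measurableC.
have Bfin : (mu B < +oo)%E by apply: lt_trans muB (ltry _).
have [Y1 N1] : Y g1 /\ N g1 <= M * N (\1_B : T -> R).
  have [YZ NZ] := Y_Z XS M (Y_indic XS mB Bfin).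
  have [] := Y_le XS YZ mg1 _.
    apply: filterS gM => x gx; rewrite /g1 !normrM.
    by apply: ler_wpM2r => //; rewrite (ger0_norm M0).
  by move=> Y1 N1; split => //; apply: le_trans N1 _; rewrite -{2}(ger0_norm M0).
have [Y2 N2] : Y g2' /\ N g2' <= c * N f0.
  have [Lf0 Xf0] := Yf0.
  apply: (Y_small_values XS Xf0 mg2 t0 (ltW c0) (ltW h0) _ (C := C)).
  - apply: nearW => x; rewrite /g2' indicE in_setC.
    case: (boolP (x \in B)) => /=; first by rewrite mulr0 normr0 ltW.
    by rewrite notin_setE /B/= mulr1 leNgt => /negP.
  - apply: le_trans gC; apply: (Phi_le_norm measurableT _ mg mg2).
    apply: nearW => x _; rewrite /g2' normrM ler_piMr// indicE.
    by case: (_ \in _); rewrite ?normr1 ?normr0.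
  - by rewrite (rearr_rearr measurableT Lf0).
  - rewrite -Kf_rearrE//.
    apply: (@le_trans _ _ (c%:E * (C / c)%:E)%E).
      by rewrite -EFinM lee_fin mulrCA mulfV ?mulr1// gt_eqF.
    by apply: lee_wpmul2l => //; rewrite lee_fin ltW.
have [_ ND] := Y_D XS Y1 Y2.
have E : g1 \+ g2' = g.
  apply/funext => x; rewrite /g1 /g2' /= !indicE in_setC.
  by case: (x \in B) => /=; ring.
rewrite E in ND; apply: le_lt_trans ND _.
have NB := Hdl B mB muB; have NB0 := N_ge0 XS (Y_indic XS mB Bfin).
rewrite [e]splitr; apply: ltr_leD.
  apply: le_lt_trans N1 _; apply: le_lt_trans (_ : (M + 1) * N (\1_B : T -> R) < _).
    by apply: ler_wpM2r => //; rewrite lerDl.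
  by rewrite mulrC -ltr_pdivlMr// ltr_wpDl.
apply: le_trans N2 _; apply: le_trans (_ : c * (N f0 + 1) <= _).
  by apply: ler_wpM2l; rewrite ?lerDl// ltW.
by rewrite /c mulfVK// gt_eqF// ltr_wpDl.
Qed.

Variable U : (T -> R) -> (T -> R).
Hypothesis DU : DS mu U.

Lemma average_bound n g M : measurable_fun setT g -> L1Linf mu g -> 0 <= M ->
  {ae mu, forall x, `|g x| <= M} -> {ae mu, forall x, `|average U n g x| <= M}.
Proof.
move=> mg Lg M0 gM.
have H k : {ae mu, forall x, `|iter k U g x| <= M}.
  elim: k => //= k IH; apply: (DS_bound mu_infinite DU) => //.
  by have [] := (L1LinfP mu_infinite _).1 (L1Linf_iter DU k Lg).
have {}H := ae_foralln H; apply: filterS H => x Hx.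
have [->|n0] := eqVneq n 0%N; first by rewrite /average invr0 mul0r normr0.
have n0' : 0 < n%:R :> R by rewrite ltr0n lt0n.
rewrite /average normrM ger0_norm ?invr_ge0// mulrC ler_pdivrMr//.
apply: le_trans (ler_norm_sum _ _ _) _.
rewrite mulr_natr -[X in _ *+ X]card_ord -sumr_const.
by apply: ler_sum => i _; exact: Hx.
Qed.

Lemma average_Phi n g : measurable_fun setT g -> L1Linf mu g ->
  (Ph (average U n g) 0 <= Ph g 0)%E.
Proof.
move=> mg Lg.
have Lk k : L1Linf mu (iter k U g) := L1Linf_iter DU k Lg.
have mk k : measurable_fun setT (iter k U g).
  by have [] := (L1LinfP mu_infinite _).1 (Lk k).
have Pk k : (Ph (iter k U g) 0 <= Ph g 0)%E.
  elim: k => //= k IH; apply: le_trans IH.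
  exact: (DS_Phi mu_infinite DU).
have ms m : measurable_fun setT (fun x => \sum_(k < m) iter k U g x).
  exact: measurable_sum.
have Ps m : (Ph (fun x => \sum_(k < m) iter k U g x)%R 0 <= m%:R%:E * Ph g 0)%E.
  elim: m => [|m IH].
    rewrite mul0e (_ : (fun x => _) = cst 0) ?Phi_cst0//.
    by apply/funext => x; rewrite big_ord0.
  rewrite (_ : (fun x => _) = (fun x => \sum_(k < m) iter k U g x) \+ iter m U g).
    rewrite -[X in Ph _ X](addr0 0); apply: le_trans (PhiD mu measurableT _ _ (ms m) (mk m)) _.
    rewrite -natr1 EFinD ge0_muleDl ?lee_fin// mul1e.
    by apply: leeD => //; exact: Pk.
  by apply/funext => x; rewrite big_ord_recr.
have i0 : 0 <= n%:R^-1 :> R by rewrite invr_ge0.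
have := PhiZ mu measurableT n%:R^-1 0 (ms n).
rewrite mulr0 ger0_norm// => ->.
apply: (@le_trans _ _ (n%:R^-1%:E * (n%:R%:E * Ph g 0))%E).
  by apply: lee_wpmul2l; rewrite ?lee_fin.
rewrite muleA -EFinM.
have [->|n0] := eqVneq n 0%N; first by rewrite mulr0 mul0e Phi_ge0.
by rewrite mulVf ?mul1e// pnatr_eq0.
Qed.

Lemma BI_average_cauchy g e : bounded_integrable mu g -> 0 < e ->
  exists K0, forall m n, (K0 <= m)%N -> (K0 <= n)%N ->
    N (average U m g \- average U n g) < e.
Proof.
move=> Bg e0; have [mg [M M0 gM] g1] := Bg.
have Lg := BI_L1Linf mu_infinite Bg.
have Yg := BI_in_Y Bg.
have P0 : Ph g 0 \is a fin_num by rewrite ge0_fin_numE// Phi_ge0.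
have [dl dl0 H] := N_small_of_L2 (fine (Ph g 0) + fine (Ph g 0)) (addr_ge0 M0 M0) e0.
have [K0 HK] := orbit_sqr_cauchy mu_infinite DU Bg dl0.
exists K0 => m n Km Kn.
have mA k : measurable_fun setT (average U k g).
  by have [YA _] := Y_average mu_infinite XS DU k Yg; exact: Y_meas YA.
apply: H => //.
- exact: measurable_funB.
- apply: filterS2 (average_bound m mg Lg M0 gM) (average_bound n mg Lg M0 gM) => x h1 h2.
  by apply: le_trans (ler_normB _ _) _; exact: lerD.
- have mN : measurable_fun setT (fun x => -1 * average U n g x) by exact: measurable_funM.
  rewrite (_ : _ \- _ = average U m g \+ (fun x => -1 * average U n g x)); last first.
    by apply/funext => x /=; rewrite mulN1r.
  rewrite -[X in Ph _ X](addr0 0); apply: le_trans (PhiD mu measurableT _ _ (mA m) mN) _.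
  rewrite EFinD fineK//; apply: leeD; first exact: average_Phi.
  apply: le_trans (average_Phi n mg Lg); apply: Phi_le_norm => //.
  by apply: nearW => x _; rewrite normrM normrN1 mul1r.
- exact: HK.
Qed.

Lemma averages_converge : averages_converge_strongly Y N U.
Proof.
move=> f Yf.
have YA n := (Y_average mu_infinite XS DU n Yf).1.
have [|fhat Yfhat cf] := Y_complete XS YA; last by exists fhat.
move=> e e0; have e3 : 0 < e / 3 by rewrite divr_gt0.
have [g Bg Ng] := OC_truncation mu_sigma_finite XS SOC Yf e3.
have Yg := BI_in_Y Bg.
have YAg n := (Y_average mu_infinite XS DU n Yg).1.
have [K0 HK] := BI_average_cauchy Bg e3; exists K0 => m n Km Kn.
have h1 := average_sub mu_infinite XS DU m Yf Yg.
have h2 := average_sub mu_infinite XS DU n Yg Yf.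
have h3 := HK m n Km Kn.
have h4 := N_tri XS (YA m) (YAg m) (YA n).
have h5 := N_tri XS (YAg m) (YAg n) (YA n).
have h6 := N_sym XS Yg Yf.
lra.
Qed.

End strong_convergence.

(** * Necessity of order continuity *)

Section multiplication_operator.
Context {R : realType} {d : measure_display} {T : measurableType d}.
Variables (mu : {measure set T -> \bar R}).
Hypothesis mu_infinite : mu setT = +oo%E.
Implicit Types f g : T -> R.

Lemma Lnormy_le f g : f \in Lfun mu +oo ->
  (forall M, 0 <= M -> {ae mu, forall x, `|f x| <= M} -> {ae mu, forall x, `|g x| <= M}) ->
  ('N[mu]_+oo[EFin \o g] <= 'N[mu]_+oo[EFin \o f])%E.
Proof.
move=> /(LfunyP mu_infinite)[mf [M M0 fM]] H.
have fin : 'N[mu]_+oo[EFin \o f]%E \is a fin_num.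
  rewrite ge0_fin_numE ?Lnorm_ge0//.
  by apply: le_lt_trans (ltry M); apply/(Lnormy_leP mu_infinite).
rewrite -(fineK fin); apply/(Lnormy_leP mu_infinite); apply: H.
  by rewrite fine_ge0// Lnorm_ge0.
by apply/(Lnormy_leP mu_infinite); rewrite fineK.
Qed.

Lemma DS_mult (m : T -> R) : measurable_fun setT m -> (forall x, 0 <= m x <= 1) ->
  DS mu (fun f x => m x * f x).
Proof.
move=> mm m01.
have le f x : `|m x * f x| <= `|f x|.
  by have /andP[m0 m1] := m01 x; rewrite normrM ger0_norm// ler_piMl.
have mU f : measurable_fun setT f -> measurable_fun setT (fun x => m x * f x).
  by move=> mf; exact: measurable_funM.
have PU f l : measurable_fun setT f ->
    (Phi mu setT (fun x => m x * f x)%R l <= Phi mu setT f l)%E.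
  by move=> mf; apply: (Phi_le_norm measurableT _ mf (mU f mf)); exact: nearW.
split.
- move=> f /(L1LinfP mu_infinite)[mf [l l0 h]]; apply/(L1LinfP mu_infinite).
  by split; [exact: mU|exists l => //; exact: le_lt_trans (PU f l mf) h].
- by move=> f g _ _; apply: filterS => x /= h xT; rewrite h.
- by move=> a f g _ _; apply: nearW => x _; ring.
- by move=> f /Lfun1P[mf _]; rewrite !Lnorm1_Phi; exact: PU.
- move=> f f1; apply: Lnormy_le => // M M0; apply: filterS => x; apply: le_trans.
  exact: le.
Qed.

End multiplication_operator.

Lemma bernoulli_ge {R : realFieldType} (m : R) k : 0 <= m <= 1 ->
  1 - k%:R * (1 - m) <= m ^+ k.
Proof.
move=> /andP[m0 m1]; elim: k => [|k IH]; first by rewrite expr0 mul0r subr0.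
rewrite exprS; apply: le_trans (_ : m * (1 - k%:R * (1 - m)) <= _).
  rewrite -natr1 -subr_ge0.
  have -> : m * (1 - k%:R * (1 - m)) - (1 - (k%:R + 1) * (1 - m)) =
      k%:R * (1 - m) ^+ 2 by ring.
  by rewrite mulr_ge0 ?sqr_ge0.
exact: ler_wpM2l.
Qed.

Section necessity_of_order_continuity.
Context {R : realType} {d : measure_display} {T : measurableType d}.
Variables (mu : {measure set T -> \bar R}).
Hypothesis mu_infinite : mu setT = +oo%E.
Variables (X : set (lebesgueType R -> R)) (normX : (lebesgueType R -> R) -> R).
Hypothesis XS : fully_symmetric X normX.
Implicit Types f g : T -> R.
Local Notation Y := (space_on mu X).
Local Notation N := (norm_on mu normX).
Hypothesis AC : forall U : (T -> R) -> (T -> R), DS mu U ->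
  averages_converge_strongly Y N U.

Section multiplier.
Variables (E : nat -> set T).
Hypothesis mE : forall k, measurable (E k).
Hypothesis ES : forall k, E k.+1 `<=` E k.

Let b k : R := 1 - k.+1%:R^-1.

Let b0 : b 0 = 0.
Proof. by rewrite /b invr1 subrr. Qed.

Let bS k : b k <= b k.+1.
Proof. by rewrite lerD2l lerN2 lef_pV2 ?posrE// ler_nat. Qed.

Let b1 k : b k < 1.
Proof. by rewrite ltrBlDr ltrDl invr_gt0. Qed.

(* [multiplier] takes the value [1 - 1 / k.+1] on [E k `\` E k.+1], and [0]
   outside of [E 0]. *)
Let term k x : R := (b k.+1 - b k) * \1_(E k.+1) x.
Definition multiplier : T -> R := limf term.

Let term_ge0 k x : 0 <= term k x.
Proof. by rewrite /term mulr_ge0 ?subr_ge0// indicE. Qed.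

Let termS k x : sumf term k.+1 x = sumf term k x + term k x.
Proof. by rewrite /sumf big_ord_recr. Qed.

Let E_le i j : (i <= j)%N -> E j `<=` E i.
Proof.
by move=> /subnK <-; elim: (j - i)%N => //= k IH x; rewrite addSn => /ES/IH.
Qed.

Let sum_in k x : E k x -> sumf term k x = b k.
Proof.
elim: k => [|k IH] Ex; first by rewrite /sumf big_ord0 b0.
by rewrite termS (IH (ES Ex)) /term indicE mem_set// mulr1 addrC subrK.
Qed.

Let sum_le k x : sumf term k x <= b k.
Proof.
elim: k => [|k IH]; first by rewrite /sumf big_ord0 b0.
rewrite termS; apply: le_trans (lerD IH (_ : _ <= b k.+1 - b k)) _.
  by rewrite /term ler_piMr ?subr_ge0// indicE; case: (_ \in _).
by rewrite addrC subrK.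
Qed.

Let sum_nd x : nondecreasing_seq (fun k => sumf term k x).
Proof. by apply/nondecreasing_seqP => k; rewrite termS lerDl. Qed.

Let sum_cvg x : sumf term k x @[k --> \oo] --> multiplier x.
Proof.
have c : cvgn (fun k => sumf term k x).
  apply: nondecreasing_is_cvgn => //; exists 1 => _ [k _ <-].
  exact: le_trans (sum_le k x) (ltW (b1 k)).
rewrite /multiplier (limfE c); exact: c.
Qed.

Lemma measurable_multiplier : measurable_fun setT multiplier.
Proof.
by apply: measurable_limf => k; apply: measurable_funM.
Qed.

Lemma multiplier01 x : 0 <= multiplier x <= 1.
Proof.
have c := @sum_cvg x; have cc : cvgn (fun k => sumf term k x) by apply/cvg_ex; eexists; exact: c.
rewrite -(cvg_lim _ c)//; apply/andP; split.
  by apply: limr_ge => //; apply: nearW => k; exact: sumr_ge0.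
by apply: limr_le => //; apply: nearW => k; exact: le_trans (sum_le k x) (ltW (b1 k)).
Qed.

Lemma multiplier_ge k x : E k x -> 1 - k.+1%:R^-1 <= multiplier x.
Proof.
move=> Ex; have c := @sum_cvg x.
have cc : cvgn (fun k => sumf term k x) by apply/cvg_ex; eexists; exact: c.
rewrite -(cvg_lim _ c)// -/(b k) -(sum_in Ex).
by apply: limr_ge => //; exists k => // j /= kj; exact: sum_nd.
Qed.

Lemma multiplier_lt1 k x : ~ E k x -> multiplier x < 1.
Proof.
move=> nE; apply: le_lt_trans (b1 k).
have c := @sum_cvg x.
have cc : cvgn (fun k => sumf term k x) by apply/cvg_ex; eexists; exact: c.
rewrite -(cvg_lim _ c)//; apply: limr_le => //; exists k => // j /= /subnK <-.
elim: (j - k)%N => [|i IH]; first by rewrite add0n.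
rewrite addSn termS /term indicE memNset ?mulr0 ?addr0// => h; apply: nE.
by apply: E_le h; rewrite -addSn leq_addl.
Qed.

End multiplier.

Lemma iter_mult (m f : T -> R) k x : iter k (fun h x => m x * h x) f x = m x ^+ k * f x.
Proof. by elim: k => [|k IH]; rewrite ?expr0 ?mul1r// iterS IH exprS mulrA. Qed.

(** With [A n] the averages of [f 0], [(1 - m) * A n = (1 - m ^ n) * f 0 / n] tends to 0 in norm,
    and [m < 1] a.e., so the limit is zero. But [f (2n) <= del * f 0 + 2 * A n] everywhere, which
    keeps [N (A n)] above [e / 4]. *)
Lemma averages_seq_order_continuous : seq_order_continuous mu X normX.
Proof.
move=> f Yf f0 fS fc e e0; apply: contrapT => H.
have {}H n : e <= N (f n) by rewrite leNgt; apply/negP => h; apply: H; exists n.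
have fle i j x : (i <= j)%N -> f j x <= f i x.
  by move=> ij; apply: (nincr_seq (u := f ^~ x)) => // n; exact: fS.
have Nf0 := N_ge0 XS (Yf 0%N).
(* Chosen so that [del * N (f 0)] takes at most half of [e]. *)
pose del := e / 2 / (N (f 0%N) + 1).
have del0 : 0 < del by rewrite !divr_gt0// ltr_wpDl.
pose E k := [set x | del * f 0%N x < f k x].
have mf k : measurable_fun setT (f k) := Y_meas (Yf k).
have mE k : measurable (E k).
  have mg : measurable_fun setT (fun x => f k x - del * f 0%N x).
    by apply: measurable_funB => //; exact: measurable_funM.
  have := mg measurableT _ (measurable_itv `]0, +oo[); rewrite setTI.
  congr measurable; apply/seteqP; split => x /=; rewrite in_itv/= andbT subr_gt0//.
have ES k : E k.+1 `<=` E k by move=> x /= h; exact: lt_le_trans h (fS k x).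
pose m := multiplier E; pose U h x : R := m x * h x.
have mm : measurable_fun setT m by exact: measurable_multiplier.
have m01 x : 0 <= m x <= 1 by exact: multiplier01.
have m1 : {ae mu, forall x, m x < 1}.
  apply: filterS fc => x c; suff [k nE] : exists k, ~ E k x by exact: multiplier_lt1 nE.
  (* The inequality in [E] is strict, so a zero of [f 0] is already outside [E 0]; any other point
     leaves once [f k x] drops below [del * f 0 x]. *)
  have [z|p] := eqVneq (f 0%N x) 0; first by exists 0%N; rewrite /E/= z mulr0 ltxx.
  have p0 : 0 < del * f 0%N x by rewrite mulr_gt0// lt0r p f0.
  move/cvgrPdist_lt : c => /(_ _ p0)[k _ /(_ k (leqnn k))] /=.
  rewrite sub0r normrN ger0_norm// => h; exists k => /= h'.
  by have := lt_trans h h'; rewrite ltxx.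
have DU : DS mu U by exact: DS_mult.
have [fhat Yfhat cf] := AC DU (Yf 0%N).
pose A n := average U n (f 0%N).
have YA n : Y (A n) := (Y_average mu_infinite XS DU n (Yf 0%N)).1.
have AE n x : A n x = n%:R^-1 * (\sum_(k < n) m x ^+ k) * f 0%N x.
  rewrite /A /average -mulrA mulr_suml; congr (_ * _).
  by apply: eq_bigr => i _; rewrite iter_mult.
have cf' : N (A n \- fhat) @[n --> \oo] --> (0 : R) by [].
pose a x : R := 1 - m x.
have ma : measurable_fun setT a by exact: measurable_funB.
have a0 x : 0 <= a x by rewrite subr_ge0; have /andP[] := m01 x.
have a1 x : a x <= 1 by rewrite gerBl; have /andP[] := m01 x.
have afle x : `|a x * fhat x| <= `|fhat x| by rewrite normrM ger0_norm// ler_piMl.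
have [Yaf _] := Y_le XS Yfhat (measurable_funM ma (Y_meas Yfhat)) (nearW _ afle).
have Naf n : (0 < n)%N -> N (a \* fhat) <= N (A n \- fhat) + n%:R^-1 * N (f 0%N).
  move=> n0; have [YB _] := Y_B XS (YA n) Yfhat.
  have n0' : 0 < n%:R^-1 :> R by rewrite invr_gt0 ltr0n.
  have [Y1 N1] : Y (a \* (A n \- fhat)) /\ N (a \* (A n \- fhat)) <= N (A n \- fhat).
    apply: (Y_le XS YB); first by apply: measurable_funM => //; exact: Y_meas YB.
    by apply: nearW => x; rewrite /= normrM ger0_norm// ler_piMl.
  have [YZ NZ] := Y_Z XS n%:R^-1 (Yf 0%N).
  have [Y2 N2] : Y (a \* A n) /\ N (a \* A n) <= n%:R^-1 * N (f 0%N).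
    have [] := Y_le XS YZ (_ : measurable_fun setT (a \* A n)) _.
    - by apply: measurable_funM => //; exact: Y_meas (YA n).
    - apply: nearW => x /=; rewrite AE /a.
      have -> : (1 - m x) * (n%:R^-1 * (\sum_(k < n) m x ^+ k) * f 0%N x) =
          (1 - m x ^+ n) * (n%:R^-1 * f 0%N x).
        have := subrX1 (m x) n => E1.
        have -> : 1 - m x ^+ n = (1 - m x) * \sum_(i < n) m x ^+ i.
          by rewrite -opprB E1 -mulNr opprB.
        ring.
      have /andP[x0 x1] := m01 x.
      rewrite normrM ler_piMl// ger0_norm ?subr_ge0 ?exprn_ile1//.
      by rewrite gerBl exprn_ge0.
    by move=> Y2 N2; split => //; apply: le_trans N2 _; move: NZ; rewrite ger0_norm// ltW.
  have [_ NB] := Y_B XS Y2 Y1.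
  have E1 : (a \* A n) \- (a \* (A n \- fhat)) = a \* fhat.
    by apply/funext => x /=; ring.
  rewrite E1 in NB; apply: le_trans NB _; rewrite addrC; exact: lerD.
have Naf0 : N (a \* fhat) = 0.
  apply/eqP; rewrite eq_le (N_ge0 XS Yaf) andbT; apply/ler_addgt0Pr => c c0.
  rewrite add0r; have c2 : 0 < c / 2 by rewrite divr_gt0.
  move/cvgrPdist_lt : cf' => /(_ _ c2)[K0 _ HK].
  pose n := maxn K0 (Num.bound (N (f 0%N) / (c / 2))).+1.
  have n0 : (0 < n)%N by rewrite /n leq_max orbT.
  apply: le_trans (Naf n n0) _; rewrite [c]splitr; apply: lerD.
    have := HK n (leq_maxl _ _); rewrite /= sub0r normrN => h.
    by apply: le_trans (ler_norm _) (ltW h).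
  rewrite mulrC ler_pdivrMr ?ltr0n// mulrC -ler_pdivrMr//.
  have B := archi_boundP (divr_ge0 Nf0 (ltW c2)).
  apply: le_trans (ltW B) _; rewrite ler_nat.
  exact: leq_trans (leqnSn _) (leq_maxr _ _).
have fhat0 : ae_eq mu setT fhat (cst 0).
  have := N_eq0 XS Yaf Naf0; apply: filterS2 m1 => x mx /(_ I) /= /eqP.
  by rewrite mulf_eq0 /a subr_eq0 (gt_eqF mx)/= => /eqP h _.
have [Y0 N0] := Y_0 mu XS.
have Nfhat : N fhat <= 0.
  rewrite -N0; have [] := Y_ae XS Y0 (Y_meas Yfhat) _; last by [].
  by apply: filterS fhat0 => x h xT; rewrite h.
have lower n : (0 < n)%N -> e / 4 <= N (A n).
  move=> n0; have [Y1 N1] := Y_Z XS del (Yf 0%N).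
  have [Y2 N2] := Y_Z XS 2 (YA n).
  have [Y3 N3] := Y_D XS Y1 Y2.
  have n0' : 0 < n%:R :> R by rewrite ltr0n.
  have A0 x : 0 <= A n x.
    rewrite AE mulr_ge0// mulr_ge0 ?invr_ge0//; apply: sumr_ge0 => i _.
    by rewrite exprn_ge0//; have /andP[] := m01 x.
  suff pw x : `|f n.*2 x| <= `|((fun x => del * f 0%N x) \+ (fun x => 2 * A n x)) x|.
    have [_ N4] := Y_le XS Y3 (mf n.*2) (nearW _ pw).
    have h1 : del * N (f 0%N) <= e / 2.
      apply: le_trans (_ : del * (N (f 0%N) + 1) <= _).
        by apply: ler_wpM2l; rewrite ?lerDl// ltW.
      by rewrite /del mulfVK// gt_eqF// ltr_wpDl.
    move: (H n.*2) N1 N2; rewrite (ger0_norm (ltW del0)) ger0_norm//; lra.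
  rewrite /= ger0_norm// ger0_norm; last first.
    by rewrite addr_ge0// mulr_ge0// ltW.
  have [Ex|nE] := pselect (E n.*2 x); last first.
    apply: le_trans (_ : del * f 0%N x <= _); last by rewrite lerDl mulr_ge0.
    by rewrite leNgt; apply/negP.
  apply: le_trans (fle _ _ x (leq0n _)) _.
  apply: le_trans (_ : 2 * A n x <= _); last by rewrite lerDr mulr_ge0// ltW.
  (* On [E (2n)] the multiplier is at least [1 - 1 / (2n + 1)], so Bernoulli's inequality loses at
     most [n / (2n + 1)], which is below one half. *)
  have half k : (k < n)%N -> 2^-1 <= m x ^+ k.
    move=> kn; apply: le_trans (bernoulli_ge k (m01 x)).
    have := multiplier_ge ES Ex; rewrite -/m => hm.
    have hk : k%:R * (1 - m x) <= n%:R * n.*2.+1%:R^-1.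
      apply: ler_pM => //; first exact: a0.
        by rewrite ler_nat ltnW.
      by rewrite lerBlDr -lerBlDl.
    have : n%:R * n.*2.+1%:R^-1 <= 2^-1 :> R.
      rewrite ler_pdivrMr// mulrC ler_pdivlMr// -natrM ler_nat muln2.
      exact: leqW.
    move=> h2; rewrite lerBrDr -lerBrDl; apply: le_trans (le_trans hk h2) _.
    by lra.
  rewrite AE mulrA -[X in X <= _]mul1r; apply: ler_wpM2r => //.
  have : 2^-1 <= n%:R^-1 * \sum_(k < n) m x ^+ k.
    rewrite [leRHS]mulrC ler_pdivlMr// mulr_natr -[X in _ *+ X]card_ord -sumr_const.
    by apply: ler_sum => i _; exact: half.
  by set z := n%:R^-1 * _; move=> ?; lra.
move/cvgrPdist_lt : cf' => /(_ (e / 4)).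
have e4 : 0 < e / 4 by rewrite divr_gt0.
move=> /(_ e4)[K0 _ HK]; have := HK K0.+1 (leqnSn _).
rewrite /= sub0r normrN => h.
have h1 := lower K0.+1 (ltn0Sn _).
have [Y1 N1] := Y_B XS (YA K0.+1) Yfhat.
have [_ N2] := Y_D XS Y1 Yfhat.
have E1 : (A K0.+1 \- fhat) \+ fhat = A K0.+1 by apply/funext => x /=; rewrite subrK.
rewrite E1 in N2.
have := ler_norm (N (A K0.+1 \- fhat)); lra.
Qed.

End necessity_of_order_continuity.

(** * From decreasing sequences to nets *)

Section order_continuity_from_sequences.
Context {R : realType} {d : measure_display} {T : measurableType d}.
Variables (mu : {measure set T -> \bar R}).
Hypothesis mu_sigma_finite : sigma_finite setT mu.
Variables (X : set (lebesgueType R -> R)) (normX : (lebesgueType R -> R) -> R).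
Hypothesis XS : fully_symmetric X normX.
Implicit Types f g : T -> R.
Local Notation Y := (space_on mu X).
Local Notation N := (norm_on mu normX).

(** The running minima of the [|f n|] are nonnegative and decreasing everywhere, and agree with the
    [f n] off a null set. *)
Lemma seq_order_continuous_ae (f : nat -> T -> R) : seq_order_continuous mu X normX ->
  (forall n, Y (f n)) -> (forall n, {ae mu, forall x, 0 <= f n x}) ->
  (forall n, {ae mu, forall x, f n.+1 x <= f n x}) ->
  {ae mu, forall x, f n x @[n --> \oo] --> (0 : R)} ->
  forall e : R, 0 < e -> exists n, N (f n) < e.
Proof.
move=> SOC Yf f0 fS fc e e0.
pose h := fix h n : T -> R := if n is k.+1
  then (fun x => Num.min (h k x) `|f k.+1 x|) else (fun x => `|f 0%N x|).
have H : {ae mu, forall x, forall n, h n x = f n x}.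
  apply: filterS2 (ae_foralln f0) (ae_foralln fS) => x h0 hS.
  elim=> [|n IH] /=; first by rewrite ger0_norm.
  by rewrite IH ger0_norm// min_r.
have mh n : measurable_fun setT (h n).
  elim: n => [|n IH] /=; first by apply: measurableT_comp => //; exact: Y_meas (Yf _).
  apply: measurable_minr => //; apply: measurableT_comp => //; exact: Y_meas (Yf _).
have Hn n : ae_eq mu setT (f n) (h n) by apply: filterS H => x hx _; rewrite hx.
have Yh n : Y (h n) by have [] := Y_ae XS (Yf n) (mh n) (Hn n).
have h0 n x : 0 <= h n x by elim: n => //= n IH; rewrite le_min IH normr_ge0.
have hS n x : h n.+1 x <= h n x by rewrite /= ge_min lexx.
have hc : {ae mu, forall x, h n x @[n --> \oo] --> (0 : R)}.
  apply: filterS2 H fc => x hx c.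
  by rewrite (_ : (fun n => h n x) = (fun n => f n x))//; apply/funext => n.
have [n Hn'] := SOC h Yh h0 hS hc e e0; exists n; apply: le_lt_trans Hn'.
have [] := Y_ae XS (Yh n) (Y_meas (Yf n)) _; last by [].
by apply: filterS H => x hx _.
Qed.

Section net.
Variables (I : Type) (le : I -> I -> Prop) (f : I -> T -> R).
Hypothesis dir : directed le.
Hypothesis Yf : forall i, Y (f i).
Hypothesis dec : decreases_to_0 mu Y le f.

Lemma directed_bound (p : nat -> I) n i0 :
  exists k, le i0 k /\ forall j, (j < n)%N -> le (p j) k.
Proof.
elim: n => [|n [k [i0k pk]]]; first by exists i0; split => //; exact: directed_refl.
have [k' [kk' pk']] := directed_ub dir k (p n).
exists k'; split; first exact: directed_trans kk'.
move=> j; rewrite ltnS leq_eqVlt => /orP[/eqP->//|jn].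
exact: directed_trans (pk _ jn) kk'.
Qed.

(** Truncation at 1 makes the integrals over sets of finite measure finite. *)
Let phi i x : R := Num.min `|f i x| 1.

Let mphi i : measurable_fun setT (phi i).
Proof.
by apply: measurable_minr => //; apply: measurableT_comp => //; exact: Y_meas (Yf i).
Qed.

Let phi_ge0 i x : 0 <= phi i x.
Proof. by rewrite le_min normr_ge0 ler01. Qed.

Let phi_le i j : le i j -> {ae mu, forall x, phi j x <= phi i x}.
Proof.
have [dS d0 _] := dec => ij; apply: filterS2 (dS _ _ ij) (d0 j) => x h h0.
rewrite /phi !ger0_norm//; last exact: le_trans h.
by rewrite le_min !ge_min h lexx orbT.
Qed.

Let dirI : exists i0 : I, True.
Proof. by have [i0] := directed_inh dir; exists i0. Qed.

(* On each set of finite measure the integrals of [min `|f i| 1] are brought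
   close to their infimum along a sequence; the limit of that sequence then
   lies below every [f i]. *)
Lemma net_cofinal_sequence : exists gam : nat -> I,
  (forall k, le (gam k) (gam k.+1)) /\
  {ae mu, forall x, f (gam k) x @[k --> \oo] --> (0 : R)}.
Proof.
have [F [FT ndF Ff]] := (sigma_finiteP _ _).1 mu_sigma_finite.
have mF n : measurable (F n) := (Ff n).1.
pose J n i := (\int[mu]_(x in F n) (phi i x)%:E)%E.
have J0 n i : (0 <= J n i)%E by apply: integral_ge0 => x _; rewrite lee_fin.
have mphiF n i : measurable_fun (F n) (fun x => (phi i x)%:E).
  by apply/measurable_EFinP; apply: measurable_funTS.
have JF n i : (J n i < +oo)%E.
  apply: le_lt_trans (Ff n).2.
  suff : (J n i <= \int[mu]_(x in F n) cst 1 x)%E by rewrite integral_cst// mul1e.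
  apply: ge0_le_integral => //.
    by move=> x _; rewrite lee_fin.
  by move=> x _; rewrite lee_fin ge_min lexx orbT.
have Jfin n i : J n i \is a fin_num by rewrite ge0_fin_numE.
have Jle n i j : le i j -> (J n j <= J n i)%E.
  move=> ij; apply: ae_ge0_le_integral => //.
  - by move=> x _; rewrite lee_fin.
  - by move=> x _; rewrite lee_fin.
  by apply: filterS (phi_le ij) => x h _; rewrite lee_fin.
have [i0 _] := dirI.
pose c n := inf [set fine (J n i) | i in [set: I]].
have hi n : has_inf [set fine (J n i) | i in [set: I]].
  split; first by exists (fine (J n i0)); exists i0.
  by exists 0 => _ [i _ <-]; rewrite fine_ge0.
have cle n i : c n <= fine (J n i) by apply: ge_inf; [exact: (hi n).2|exists i].
(* At stage [j] only the sets [F n] with [n <= j] are controlled, so directedness has to bound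
   finitely many indices only. *)
have step (a : nat * I) : exists y, le a.2 y /\
    forall n, (n <= a.1)%N -> fine (J n y) < c n + a.1.+1%:R^-1.
  case: a => j x /=.
  have e0 : 0 < j.+1%:R^-1 :> R by rewrite invr_gt0.
  have H n : exists i, fine (J n i) < c n + j.+1%:R^-1.
    by have [_ [i _ <-] h] := inf_adherent e0 (hi n); exists i.
  have [p Hp] := choice H.
  have [y [xy py]] := directed_bound p j.+1 x.
  exists y; split => // n nj; apply: le_lt_trans (Hp n).
  by apply: fine_le => //; apply: Jle; exact: py.
have [s Hs] := choice step.
pose gam := fix gam k := if k is j.+1 then s (j.+1, gam j) else s (0%N, i0).
have gamS k : le (gam k) (gam k.+1) := (Hs (k.+1, gam k)).1.
have gamJ k n : (n <= k)%N -> fine (J n (gam k)) < c n + k.+1%:R^-1.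
  by case: k => [|k] nk; [exact: (Hs (0%N, i0)).2|exact: (Hs (k.+1, gam k)).2].
exists gam; split => //.
pose g x := fine (limn_esup (fun k => (phi (gam k) x)%:E)).
have mg : measurable_fun setT g.
  apply: (measurableT_comp (fine_measurable measurableT)).
  by apply: measurable_fun_limn_esup => n; apply/measurable_EFinP.
have dS : {ae mu, forall x, forall k, phi (gam k.+1) x <= phi (gam k) x}.
  by apply: ae_foralln => k; exact: phi_le.
have gE : {ae mu, forall x, phi (gam k) x @[k --> \oo] --> g x /\
    (forall k, g x <= phi (gam k) x) /\ 0 <= g x}.
  apply: filterS dS => x h.
  have nd : {homo (fun k => phi (gam k) x) : i j / (i <= j)%N >-> j <= i}.
    by apply: (nincr_seq (u := fun k => phi (gam k) x)).
  have cx : cvgn (fun k => phi (gam k) x).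
    by apply: nonincreasing_is_cvgn => //; exists 0 => _ [k _ <-].
  have E : g x = limn (fun k => phi (gam k) x).
    have c' : (phi (gam k) x)%:E @[k --> \oo] --> (limn (fun k => phi (gam k) x))%:E.
      by apply: cvg_EFin => //; apply: nearW.
    by rewrite /g (cvg_limn_einf_sup c').2.
  rewrite E; split; [exact: cx|split].
    by move=> k; exact: nonincreasing_cvgn_ge.
  by apply: limr_ge => //; exact: nearW.
have gphi i : {ae mu, forall x, g x <= phi i x}.
  pose psi x : R := Num.max (g x - phi i x) 0.
  have mpsi : measurable_fun setT psi.
    by apply: measurable_maxr => //; exact: measurable_funB.
  have psi0 x : 0 <= psi x by rewrite le_max lexx orbT.
  have mpsiF n : measurable_fun (F n) (fun x => (psi x)%:E).
    by apply/measurable_EFinP; apply: measurable_funTS.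
  have Ipsi n k : (n <= k)%N ->
      (\int[mu]_(x in F n) (psi x)%:E <= (k.+1%:R^-1)%:E)%E.
    (* Beyond both [i] and [gam k]: where [g] exceeds [phi i], the overshoot plus [phi b <= phi i]
       is at most [g <= phi (gam k)]. The integrals of [phi b] and [phi (gam k)] differ by less than
       [1 / k.+1], which bounds the overshoot. *)
    move=> nk; have [b [ib gb]] := directed_ub dir i (gam k).
    have H : (\int[mu]_(x in F n) (psi x)%:E + J n b <= J n (gam k))%E.
      rewrite /J -ge0_integralD//; last 2 first.
      - by move=> x _; rewrite lee_fin.
      - by move=> x _; rewrite lee_fin.
      apply: ae_ge0_le_integral => //.
      - by move=> x _; rewrite -EFinD lee_fin addr_ge0.
      - exact: emeasurable_funD.
      - by move=> x _; rewrite lee_fin.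
      apply: filterS2 gE (filterI (phi_le ib) (phi_le gb)) => x [_ [gx _]] [h1 h2] _.
      rewrite -EFinD lee_fin /psi; have := gx k.
      by have [m0|m0] := leP (g x - phi i x) 0; move: h1 h2; lra.
    have psifin : (\int[mu]_(x in F n) (psi x)%:E)%E \is a fin_num.
      rewrite ge0_fin_numE; last by apply: integral_ge0 => x _; rewrite lee_fin.
      apply: le_lt_trans (JF n (gam k)); apply: le_trans H.
      by rewrite leeDl.
    have {}H : fine (\int[mu]_(x in F n) (psi x)%:E) + fine (J n b) <= fine (J n (gam k)).
      by rewrite -lee_fin EFinD !fineK.
    rewrite -(fineK psifin) lee_fin.
    rewrite -(lerD2r (fine (J n b))); apply: le_trans H _.
    apply: le_trans (ltW (gamJ k n nk)) _.
    by rewrite addrC lerD2l; exact: cle.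
  have Z n : ae_eq mu (F n) psi (cst 0).
    have I0 : (\int[mu]_(x in F n) (psi x)%:E = 0)%E.
      apply/eqP; rewrite eq_le; apply/andP; split; last first.
        by apply: integral_ge0 => x _; rewrite lee_fin.
      apply/lee_addgt0Pr => e e0; rewrite add0e.
      have [K _ HK] := near_infty_natSinv_lt (PosNum e0).
      apply: le_trans (Ipsi n (maxn n K) (leq_maxl _ _)) _.
      by rewrite lee_fin ltW//; exact: (HK _ (leq_maxr n K)).
    have Iabs : (\int[mu]_(x in F n) `|(EFin \o psi) x| = 0)%E.
      rewrite -[RHS]I0; apply: eq_integral => x _ /=.
      by rewrite ger0_norm.
    have mp : measurable_fun (F n) (EFin \o psi) by exact: mpsiF.
    have := (ae_eq_integral_abs mu (mF n) mp).1 Iabs.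
    by apply: filterS => x h /h [].
  apply: filterS (ae_foralln Z) => x h.
  have : setT x by []. rewrite FT => -[n _ Fx].
  have := h n Fx; rewrite /psi => /= h0.
  by rewrite -subr_le0 -h0 le_max lexx.
have [_ d0 dinf] := dec.
have Yg : Y g.
  have [] := Y_le XS (Yf (gam 0%N)) mg _; last by [].
  apply: filterS gE => x [_ [gx g0]]; rewrite ger0_norm//.
  by apply: le_trans (gx 0%N) _; rewrite ge_min lexx.
have g0 : {ae mu, forall x, g x <= 0}.
  apply: dinf => // i; apply: filterS2 (gphi i) (d0 i) => x h h0.
  by apply: le_trans h _; rewrite /phi ger0_norm// ge_min lexx.
have d0' : {ae mu, forall x, forall k, 0 <= f (gam k) x}.
  by apply: ae_foralln => k; exact: d0.
apply: filterS2 (filterI gE g0) d0' => x [[c1 [_ c3]] c2] c4.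
have gx0 : g x = 0 by apply/eqP; rewrite eq_le c2 c3.
rewrite gx0 in c1.
(* Below 1 the truncation in [phi] is inactive. *)
apply/cvgrPdist_lt => e e0; have e1 : 0 < Num.min e 1 by rewrite lt_min e0 ltr01.
move/cvgrPdist_lt : c1 => /(_ _ e1); apply: filterS => k /=.
rewrite !sub0r !normrN (ger0_norm (phi_ge0 _ _)) lt_min => /andP[h1 h2].
move: h1 h2; rewrite /phi !gt_min ltxx !orbF => /orP[//|h1] h2.
exact: lt_trans h2 h1.
Qed.

End net.

Lemma order_continuous_of_seq : seq_order_continuous mu X normX ->
  order_continuous mu Y N.
Proof.
move=> SOC I le f dir Yf dec; have [dS d0 _] := dec.
have mono i j : le i j -> N (f j) <= N (f i).
  move=> ij; have [] := Y_le XS (Yf i) (Y_meas (Yf j)) _; last by [].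
  apply: filterS2 (dS _ _ ij) (d0 j) => x h h0.
  by rewrite !ger0_norm//; exact: le_trans h.
split => //.
have [gam [gamS gamc]] := net_cofinal_sequence dir Yf dec.
set S := [set N (f i) | i in [set: I]].
have lb : lbound S 0 by move=> _ [i _ <-]; exact: (N_ge0 XS).
have S0 : S !=set0 by exists (N (f (gam 0%N))); exists (gam 0%N).
apply/eqP; rewrite eq_le lb_le_inf// andbT; apply/ler_addgt0Pr => e e0.
rewrite add0r.
have [||||n Hn] := @seq_order_continuous_ae (f \o gam) SOC _ _ _ _ e e0.
- by move=> n; exact: Yf.
- by move=> n; exact: d0.
- by move=> n; exact: dS.
- exact: gamc.
apply: le_trans (ltW Hn); apply: ge_inf; first by exists 0.
by exists (gam n).
Qed.

End order_continuity_from_sequences.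

(** * Necessity of functions outside of L1 *)

Lemma sum_single {R : realType} (c : nat -> R) K n : (forall k, k != K -> c k = 0) ->
  \sum_(k < n) c k = if (K < n)%N then c K else 0.
Proof.
move=> H; elim: n => [|n IH]; first by rewrite big_ord0.
rewrite big_ord_recr/= IH ltnS; case: (ltngtP K n) => [Kn|nK|->].
- by rewrite (H n) ?addr0// gtn_eqF.
- by rewrite (H n) ?addr0// ltn_eqF.
- by rewrite add0r.
Qed.

Section shift_operator.
Context {R : realType} {d : measure_display} {T : measurableType d}.
Variables (mu : {measure set T -> \bar R}).
Hypothesis mu_infinite : mu setT = +oo%E.
Variable A : nat -> set T.
Hypothesis mA : forall k, measurable (A k).
Hypothesis tA : trivIset setT A.
Hypothesis finA : forall k, (mu (A k) < +oo)%E.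
Hypothesis A0 : (0 < mu (A 0))%E.
Hypothesis AS : forall k, (mu (A k) <= mu (A k.+1))%E.
Implicit Types f g : T -> R.
Local Notation Ph := (Phi mu setT).

Let a k : R := fine (mu (A k)).

Let aE k : mu (A k) = (a k)%:E.
Proof. by rewrite fineK// ge0_fin_numE. Qed.

Let aS k : a k <= a k.+1.
Proof. by rewrite -lee_fin -!aE. Qed.

Let a0k k : a 0 <= a k.
Proof. by elim: k => // k IH; exact: le_trans IH (aS k). Qed.

Let a_gt0 k : 0 < a k.
Proof. by apply: lt_le_trans (a0k k); rewrite -lte_fin -aE. Qed.

Let A_eq i j x : A i x -> A j x -> i = j.
Proof. by move=> Ai Aj; apply: tA => //; exists x. Qed.

Let weight f k : R := (\int[mu]_(x in A k) f x) / a k.+1.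

Let term f k x : R := weight f k * \1_(A k.+1) x.

(* The averages of [f] over [A k] are moved to [A k.+1], and rescaled so that
   the integral is kept. *)
Definition shift_op f : T -> R := limf (term f).

Lemma shift_opE f k x : A k.+1 x -> shift_op f x = weight f k.
Proof.
move=> Ax; apply: limfE.
have H j : j != k -> term f j x = 0.
  move=> jk; rewrite /term indicE memNset ?mulr0// => Aj.
  by have [/eqP] := A_eq Aj Ax; apply/negP.
apply: cvg_near_cst; exists k.+1 => // n /= kn.
by rewrite /sumf (sum_single n H) kn /term indicE mem_set// mulr1.
Qed.

Lemma shift_op0 f x : (forall k, ~ A k.+1 x) -> shift_op f x = 0.
Proof.
move=> nA; apply: limfE.
apply: cvg_near_cst; apply: nearW => n.
by rewrite /sumf big1// => i _; rewrite /term indicE memNset// mulr0.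
Qed.

Let shift_case f x : (exists2 k, A k.+1 x & shift_op f x = weight f k) \/
  (forall k, ~ A k.+1 x) /\ shift_op f x = 0.
Proof.
have [[k Ak]|nA] := pselect (exists k, A k.+1 x).
  by left; exists k => //; exact: shift_opE.
have H k : ~ A k.+1 x by move=> Ak; apply: nA; exists k.
by right; split => //; exact: shift_op0.
Qed.

Lemma measurable_shift_op f : measurable_fun setT (shift_op f).
Proof. by apply: measurable_limf => k; apply: measurable_funM. Qed.

Let integral_A_fin f k : L1Linf mu f -> (\int[mu]_(x in A k) (`|f x|)%:E < +oo)%E.
Proof.
move=> /(L1LinfP mu_infinite)[mf [l l0 h]].
have mfA : measurable_fun (A k) f by exact: measurable_funTS.
apply: le_lt_trans (integral_le_Phi mu (mA k) mfA l0) _.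
apply: lte_add_pinfty; first by rewrite aE -EFinM ltry.
by apply: le_lt_trans h; exact: (Phi_subset mu (mA k) l measurableT mf).
Qed.

Let integrable_A f k : L1Linf mu f -> mu.-integrable (A k) (EFin \o f).
Proof.
move=> Lf; have /(L1LinfP mu_infinite)[mf _] := Lf.
apply/integrableP; split; first by apply/measurable_EFinP; exact: measurable_funTS.
exact: integral_A_fin.
Qed.

Let weight_norm f k : L1Linf mu f ->
  ((`|weight f k| * a k.+1)%:E <= \int[mu]_(x in A k) (`|f x|)%:E)%E.
Proof.
move=> Lf; have i0 : 0 <= (a k.+1)^-1 by rewrite invr_ge0 ltW.
rewrite normrM (ger0_norm i0).
rewrite mulfVK ?gt_eqF// (EFin_normr_Rintegral (mA k) (integrable_A k Lf)).
apply: le_trans (le_abse_integral mu (mA k) _) _ => //.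
by have /integrableP[] := integrable_A k Lf.
Qed.

Let weight_lin c f g k : L1Linf mu f -> L1Linf mu g ->
  weight (fun x => c * f x + g x) k = c * weight f k + weight g k.
Proof.
move=> Lf Lg; have If := integrable_A k Lf; have Ig := integrable_A k Lg.
have Icf : mu.-integrable (A k) (EFin \o (fun x => c * f x)).
  by have := integrableZl (mA k) c If.
by rewrite /weight (RintegralD (mA k) Icf Ig) RintegralZl// mulrDl mulrA.
Qed.

Let shift_lin c f g x : L1Linf mu f -> L1Linf mu g ->
  shift_op (fun x => c * f x + g x) x = c * shift_op f x + shift_op g x.
Proof.
move=> Lf Lg; have [[k Ak _]|[nA _]] := shift_case f x.
  by rewrite !(shift_opE _ Ak) weight_lin.
by rewrite !shift_op0// mulr0 addr0.
Qed.

Lemma shift_Phi f : L1Linf mu f -> (Ph (shift_op f) 0 <= Ph f 0)%E.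
Proof.
move=> Lf; have /(L1LinfP mu_infinite)[mf _] := Lf.
have mn : measurable_fun setT (fun x => (`|f x|)%:E).
  by apply/measurable_EFinP; exact: measurableT_comp.
pose t k x := ((`|weight f k|)%:E * (\1_(A k.+1) x)%:E)%E.
have t0 k x : (0 <= t k x)%E by rewrite mule_ge0 ?lee_fin.
have mt k : measurable_fun setT (t k).
  by apply: measurable_funeM; apply/measurable_EFinP; exact: measurable_indic.
rewrite !Phi0E.
apply: (@le_trans _ _ (\int[mu]_x (\sum_(0 <= k <oo) t k x))%E).
  apply: ge0_le_integral => //.
  - by apply/measurable_EFinP; apply: measurableT_comp => //; exact: measurable_shift_op.
  - by apply: (@ge0_emeasurable_sum _ _ _ _ _ xpredT).
  move=> x _; have [[k Ak ->]|[_ ->]] := shift_case f x; last first.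
    by rewrite normr0; apply: nneseries_ge0.
  apply: le_trans (@nneseries_lim_ge _ (t ^~ x) xpredT 0 k.+1 _) => //.
  rewrite big_nat_recr//= {2}/t indicE mem_set// mule1 leeDr//.
  by apply: sume_ge0.
rewrite integral_nneseries//.
have mf' : measurable_fun (\bigcup_k A k) (fun x => (`|f x|)%:E).
  exact: measurable_funTS.
apply: (@le_trans _ _ (\int[mu]_(x in \bigcup_k A k) (`|f x|)%:E)%E); last first.
  by apply: ge0_subset_integral => //; exact: bigcupT_measurable.
rewrite ge0_integral_bigcup//; apply: lee_nneseries.
  by move=> k _ _; apply: integral_ge0.
move=> k _; rewrite ge0_integralZl//; last first.
  by apply/measurable_EFinP; exact: measurable_indic.
rewrite integral_indic// setIT aE -EFinM; exact: weight_norm.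
Qed.

(** The mean over [A k] is rescaled by [a k / a k.+1], which is at most 1 because the measures are
    nondecreasing. *)
Lemma shift_bound f (M : R) : L1Linf mu f -> 0 <= M ->
  {ae mu, forall x, `|f x| <= M} -> forall x, `|shift_op f x| <= M.
Proof.
move=> Lf M0 fM x; have /(L1LinfP mu_infinite)[mf _] := Lf.
have [[k _ ->]|[_ ->]] := shift_case f x; last by rewrite normr0.
have H : ((`|weight f k| * a k.+1)%:E <= M%:E * mu (A k))%E.
  apply: le_trans (weight_norm k Lf) _; rewrite -integral_cst//.
  apply: ae_ge0_le_integral => //.
    by apply/measurable_EFinP; apply: measurable_funTS; exact: measurableT_comp.
  by apply: filterS fM => y h _; rewrite lee_fin.
move: H; rewrite aE -EFinM lee_fin => H.
rewrite -(ler_pM2r (a_gt0 k.+1)); apply: le_trans H _.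
exact: ler_wpM2l.
Qed.

Lemma DS_shift_op : DS mu shift_op.
Proof.
have L1s f : f \in Lfun mu 1 -> shift_op f \in Lfun mu 1.
  move=> f1; have /Lfun1P[mf h] := f1; apply/Lfun1P; split.
    exact: measurable_shift_op.
  by apply: le_lt_trans h; apply: shift_Phi; exact: L1Linf_Lfun1.
have Lys f : f \in Lfun mu +oo -> shift_op f \in Lfun mu +oo.
  move=> fy; have /(LfunyP mu_infinite)[mf [M M0 fM]] := fy.
  apply/(LfunyP mu_infinite); split; first exact: measurable_shift_op.
  exists M => //; apply: nearW; apply: shift_bound => //.
  exact: L1Linf_Lfuny.
split.
- move=> f Lf; have [g [h [g1 hy E]]] := Lf.
  have Lg := L1Linf_Lfun1 mu_infinite g1; have Lh := L1Linf_Lfuny mu_infinite hy.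
  exists (shift_op g), (shift_op h); split; [exact: L1s|exact: Lys|].
  apply/funext => x; rewrite E (_ : g \+ h = (fun x => 1 * g x + h x)).
    by rewrite shift_lin// mul1r.
  by apply/funext => y; rewrite mul1r.
- move=> f g Lf Lg fg; apply: nearW => x _.
  have W k : weight f k = weight g k.
    rewrite /weight /Rintegral; congr (fine _ / _); apply: ae_eq_integral => //.
    + by have /integrableP[] := integrable_A k Lf.
    + by have /integrableP[] := integrable_A k Lg.
    + by apply: filterS fg => y h _ /=; rewrite h.
  have [[k Ak ->]|[nA ->]] := shift_case f x; last by rewrite shift_op0.
  by rewrite (shift_opE _ Ak).
- by move=> c f g Lf Lg; apply: nearW => x _; exact: shift_lin.
- by move=> f f1; rewrite !Lnorm1_Phi; apply: shift_Phi; exact: L1Linf_Lfun1.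
- move=> f fy; apply: (Lnormy_le mu_infinite fy) => M M0 fM; apply: nearW.
  by apply: shift_bound => //; exact: L1Linf_Lfuny.
Qed.

Lemma shift_indic c k :
  shift_op (fun x => c * \1_(A k) x) = (fun x => c * a k / a k.+1 * \1_(A k.+1) x).
Proof.
have I k' : mu.-integrable (A k') (EFin \o (\1_(A k) : T -> R)).
  have Y1 : bounded_integrable mu (\1_(A k) : T -> R).
    split; first exact: measurable_indic.
      exists 1 => //; apply: nearW => x; rewrite ger0_norm ?indicE//.
      by case: (_ \in _).
    rewrite Phi0E; under eq_integral => x _ do rewrite ger0_norm ?indicE//.
    by under eq_integral => x _ do rewrite -indicE; rewrite integral_indic// setIT.
  exact: integrable_A (BI_L1Linf mu_infinite Y1).
apply/funext => x; have [[j Aj ->]|[nA ->]] := shift_case (fun x => c * \1_(A k) x) x.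
  rewrite /weight RintegralZl// /Rintegral integral_indic// indicE.
  have [<-|jk] := eqVneq j k.
    by rewrite setIid mem_set// mulr1.
  have -> : A k `&` A j = set0.
    rewrite -subset0 => y [Ak Aj']; have := A_eq Ak Aj'.
    by move=> E; rewrite E eqxx in jk.
  rewrite measure0 mulr0 mul0r memNset ?mulr0// => Ak.
  by have [E] := A_eq Aj Ak; rewrite E eqxx in jk.
by rewrite indicE memNset ?mulr0.
Qed.

Lemma iter_shift_indic k :
  iter k shift_op (\1_(A 0%N)) = (fun x => a 0 / a k * \1_(A k) x).
Proof.
elim: k => [|k IH].
  by apply/funext => x; rewrite /= mulfV ?mul1r// gt_eqF.
rewrite iterS IH shift_indic; apply/funext => x.
by rewrite mulfVK// gt_eqF.
Qed.

(** The iterates have disjoint supports and values in [[0, 1]], so at each point at most one term of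
    the sum is nonzero. *)
Lemma average_shift_bound n x :
  0 <= average shift_op n (\1_(A 0%N)) x <= n%:R^-1.
Proof.
rewrite /average; under eq_bigr do rewrite iter_shift_indic.
pose c k : R := a 0 / a k * \1_(A k) x.
have c0 k : 0 <= c k by rewrite mulr_ge0// ?divr_ge0 ?ltW// indicE.
have c1 k : c k <= 1.
  rewrite -[leRHS]mulr1; apply: ler_pM; rewrite ?divr_ge0 ?(ltW (a_gt0 _))// ?indicE//.
  by rewrite ler_pdivrMr// mul1r.
apply/andP; split.
  by rewrite mulr_ge0 ?invr_ge0//; apply: sumr_ge0 => i _; exact: c0.
rewrite -[leRHS]mulr1; apply: ler_wpM2l; first by rewrite invr_ge0.
rewrite -/(\sum_(k < n) c k).
have [[K AK]|nA] := pselect (exists K, A K x).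
  have H k : k != K -> c k = 0.
    move=> kK; rewrite /c indicE memNset ?mulr0// => Ak.
    by move: kK; rewrite (A_eq Ak AK) eqxx.
  by rewrite (sum_single n H); case: ifP.
rewrite big1// => i _; rewrite /c indicE memNset ?mulr0// => Ai.
by apply: nA; exists i.
Qed.

Lemma average_shift_Phi n : (0 < n)%N ->
  Ph (average shift_op n (\1_(A 0%N))) 0 = mu (A 0%N).
Proof.
move=> n0; rewrite Phi0E.
pose t k x := ((a 0 / a k)%:E * (\1_(A k) x)%:E)%E.
have q0 k : 0 <= a 0 / a k by rewrite divr_ge0 ?ltW.
have t0 k x : (0 <= t k x)%E by rewrite mule_ge0 ?lee_fin.
have mt k : measurable_fun setT (t k).
  by apply: measurable_funeM; apply/measurable_EFinP; exact: measurable_indic.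
rewrite (eq_integral (fun x => (n%:R^-1)%:E * (\sum_(k < n) t k x))%E); last first.
  move=> x _; have /andP[h _] := average_shift_bound n x.
  rewrite ger0_norm// /average EFinM -sumEFin; congr (_ * _)%E.
  by apply: eq_bigr => i _; rewrite iter_shift_indic EFinM.
rewrite ge0_integralZl//; last 2 first.
- exact: emeasurable_sum.
- by move=> x _; apply: sume_ge0.
rewrite ge0_integral_sum//.
rewrite (eq_bigr (fun=> (a 0)%:E)); last first.
  move=> i _; rewrite /t ge0_integralZl//; last first.
  - by rewrite lee_fin.
  - by apply/measurable_EFinP; exact: measurable_indic.
  by rewrite integral_indic// setIT aE -EFinM mulfVK// gt_eqF.
rewrite sumEFin sumr_const card_ord -EFinM aE -[a 0 *+ n]mulr_natl mulrA mulVf ?mul1r//.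
by rewrite pnatr_eq0 -lt0n.
Qed.

End shift_operator.

Section partition_of_increasing_measure.
Context {R : realType} {d : measure_display} {T : measurableType d}.
Variables (mu : {measure set T -> \bar R}).
Hypothesis mu_infinite : mu setT = +oo%E.
Hypothesis mu_sigma_finite : sigma_finite setT mu.

(** Differences of an exhausting sequence, thinned so that each set has more than twice the measure
    of the one before. A difference then outweighs the whole set removed, which contains the
    preceding difference. *)
Lemma increasing_measure_family : exists A : nat -> set T,
  [/\ forall k, measurable (A k), trivIset setT A, forall k, (mu (A k) < +oo)%E,
      (0 < mu (A 0%N))%E & forall k, (mu (A k) <= mu (A k.+1))%E].
Proof.
have [F [FT ndF Ff]] := (sigma_finiteP _ _).1 mu_sigma_finite.
have mF n : measurable (F n) := (Ff n).1.
have finF n : (mu (F n) < +oo)%E := (Ff n).2.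
have Fle i j : (i <= j)%N -> F i `<=` F j by move=> ij; exact/subsetPset/ndF.
have muF : mu (F n) @[n --> \oo] --> +oo%E.
  have := @nondecreasing_cvg_mu _ _ _ mu F mF (bigcupT_measurable _ mF) ndF.
  by rewrite -FT mu_infinite.
have large (c : R) n : exists2 n', (n <= n')%N & (c%:E < mu (F n'))%E.
  apply: contrapT => H.
  have H' k : (mu (F k) <= c%:E)%E.
    apply: (@le_trans _ _ (mu (F (maxn n k)))).
      by apply: le_measure; rewrite ?inE//; exact: Fle (leq_maxr _ _).
    by rewrite leNgt; apply/negP => h; apply: H; exists (maxn n k) => //; exact: leq_maxl.
  have : (+oo <= c%:E :> \bar R)%E.
    rewrite -(cvg_lim _ muF)//; apply: lime_le; first by apply/cvg_ex; eexists; exact: muF.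
    exact: nearW.
  by rewrite leye_eq.
have step n : exists n', (n <= n')%N /\ (mu (F n) <= mu (F n' `\` F n))%E.
  have fn : mu (F n) \is a fin_num by rewrite ge0_fin_numE.
  have [n' nn' h] := large (2 * fine (mu (F n))) n; exists n'; split => //.
  rewrite measureD//; last exact: finF.
  have -> : F n' `&` F n = F n by apply/setIidr; exact: Fle.
  rewrite leeBrDr//; apply: le_trans (ltW h).
  by rewrite EFinM fineK// mule_natl mule2n.
have [s Hs] := choice step.
(* Starting from measure above 1 makes the first difference of positive measure. *)
have [n0 _ h0] := large 1 0%N.
pose nk k := iter k s n0.
have nkS k : (nk k <= nk k.+1)%N := (Hs (nk k)).1.
have nk_le i j : (i <= j)%N -> (nk i <= nk j)%N.
  move=> /subnK <-; elim: (j - i)%N => //= k IH.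
  exact: leq_trans IH (nkS _).
have muS k : (mu (F (nk k)) <= mu (F (nk k.+1) `\` F (nk k)))%E := (Hs (nk k)).2.
exists (fun k => F (nk k.+1) `\` F (nk k)); split.
- by move=> k; exact: measurableD.
- have H i j : (i < j)%N ->
      ~ ((F (nk i.+1) `\` F (nk i)) `&` (F (nk j.+1) `\` F (nk j)) !=set0).
    move=> ij [x [[Fi _] [_ nFj]]]; apply: nFj.
    exact: (Fle _ _ (nk_le _ _ ij)).
  move=> i j _ _ h; case: (ltngtP i j) => // ij.
    by have := H _ _ ij.
  by rewrite setIC in h; have := H _ _ ij.
- move=> k; apply: le_lt_trans (finF (nk k.+1)).
  by apply: le_measure; rewrite ?inE//; exact: measurableD.
- apply: lt_le_trans (muS 0%N); apply: lt_trans h0.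
  by rewrite lte_fin ltr01.
- move=> k; apply: le_trans (muS k.+1).
  by apply: le_measure; rewrite ?inE//; exact: measurableD.
Qed.

End partition_of_increasing_measure.

Section necessity_of_non_L1.
Context {R : realType} {d : measure_display} {T : measurableType d}.
Variables (mu : {measure set T -> \bar R}).
Hypothesis mu_infinite : mu setT = +oo%E.
Hypothesis mu_sigma_finite : sigma_finite setT mu.
Variables (X : set (lebesgueType R -> R)) (normX : (lebesgueType R -> R) -> R).
Hypothesis XS : fully_symmetric X normX.
Implicit Types f g : T -> R.
Local Notation Y := (space_on mu X).
Local Notation N := (norm_on mu normX).
Local Notation Ph := (Phi mu setT).

(** Otherwise some [g k] has L1 norm above [4 ^ k * N (g k)]. The absolute values, rescaled to norm
    at most [2^-k], sum in [Y] to a function dominating each of them, whose L1 norm is thus at least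
    every [2 ^ k]. *)
Lemma L1_norm_bound : Y `<=` L1 mu ->
  exists2 C : R, 0 <= C & forall g, Y g -> (Ph g 0 <= (C * N g)%:E)%E.
Proof.
move=> YL1; apply: contrapT => H.
have H' k : exists g, Y g /\ ((4 ^+ k * N g)%:E < Ph g 0)%E.
  apply: contrapT => H'; apply: H; exists (4 ^+ k); first by rewrite exprn_ge0.
  by move=> g Yg; rewrite leNgt; apply/negP => h; apply: H'; exists g.
have [g Hg] := choice H'.
have Yg k : Y (g k) := (Hg k).1.
have Ng k : 0 < N (g k).
  rewrite lt0r (N_ge0 XS (Yg k)) andbT; apply/eqP => z.
  have [_ h] := Hg k.
  have := (Phi_ae0 mu measurableT (Y_meas (Yg k))).2 (N_eq0 XS (Yg k) z).
  by move=> z'; move: h; rewrite z z' mulr0 ltxx.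
pose q k := 2^-1 ^+ k / N (g k).
have q0 k : 0 < q k by rewrite divr_gt0// exprn_gt0// invr_gt0.
have mg k : measurable_fun setT (g k) := Y_meas (Yg k).
pose u k x := q k * `|g k x|.
have mu_ k : measurable_fun setT (u k).
  by apply: measurable_funM => //; exact: measurableT_comp.
have u0 k x : 0 <= u k x by rewrite mulr_ge0// ltW.
have Hu k : Y (u k) /\ N (u k) <= 1 * 2^-1 ^+ k.
  have [YZ NZ] := Y_Z XS (q k) (Yg k).
  have [] := Y_le XS YZ (mu_ k) _.
    by apply: nearW => x; rewrite /u !normrM normr_id.
  move=> Y1 N1; split => //; apply: le_trans N1 _; apply: le_trans NZ _.
  by rewrite (ger0_norm (ltW (q0 k))) mul1r /q mulfVK// gt_eqF.
have [Yr _ cr] := Y_series XS (fun k => (Hu k).1) (fun k => (Hu k).2).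
have ur k : {ae mu, forall x, u k x <= limf u x}.
  apply: filterS cr => x c; rewrite -(cvg_lim _ c)//.
  apply: limr_ge; first by apply/cvg_ex; eexists; exact: c.
  exists k.+1 => // n /= kn.
  rewrite /sumf -(big_mkord xpredT (fun j => u j x)) (@big_cat_nat _ _ _ k.+1)//=.
  rewrite big_nat_recr//= -addrA addrCA lerDl addr_ge0//; apply: sumr_ge0 => i _ //.
have /Lfun1P[mr Pr] := YL1 _ Yr.
have Pf : Ph (limf u) 0 \is a fin_num by rewrite ge0_fin_numE// Phi_ge0.
have big k : 2 ^+ k <= fine (Ph (limf u) 0).
  rewrite -lee_fin fineK//; apply: (@le_trans _ _ (Ph (u k) 0)).
    have E : Ph (u k) 0 = ((q k)%:E * Ph (g k) 0)%E.
      have := PhiZ mu measurableT (q k) 0 (mg k).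
      rewrite mulr0 (ger0_norm (ltW (q0 k))) => <-.
      by rewrite !Phi0E; apply: eq_integral => x _; rewrite /u !normrM normr_id.
    rewrite E; apply: le_trans (lee_wpmul2l _ (ltW (Hg k).2)); last first.
      by rewrite lee_fin ltW.
    rewrite -EFinM lee_fin /q.
    have -> : 2^-1 ^+ k / N (g k) * (4 ^+ k * N (g k)) = 2^-1 ^+ k * 4 ^+ k.
      by field; rewrite gt_eqF.
    rewrite -exprMn (_ : 2^-1 * 4 = 2)//; by field.
  apply: (Phi_le_norm measurableT _ mr (mu_ k)); apply: filterS (ur k) => x h _.
  by rewrite ger0_norm//; apply: le_trans h (ler_norm _).
have := big (Num.bound (fine (Ph (limf u) 0))).
rewrite leNgt => /negP; apply.
have P0 : 0 <= fine (Ph (limf u) 0) by rewrite fine_ge0// Phi_ge0.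
apply: lt_trans (archi_boundP P0) _.
by rewrite -natrX ltr_nat ltn_expl.
Qed.

(** By [L1_norm_bound], convergence in [Y] is convergence in L1. Since
    [|fhat| - 1 / m <= |B m - fhat|], the excess of [fhat] over every positive height vanishes, so
    [fhat] is zero, although each [B m] with [m > 0] has L1 norm [mu (A 0)]. *)
Lemma averages_not_L1 :
  (forall U : (T -> R) -> (T -> R), DS mu U -> averages_converge_strongly Y N U) ->
  ~ (Y `<=` L1 mu).
Proof.
move=> AC YL1; have [C C0 HC] := L1_norm_bound YL1.
have [A [mA tA finA A0 AS]] := increasing_measure_family mu_infinite mu_sigma_finite.
pose U := shift_op mu A; have DU : DS mu U by exact: DS_shift_op.
have Yf : Y (\1_(A 0%N) : T -> R) by exact: (Y_indic XS).
have [fhat Yfhat cf] := AC U DU _ Yf.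
pose B n := average U n (\1_(A 0%N)).
have YB n : Y (B n) := (Y_average mu_infinite XS DU n Yf).1.
have small (e : R) : 0 < e -> exists K0, forall n, (K0 <= n)%N ->
    (Ph (B n \- fhat)%R 0 < e%:E)%E.
  move=> e0; have e1 : 0 < e / (C + 1) by rewrite divr_gt0// ltr_wpDl.
  move/cvgrPdist_lt : cf => /(_ _ e1)[K0 _ HK]; exists K0 => n Kn.
  have [YD _] := Y_B XS (YB n) Yfhat.
  apply: le_lt_trans (HC _ YD) _; rewrite lte_fin.
  have := HK n Kn; rewrite /= sub0r normrN ger0_norm; last exact: (N_ge0 XS).
  rewrite -/(B n) ltr_pdivlMr; last by rewrite ltr_wpDl.
  apply: le_lt_trans; rewrite mulrC.
  by apply: ler_wpM2l; [exact: (N_ge0 XS)|rewrite lerDl].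
have mfhat := Y_meas Yfhat.
have fhat0 : (Ph fhat 0 <= 0)%E.
  apply: Phi0_le_lim => // n; apply/lee_addgt0Pr => e e0; rewrite add0e.
  have [K0 HK] := small e e0; pose m := maxn n.+1 K0.
  have m0 : (0 < m)%N by rewrite /m leq_max.
  have m0' : 0 < m%:R :> R by rewrite ltr0n.
  apply: le_trans (ltW (HK m (leq_maxr _ _))).
  apply: (@le_trans _ _ (Ph fhat m%:R^-1)).
    apply: le_Phi => //; rewrite lef_pV2 ?posrE// ler_nat.
    exact: leq_maxl.
  have [YD _] := Y_B XS (YB m) Yfhat.
  apply: (Phi_le_ae measurableT (Y_meas YD) mfhat); apply: nearW => x _.
  have /andP[b0 b1] := average_shift_bound mu_infinite mA tA finA A0 AS m x.
  rewrite subr0 /=; rewrite -/(B m x) in b0 b1.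
  have := ler_normD (fhat x - B m x) (B m x).
  by rewrite subrK (ger0_norm b0) distrC; lra.
have fA : mu (A 0%N) \is a fin_num by rewrite ge0_fin_numE.
have [K0 HK] := small (fine (mu (A 0%N))) (fine_gt0 (introT andP (conj A0 (finA 0%N)))).
have := HK K0.+1 (leqnSn _); rewrite fineK// ltNge => /negP; apply.
have [YD _] := Y_B XS (YB K0.+1) Yfhat.
rewrite -(average_shift_Phi mu_infinite mA tA finA A0 AS (ltn0Sn K0)).
have := PhiD mu measurableT 0 0 (Y_meas YD) mfhat.
rewrite addr0 (_ : _ \+ fhat = B K0.+1); last by apply/funext => x /=; rewrite subrK.
move=> h; apply: le_trans h _; rewrite -[leRHS]adde0; exact: leeD.
Qed.

End necessity_of_non_L1.

Theorem theorem4p5 (R : realType) (d : measure_display) (T : measurableType d)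
    (mu : {measure set T -> \bar R})
    (mu_complete : measure_is_complete mu)
    (mu_sigma_finite : sigma_finite setT mu)
    (mu_infinite : mu setT = +oo%E)
    (X : set (lebesgueType R -> R)) (normX : (lebesgueType R -> R) -> R)
    (X_fully_symmetric : fully_symmetric X normX) :
  (order_continuous mu (space_on mu X) (norm_on mu normX) ->
   ~ (space_on mu X `<=` L1 mu) ->
   forall U : (T -> R) -> (T -> R), DS mu U ->
     averages_converge_strongly (space_on mu X) (norm_on mu normX) U)
  /\
  (quasi_non_atomic mu ->
   (forall U : (T -> R) -> (T -> R), DS mu U ->
     averages_converge_strongly (space_on mu X) (norm_on mu normX) U) ->
   order_continuous mu (space_on mu X) (norm_on mu normX) /\
   ~ (space_on mu X `<=` L1 mu)).

Proof.
split.
  move=> OC YL1 U DU.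
  exact: (averages_converge mu_infinite mu_sigma_finite X_fully_symmetric
    (OC_seq X_fully_symmetric OC) YL1 DU).
move=> _ conv; split; last exact: (averages_not_L1 mu_infinite mu_sigma_finite X_fully_symmetric conv).
apply: (order_continuous_of_seq mu_sigma_finite X_fully_symmetric).
exact: (averages_seq_order_continuous mu_infinite X_fully_symmetric conv).
Qed.
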